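(* Let $p\ge 0$ be an integer, let $q\ge 1$ be an odd integer, let $D\subseteq\mathbb{R}^{p+2}$ be a domain invariant under the reflection $(\boldsymbol{x}_p,r)\mapsto(\boldsymbol{x}_p,-r)$, and let $f(\boldsymbol{x})=F_1(\boldsymbol{x}')+\underline{\omega}F_2(\boldsymbol{x}')\in\mathcal{GSR}(\Omega_D)$. Then the function $$\tau_q f(\boldsymbol{x}):=\frac{1}{(q-1)!!}\,\Delta_{\boldsymbol{x}}^{\frac{q-1}{2}}f(\boldsymbol{x})=A(\boldsymbol{x}')+\underline{\omega}B(\boldsymbol{x}'),$$ where $$A(\boldsymbol{x}')=\Big(\frac1r\partial_r\Big)^{\frac{q-1}{2}}F_1(\boldsymbol{x}'),\qquad B(\boldsymbol{x}')=\Big(\partial_r\frac1r\Big)^{\frac{q-1}{2}}F_2(\boldsymbol{x}'),$$ is monogenic in $\Omega_D$.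
   Context: $\mathbb{R}_{p+q}$ is the real Clifford algebra generated by $e_1,\dots,e_{p+q}$ with $e_ie_j+e_je_i=-2\delta_{ij}$; $e_0=1$. A point of $\mathbb{R}^{p+q+1}$ is identified with the paravector $\boldsymbol{x}=\boldsymbol{x}_p+\underline{\boldsymbol{x}}_q$, $\boldsymbol{x}_p=\sum_{i=0}^p x_ie_i\in\mathbb{R}^{p+1}$, $\underline{\boldsymbol{x}}_q=\sum_{i=p+1}^{p+q}x_ie_i\in\mathbb{R}^q$. $\mathbb{S}=\{\underline{\omega}=\sum_{i=p+1}^{p+q}\omega_ie_i:\sum\omega_i^2=1\}$ is the unit sphere of $\mathbb{R}^q$. One writes $\underline{\boldsymbol{x}}_q=r\underline{\omega}$ with $r=|\underline{\boldsymbol{x}}_q|$, $\underline{\omega}\in\mathbb{S}$ ($\underline{\omega}$ arbitrary if $r=0$), and $\boldsymbol{x}'=(\boldsymbol{x}_p,r)$. Operators: $D_{\boldsymbol{x}_p}=\sum_{i=0}^p e_i\partial_{x_i}$, $\overline{D}_{\boldsymbol{x}_p}=\partial_{x_0}-\sum_{i=1}^p e_i\partial_{x_i}$, $D_{\boldsymbol{x}}=\sum_{i=0}^{p+q}e_i\partial_{x_i}$ (all acting from the left), $\Delta_{\boldsymbol{x}}=\sum_{i=0}^{p+q}\partial_{x_i}^2$. A $C^1$ function $f:\Omega\to\mathbb{R}_{p+q}$ on a domain $\Omega\subseteq\mathbb{R}^{p+q+1}$ is monogenic if $D_{\boldsymbol{x}}f=0$ in $\Omega$. The p-symmetric completion of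 $D$ is $\Omega_D=\{\boldsymbol{x}_p+r\underline{\omega}:\underline{\omega}\in\mathbb{S},\ r\ge0,\ (\boldsymbol{x}_p,r)\in D\}\subseteq\mathbb{R}^{p+q+1}$. A generalized partial-slice function on $\Omega_D$ is a function $f:\Omega_D\to\mathbb{R}_{p+q}$ of the form $f(\boldsymbol{x}_p+r\underline{\omega})=F_1(\boldsymbol{x}_p,r)+\underline{\omega}F_2(\boldsymbol{x}_p,r)$ with $F_1,F_2:D\to\mathbb{R}_{p+q}$, $F_1$ even and $F_2$ odd in $r$. $\mathcal{GSR}(\Omega_D)$ is the set of such $f$ with $F_1,F_2\in C^1(D)$ satisfying on $D$: $D_{\boldsymbol{x}_p}F_1-\partial_rF_2=0$ and $\overline{D}_{\boldsymbol{x}_p}F_2+\partial_rF_1=0$. $(\frac1r\partial_r)^k$ is the $k$-th iterate of $F\mapsto\frac1r\partial_rF$, and $(\partial_r\frac1r)^k$ the $k$-th iterate of $F\mapsto\partial_r(F/r)$. Convention: the values of $(\frac1r\partial_r)^kF_1$ and $(\partial_r\frac1r)^kF_2$ at points $(\boldsymbol{x}_p,0)\in D$ are understood as the limits as $r\to0$ (which exist for $f\in\mathcal{GSR}(\Omega_D)$). $(2m)!!=2\cdot4\cdots(2m)$, $0!!=1$. *)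

(* Defs.v *)
From HB Require Import structures.
From mathcomp Require Import all_boot all_order all_algebra.
From mathcomp Require Import all_classical all_reals all_analysis.

Set Implicit Arguments.
Unset Strict Implicit.
Unset Printing Implicit Defensive.

Import Order.TTheory GRing.Theory Num.Theory.
Import numFieldNormedType.Exports.

Local Open Scope classical_set_scope.
Local Open Scope ring_scope.

(* Elements are given by their coordinates in the basis of blades
   [e_A = e_{i_1} ... e_{i_k}], [A = {i_1 < ... < i_k}].  The row-vector
   representation provides the (finite-dimensional) topology. *)

Definition clifford (R : realType) (n : nat) : Type := 'rV[R]_#|{set 'I_n}|.

HB.instance Definition _ (R : realType) (n : nat) :=
  NormedModule.on (clifford R n).

Section CliffordAlgebra.
Context {R : realType} {n : nat}.
Implicit Types (A B C : {set 'I_n}) (x y z : clifford R n).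

Definition blade A : clifford R n := delta_mx 0 (enum_rank A).

Definition symdiff A B : {set 'I_n} := (A :\: B) :|: (B :\: A).

(* Sorting [e_A e_B]: one sign for each transposition of [e_i], [i \in A], with
   [e_j], [j \in B], [j < i], and one sign for each square [e_i ^+ 2 = -1]. *)
Definition blade_sign A B : R :=
  \prod_(i in A) \prod_(j in B | (j <= i)%N) (-1).

Definition cliff_mul x y : clifford R n :=
  \sum_A \sum_B (x 0 (enum_rank A) * y 0 (enum_rank B) * blade_sign A B)
    *: blade (symdiff A B).

Let symdiffA : associative symdiff.
Proof.
move=> A B C; apply/setP => i; rewrite !inE.
by case: (i \in A); case: (i \in B); case: (i \in C).
Qed.

Let symdiff0s A : symdiff finset.set0 A = A.
Proof. by apply/setP => i; rewrite !inE; case: (i \in A). Qed.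

Let symdiffs0 A : symdiff A finset.set0 = A.
Proof. by apply/setP => i; rewrite !inE; case: (i \in A). Qed.

Let prod_symdiff (P : pred 'I_n) (u : 'I_n -> R) A B :
    (forall i, u i * u i = 1) ->
  \prod_(i in symdiff A B | P i) u i =
    (\prod_(i in A | P i) u i) * (\prod_(i in B | P i) u i).
Proof.
move=> uu; rewrite !(big_mkcond (fun i => _ && P i)) -big_split /=.
apply: eq_bigr => i _; rewrite !inE.
by case: (i \in A); case: (i \in B); case: (P i); rewrite ?mulr1 ?mul1r ?uu.
Qed.

Let prodN1_sqr (P : pred 'I_n) :
  (\prod_(j | P j) (-1)) * (\prod_(j | P j) (-1)) = 1 :> R.
Proof.
by rewrite -big_split /= big1// => i _; rewrite mulrNN mulr1.
Qed.

Let signDl A B C :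
  blade_sign (symdiff A B) C = blade_sign A C * blade_sign B C.
Proof.
have := @prod_symdiff xpredT
  (fun i => \prod_(j in C | (j <= i)%N) (-1)) A B (fun i => prodN1_sqr _).
rewrite /blade_sign; under eq_bigl do rewrite andbT.
by move=> ->; congr (_ * _); apply: eq_bigl => i; rewrite andbT.
Qed.

Let signDr A B C :
  blade_sign A (symdiff B C) = blade_sign A B * blade_sign A C.
Proof.
rewrite /blade_sign -big_split /=; apply: eq_bigr => i _.
by apply: prod_symdiff => j; rewrite mulrNN mulr1.
Qed.

Let sign0s A : blade_sign finset.set0 A = 1.
Proof. by rewrite /blade_sign big_set0. Qed.

Let signs0 A : blade_sign A finset.set0 = 1.
Proof.
by rewrite /blade_sign big1// => i _; rewrite big_pred0// => j; rewrite inE.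
Qed.

Let bladeE A B : blade A 0 (enum_rank B) = (A == B)%:R.
Proof. by rewrite mxE eqxx (inj_eq enum_rank_inj) eq_sym. Qed.

Let blade_expand x : x = \sum_A x 0 (enum_rank A) *: blade A.
Proof.
rewrite [LHS]row_sum_delta (reindex enum_rank) //=.
by exists enum_val => A _; [exact: enum_rankK|exact: enum_valK].
Qed.

Let cliff_mulDl : left_distributive cliff_mul +%R.
Proof.
move=> x y z; rewrite /cliff_mul -big_split; apply: eq_bigr => A _ /=.
rewrite -big_split; apply: eq_bigr => B _ /=.
by rewrite mxE !mulrDl scalerDl.
Qed.

Let cliff_mulDr : right_distributive cliff_mul +%R.
Proof.
move=> x y z; rewrite /cliff_mul -big_split; apply: eq_bigr => A _ /=.
rewrite -big_split; apply: eq_bigr => B _ /=.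
by rewrite mxE mulrDr !mulrDl scalerDl.
Qed.

Let cliff_mulZl (a : R) x y : a *: cliff_mul x y = cliff_mul (a *: x) y.
Proof.
rewrite /cliff_mul scaler_sumr; apply: eq_bigr => A _.
rewrite scaler_sumr; apply: eq_bigr => B _.
by rewrite mxE scalerA !mulrA.
Qed.

Let cliff_mulZr (a : R) x y : a *: cliff_mul x y = cliff_mul x (a *: y).
Proof.
rewrite /cliff_mul scaler_sumr; apply: eq_bigr => A _.
rewrite scaler_sumr; apply: eq_bigr => B _.
by rewrite mxE scalerA; congr (_ *: _); rewrite !mulrA (mulrC a).
Qed.

Let cliff_mul_blade A B :
  cliff_mul (blade A) (blade B) = blade_sign A B *: blade (symdiff A B).
Proof.
rewrite /cliff_mul (bigD1 A)//= [X in _ + X]big1 ?addr0; last first.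
  move=> C CA; rewrite big1// => E _.
  by rewrite bladeE [A == C]eq_sym (negbTE CA) !mul0r scale0r.
rewrite (bigD1 B)//= big1 ?addr0; last first.
  move=> C CB.
  by rewrite [X in _ * X * _]bladeE [B == C]eq_sym (negbTE CB) mulr0 mul0r scale0r.
by rewrite !bladeE !eqxx !mul1r.
Qed.

Let mul0 x : cliff_mul 0 x = 0.
Proof. by have := cliff_mulZl 0 0 x; rewrite !scale0r => <-. Qed.
Let mulx0 x : cliff_mul x 0 = 0.
Proof. by have := cliff_mulZr 0 x 0; rewrite !scale0r => <-. Qed.

Let blade_ind (P : clifford R n -> Prop) : (forall A, P (blade A)) ->
  P 0 -> (forall x y, P x -> P y -> P (x + y)) ->
  (forall a x, P x -> P (a *: x)) -> forall x, P x.
Proof.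
move=> Pb P0 PD PZ x; rewrite (blade_expand x).
by elim/big_ind : _ => // A _; exact/PZ/Pb.
Qed.

Let cliff_mulA : associative cliff_mul.
Proof.
move=> x y z; elim/blade_ind: x => [A||x1 x2 h1 h2|a x h].
- elim/blade_ind: y => [B||y1 y2 h1 h2|a y h].
  + elim/blade_ind: z => [C||z1 z2 h1 h2|a z h].
    * rewrite !cliff_mul_blade -cliff_mulZl -cliff_mulZr !cliff_mul_blade.
      rewrite !scalerA symdiffA signDl signDr; congr (_ *: _).
      by rewrite mulrC mulrA.
    * by rewrite !mulx0.
    * by rewrite !cliff_mulDr h1 h2.
    * by rewrite -!cliff_mulZr h.
  + by rewrite !(mulx0, mul0).
  + by rewrite !(cliff_mulDl, cliff_mulDr) h1 h2.
  + by rewrite -cliff_mulZl -!cliff_mulZr -cliff_mulZl h.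
- by rewrite !mul0.
- by rewrite !cliff_mulDl h1 h2.
- by rewrite -!cliff_mulZl h.
Qed.

Let cliff_mul1 : left_id (blade finset.set0) cliff_mul.
Proof.
elim/blade_ind => [A||x y hx hy|a x h].
- by rewrite cliff_mul_blade symdiff0s sign0s scale1r.
- by rewrite mulx0.
- by rewrite cliff_mulDr hx hy.
- by rewrite -cliff_mulZr h.
Qed.

Let cliff_mulr1 : right_id (blade finset.set0) cliff_mul.
Proof.
elim/blade_ind => [A||x y hx hy|a x h].
- by rewrite cliff_mul_blade symdiffs0 signs0 scale1r.
- by rewrite mul0.
- by rewrite cliff_mulDl hx hy.
- by rewrite -cliff_mulZl h.
Qed.

Let cliff_1neq0 : blade finset.set0 != 0.
Proof.
apply/eqP => /(congr1 (fun x : clifford R n => x 0 (enum_rank finset.set0))).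
by rewrite bladeE eqxx mxE => /eqP; rewrite oner_eq0.
Qed.

HB.instance Definition _ := GRing.Zmodule_isNzRing.Build (clifford R n)
  cliff_mulA cliff_mul1 cliff_mulr1 cliff_mulDl cliff_mulDr cliff_1neq0.

HB.instance Definition _ :=
  GRing.Lmodule_isLalgebra.Build R (clifford R n) cliff_mulZl.

HB.instance Definition _ :=
  GRing.Lalgebra_isAlgebra.Build R (clifford R n) cliff_mulZr.

Lemma blade0 : blade finset.set0 = 1.
Proof. by []. Qed.

Lemma blade_mul A B : blade A * blade B = blade_sign A B *: blade (symdiff A B).
Proof. exact: cliff_mul_blade. Qed.

Definition gen (i : 'I_n) : clifford R n := blade [set i]%SET.

Lemma gen_rel (i j : 'I_n) :
  gen i * gen j + gen j * gen i = - (2 * (i == j)%:R)%:A.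
Proof.
rewrite !blade_mul /blade_sign !big_set1.
have big1E (a b : 'I_n) :
    \prod_(k in [set a]%SET | (k <= b)%N) (-1) = (-1) ^+ (a <= b)%N :> R.
  by rewrite big_mkcondr big_set1; case: leqP.
rewrite !big1E; have [<-|ij] := eqVneq i j.
  rewrite leqnn expr1 (_ : symdiff _ _ = finset.set0); last first.
    by apply/setP => k; rewrite !inE; case: eqP.
  by rewrite mulr1 blade0 -scalerDl -scaleNr -opprD.
have -> : symdiff [set j]%SET [set i]%SET = symdiff [set i]%SET [set j]%SET.
  by rewrite /symdiff finset.setUC.
rewrite mulr0 scale0r oppr0 -scalerDl.
case: (ltngtP i j) => [||/val_inj/eqP]; last by rewrite (negbTE ij).
  by rewrite expr0 expr1 addrN scale0r.
by rewrite expr0 expr1 addNr scale0r.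
Qed.

(* [e_0 = 1, e_1, ..., e_n] *)
Definition e_ (i : 'I_n.+1) : clifford R n :=
  if unlift ord0 i is Some j then gen j else 1.

End CliffordAlgebra.

Definition is_domain {T : topologicalType} (D : set T) : Prop :=
  [/\ open D, connected D & D !=set0].

(* In finite dimension, continuity of all [y |-> 'D_v f y] is continuity of the
   differential. *)
Definition C1_on {R : realType} {V W : normedModType R} (D : set V)
    (f : V -> W) : Prop :=
  forall x, D x ->
    differentiable f x /\ forall v, {for x, continuous (fun y => 'D_v f y)}.

(* The paravector [x_p + x_q] is represented by [row_mx x_p x_q] in
   ['rV_(p.+1 + q)], which is convertible to ['rV_(p + q).+1]; thus
   [e_ (lshift q i)] is [e_i] for [0 <= i <= p] and [e_ (rshift p.+1 j)] is
   [e_(p+1+j)] for [0 <= j < q].  A point [x' = (x_p, r)] of [R^(p+2)] is a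
   pair.  Functions on a set are represented by total functions, constrained
   on that set only. *)

Section GeneralizedPartialSlice.
Context {R : realType} {p q : nat}.

Local Notation Cl := (clifford R (p + q)).
Local Notation paraT := 'rV[R]_(p.+1 + q).
Local Notation sliceT := ('rV[R]_p.+1 * R)%type.

Implicit Types (D : set sliceT) (F : sliceT -> Cl) (f : paraT -> Cl).

Definition e_p (i : 'I_p.+1) : Cl := e_ (lshift q i : 'I_(p + q).+1).
Definition e_q (j : 'I_q) : Cl := e_ (rshift p.+1 j : 'I_(p + q).+1).

Definition sphere_q : set 'rV[R]_q := [set w | \sum_j w 0 j ^+ 2 = 1].

Definition vecq (w : 'rV[R]_q) : Cl := \sum_j w 0 j *: e_q j.

Definition partial_d (i : 'I_(p.+1 + q)) f : paraT -> Cl :=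
  fun x => 'D_(delta_mx 0 i) f x.

Definition dirac_op f : paraT -> Cl :=
  fun x => \sum_(i < p.+1 + q) (e_ (i : 'I_(p + q).+1) : Cl) * partial_d i f x.

Definition laplace f : paraT -> Cl :=
  fun x => \sum_(i < p.+1 + q) partial_d i (partial_d i f) x.

(* ['D_v] is total, with an unspecified value where the derivative does not
   exist; hence the separate statement that [laplace f x] is meaningful. *)
Definition laplace_defined f (x : paraT) : Prop :=
  forall i : 'I_(p.+1 + q), derivable f x (delta_mx 0 i) /\
    derivable (partial_d i f) x (delta_mx 0 i).

Definition monogenic (Omega : set paraT) f : Prop :=
  C1_on Omega f /\ forall x, Omega x -> dirac_op f x = 0.

Definition dir_xp (i : 'I_p.+1) : sliceT := (delta_mx 0 i, 0).
Definition dir_r : sliceT := (0, 1).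

Definition dirac_op_p F : sliceT -> Cl :=
  fun x => \sum_(i < p.+1) e_p i * 'D_(dir_xp i) F x.

Definition dirac_op_p_conj F : sliceT -> Cl :=
  fun x => 'D_(dir_xp ord0) F x
    - \sum_(i < p.+1 | i != ord0) e_p i * 'D_(dir_xp i) F x.

Definition d_r F : sliceT -> Cl := fun x => 'D_dir_r F x.

Definition reflection_invariant D : Prop :=
  forall xp r, D (xp, r) -> D (xp, - r).

Definition completion D : set paraT :=
  [set x | exists xp r w,
    [/\ sphere_q w, 0 <= r, D (xp, r) & x = row_mx xp (r *: w)]].

Definition even_on D F : Prop :=
  forall xp r, D (xp, r) -> F (xp, - r) = F (xp, r).

Definition odd_on D F : Prop :=
  forall xp r, D (xp, r) -> F (xp, - r) = - F (xp, r).

Definition has_slice_form D f (A B : sliceT -> Cl) : Prop :=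
  forall xp r w, sphere_q w -> 0 <= r -> D (xp, r) ->
    f (row_mx xp (r *: w)) = A (xp, r) + vecq w * B (xp, r).

Definition partial_slice D f (F1 F2 : sliceT -> Cl) : Prop :=
  [/\ even_on D F1, odd_on D F2 & has_slice_form D f F1 F2].

(* [f] is in [GSR(completion D)], with components [F1] and [F2]. *)
Definition GSR D f (F1 F2 : sliceT -> Cl) : Prop :=
  [/\ partial_slice D f F1 F2, C1_on D F1, C1_on D F2,
      forall x, D x -> dirac_op_p F1 x - d_r F2 x = 0 &
      forall x, D x -> dirac_op_p_conj F2 x + d_r F1 x = 0].

(* Meaningful for [r != 0] only: [0^-1 = 0]. *)
Definition inv_r_d_r F : sliceT -> Cl := fun x => x.2^-1 *: d_r F x.
Definition d_r_inv_r F : sliceT -> Cl := d_r (fun x => x.2^-1 *: F x).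

(* Extension to [r = 0] by the limit [r --> 0], [x_p] being fixed. *)
Definition extend_r0 F : sliceT -> Cl :=
  fun x => if x.2 == 0 then lim (F (x.1, s) @[s --> 0^']) else F x.

Definition slice_A (m : nat) (F1 : sliceT -> Cl) : sliceT -> Cl :=
  extend_r0 (iter m inv_r_d_r F1).
Definition slice_B (m : nat) (F2 : sliceT -> Cl) : sliceT -> Cl :=
  extend_r0 (iter m d_r_inv_r F2).

(* As for [laplace_defined]: the derivatives and limits are total functions. *)
Definition slice_A_defined D (m : nat) (F1 : sliceT -> Cl) : Prop :=
  (forall k x, (k < m)%N -> D x -> x.2 != 0 ->
     derivable (iter k inv_r_d_r F1) x dir_r) /\
  (forall xp, D (xp, 0) -> cvg (iter m inv_r_d_r F1 (xp, s) @[s --> 0^'])).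
Definition slice_B_defined D (m : nat) (F2 : sliceT -> Cl) : Prop :=
  (forall k x, (k < m)%N -> D x -> x.2 != 0 ->
     derivable (fun y : sliceT => y.2^-1 *: iter k d_r_inv_r F2 y) x dir_r) /\
  (forall xp, D (xp, 0) -> cvg (iter m d_r_inv_r F2 (xp, s) @[s --> 0^'])).

(* [(2m)!! = 2 * 4 * ... * (2m)] *)
Definition even_dfact (m : nat) : nat := \prod_(1 <= i < m.+1) (2 * i)%N.

(* For [q] odd, [q - 1 = 2 m] with [m = (q - 1) / 2]. *)
Definition tau f : paraT -> Cl :=
  fun x => ((even_dfact (q.-1)./2)%:R : R)^-1 *: iter (q.-1)./2 laplace f x.

End GeneralizedPartialSlice.

(* Main.v *)
(* In the coordinates [(x_p, r)] the pair [(F1, F2)] solves a first-order system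
   that factorizes the Laplacian. Its solutions are therefore harmonic, hence
   infinitely differentiable, although they are only assumed to be of class C^1:
   their Steklov averages are classical harmonic functions, which converge
   uniformly, and the interior gradient estimate (a maximum principle argument)
   passes derivatives to uniform limits of harmonic functions. The partial
   derivatives in [x_p] of a solution form again a solution.

   Put [a_k = ((1/r) d_r)^k F1] and [b_k = ((1/r) d_r)^k (F2 / r)]. The system
   gives [D_p a_k = r^2 b_(k+1) + (2k+1) b_k] and [a_(k+1) = - conj D_p b_k], so
   that no radial derivative is needed to define [a_k] and [b_k] recursively. At
   [r = 0] the limit of [b_k] is [D_p a_k / (2k+1)], because
   [d_r (r^(2k+1) b_k) = r^(2k) D_p a_k].

   With [f_k = a_k + x_q b_k], where [r = |x_q|], the rules [d_j a_k = x_j a_(k+1)]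
   and [d_j b_k = x_j b_(k+1)] yield [Laplace f_k = (q - 1 - 2k) f_(k+1)] and
   [Dirac f_k = (2k + 1 - q) b_k]. For [k = (q - 1) / 2] the latter vanishes, and
   the former gives [Laplace^k f_0 = (q - 1)!! f_k]. *)

Require Import Defs.
From HB Require Import structures.
From mathcomp Require Import all_boot all_order all_algebra.
From mathcomp Require Import all_classical all_reals all_analysis.
From mathcomp Require Import ring lra.
Import Order.TTheory GRing.Theory Num.Theory.
Import numFieldNormedType.Exports.
Local Open Scope classical_set_scope.
Local Open Scope ring_scope.

Set Implicit Arguments.
Unset Strict Implicit.
Unset Printing Implicit Defensive.

(** * Directional derivatives *)

(** [A] and [B] involve derivatives of high order of a pair that is only C^1, together with their
    limits at [r = 0], where [1/r] is singular. In the variables [(x_p, r)], however, the points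
    with [r = 0] are ordinary points of a system with constant coefficients, so regularity is
    obtained there first; what remains singular are the radial quotients, and these are expressed by
    derivatives in [x_p]. Statements about [a_k] and [b_k] therefore range over all solution pairs:
    level [k + 1] for a pair rests on level [k] for its derivatives in [x_p]. Averages are taken
    over segments because averaging a merely continuous function along [e_i] makes it differentiable
    in [e_i], and because averaging commutes with constant coefficients; one average per direction
    thus creates all the second derivatives that the factorization of the Laplacian uses. All
    estimates are made in the sup norm, whose balls are cubes and are mapped to themselves by the
    reflections of the maximum principle argument. *)

Section EpsilonDelta.
Context {R : realType} {V W : normedModType R}.

Lemma near_normP (x : V) (P : set V) :
  (\forall y \near x, P y) <->
  exists2 d : R, 0 < d & forall y, `|y - x| < d -> P y.
Proof.
split=> [/nbhs_ballP[d /= d0 H]|[d d0 H]].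
  by exists d => // y yx; apply: H; rewrite -ball_normE /= distrC.
by apply/nbhs_ballP; exists d => // y; rewrite -ball_normE /= distrC => /H.
Qed.

Lemma continuous_normP (f : V -> W) (x : V) :
  {for x, continuous f} <->
  forall r : R, 0 < r ->
    exists2 d : R, 0 < d & forall y, `|y - x| < d -> `|f y - f x| <= r.
Proof.
split=> [/cvgrPdist_le fx r r0|fx].
  by have /near_normP[d d0 H] := fx _ r0; exists d => // y /H; rewrite distrC.
apply/cvgrPdist_le => r r0; apply/near_normP.
by have [d d0 H] := fx _ r0; exists d => // y /H; rewrite distrC.
Qed.

Lemma near_forall (I : finType) (x : V) (P : I -> V -> Prop) :
  (forall i, \forall y \near x, P i y) -> \forall y \near x, forall i, P i y.
Proof. exact: filter_forall. Qed.

End EpsilonDelta.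

Section Continuity.
Context {R : realType} {V W : normedModType R}.

Lemma continuous_bigsum (J : Type) (s : seq J) (f : J -> V -> W) (x : V) :
  (forall j, {for x, continuous (f j)}) ->
  {for x, continuous (fun y => \sum_(j <- s) f j y)}.
Proof.
by move=> cf; apply: cvg_big => [|j _]; [exact: add_continuous|exact: cf].
Qed.

Lemma continuous_scaler (a : V -> R) (f : V -> W) (x : V) : {for x, continuous a} ->
  {for x, continuous f} -> {for x, continuous (fun y => a y *: f y)}.
Proof. by move=> ca cf; exact: cvgZ. Qed.

Lemma near_eq_continuous (f g : V -> W) (x : V) : (\forall y \near x, f y = g y) ->
  {for x, continuous f} -> {for x, continuous g}.
Proof.
move=> E cf; rewrite /prop_for /continuous_at -(nbhs_singleton E).
by apply: cvg_trans cf; apply: near_eq_cvg; apply: filterS E => y ->.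
Qed.

Lemma differentiable_linear_approx (f : V -> W) (df : {linear V -> W}) (x : V) :
  continuous df ->
  (forall eps : R, 0 < eps ->
    \forall h \near (0 : V), `|f (h + x) - f x - df h| <= eps * `|h|) ->
  differentiable f x /\ 'd f x = df :> (V -> W).
Proof.
move=> cdf H; have E : f \o shift x = cst (f x) + df +o_ 0 id.
  apply/eqaddoP => eps e0; apply: filterS (H _ e0) => h.
  by rewrite /= opprD addrA.
have dE := diff_unique cdf E.
by split=> //; apply/diff_locallyP; rewrite dE.
Qed.

End Continuity.

Lemma continuous_pair (R : realType) (U V W : normedModType R) (f : U -> V)
    (g : U -> W) (x : U) : {for x, continuous f} -> {for x, continuous g} ->
  {for x, continuous (fun y => (f y, g y))}.
Proof. by move=> cf cg; exact: cvg_pair. Qed.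

Section DirectionalDerivative.
Context {R : realType} {V W : normedModType R}.
Implicit Types (f : V -> W) (x v : V) (s t : R).

(** Derivatives are often transferred below along a change of the base point or of the increment;
    with explicit difference quotients such a transfer is a single rewriting. *)
Lemma is_deriveP f x v (l : W) :
  is_derive x v f l <->
  forall e : R, 0 < e -> exists2 d : R, 0 < d & forall t, t != 0 -> `|t| < d ->
    `|t^-1 *: (f (t *: v + x) - f x) - l| <= e.
Proof.
split=> [[dfx <-] e e0|H].
  have /cvgrPdist_le /(_ _ e0) := dfx.
  move=> [d /= d0 H]; exists d => // t t0 td.
  rewrite distrC; apply: H => //=.
  by rewrite sub0r normrN.
have fl : (fun h => h^-1 *: ((f \o shift x) (h *: v) - f x)) @ 0^' --> l.
  apply/cvgrPdist_le => e e0; have [d d0 Hd] := H _ e0.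
  exists d => // t /=; rewrite sub0r normrN => td t0.
  by rewrite distrC; apply: Hd.
split; first by apply/cvg_ex; exists l.
exact/cvg_lim.
Qed.

Lemma is_derive_unique f x v (l l' : W) :
  is_derive x v f l -> is_derive x v f l' -> l = l'.
Proof. by move=> [_ <-] [_ <-]. Qed.

Lemma is_derive_scale f x v t (l : W) :
  is_derive x v f l -> is_derive x (t *: v) f (t *: l).
Proof.
have [->|t0] := eqVneq t 0.
  by rewrite !scale0r => _; exact: is_derive0.
move=> /is_deriveP H; apply/is_deriveP => e e0.
have te0 : 0 < e / `|t| by rewrite divr_gt0// normr_gt0.
have [d d0 Hd] := H _ te0.
exists (d / `|t|); first by rewrite divr_gt0// normr_gt0.
move=> s s0 sd.
have st0 : s * t != 0 by rewrite mulf_neq0.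
have := Hd (s * t) st0.
rewrite normrM -ltr_pdivlMr ?normr_gt0// => /(_ sd).
rewrite ler_pdivlMr ?normr_gt0// mulrC -normrZ scalerBr !scalerA.
by rewrite invfM mulrCA divff// mulr1.
Qed.

Lemma is_derive_bigsum (J : Type) (s : seq J) (f : J -> V -> W) x v (l : J -> W) :
  (forall j, is_derive x v (f j) (l j)) ->
  is_derive x v (fun y => \sum_(j <- s) f j y) (\sum_(j <- s) l j).
Proof.
move=> D; elim: s => [|j s IH].
  by rewrite big_nil; under eq_fun do rewrite big_nil; exact: is_derive_cst.
rewrite big_cons; under eq_fun do rewrite big_cons.
exact: is_deriveD.
Qed.

End DirectionalDerivative.

Section Line.
Context {R : realType} {V W : normedModType R}.
Implicit Types (f : V -> W) (x v : V) (s t : R).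

Lemma is_derive_line f x v t (l : W) :
  is_derive t (1 : R) (fun s => f (s *: v + x)) l <->
  is_derive (t *: v + x) v f l.
Proof.
suff E (h : R) : f ((h *: 1 + t) *: v + x) = f (h *: v + (t *: v + x)).
  by split=> /is_deriveP H; apply/is_deriveP => e /H[d d0 Hd]; exists d => // h h0 hd;
    have := Hd h h0 hd; rewrite E.
by rewrite scalerDl addrA /GRing.scale /= mulr1.
Qed.

Lemma is_derive_line_scale f x v s t (l : W) :
  is_derive (t *: (s *: v) + x) v f l ->
  is_derive t (1 : R) (fun h => f (h *: (s *: v) + x)) (s *: l).
Proof. by move=> /(is_derive_scale s) /is_derive_line. Qed.

Lemma is_derive_line0 f x v (l : W) :
  is_derive x v f l -> is_derive (0 : R) (1 : R) (fun h => f (h *: v + x)) l.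
Proof. by move=> D; apply/is_derive_line; rewrite scale0r add0r. Qed.

End Line.

Section MeanValue.
Context {R : realType} {V : normedModType R}.
Implicit Types (f g : V -> R) (x e : V).

(** [t] may have either sign, since the segment is parametrized by [s] in [[0, 1]]. *)
Lemma mvt_line f g x e (t : R) :
  (forall s : R, 0 <= s <= 1 ->
     is_derive ((s * t) *: e + x) e f (g ((s * t) *: e + x))) ->
  exists2 s : R, 0 < s < 1 & f (t *: e + x) - f x = t * g ((s * t) *: e + x).
Proof.
move=> H.
have D (s : R) : 0 <= s <= 1 -> is_derive s (1 : R) (fun s => f (s *: (t *: e) + x))
    (t * g ((s * t) *: e + x)).
  by move=> /H; rewrite -!scalerA => /(is_derive_scale t) /is_derive_line.
have [] := @MVT R (fun s => f (s *: (t *: e) + x))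
  (fun s => t * g ((s * t) *: e + x)) 0 1 ltr01.
- by move=> s; rewrite in_itv /= => /andP[s0 s1]; apply: D; rewrite !ltW.
- by apply: derivable_within_continuous => s; rewrite in_itv /= => /D[].
- move=> s; rewrite in_itv /= => s01; rewrite scale1r scale0r add0r subr0 mulr1.
  by exists s.
Qed.

End MeanValue.

(** The interior maximum forces [g' 0 = 0]. If [c > 0], then [g'] is positive just to the right of
    [0], and the mean value theorem contradicts maximality. *)
Lemma second_derivative_max (R : realType) (g g' : R -> R) (c d : R) : 0 < d ->
  (forall t : R, `|t| < d -> is_derive t (1 : R) g (g' t)) ->
  is_derive (0 : R) (1 : R) g' c ->
  (forall t : R, `|t| < d -> g t <= g 0) -> c <= 0.
Proof.
move=> d0 dg dg' gmax.
have g'0 : g' 0 = 0.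
  apply: (@is_derive_unique _ _ _ g 0 1); first by apply: dg; rewrite normr0.
  have dd : - d < d by rewrite gtrN.
  have itvE (t : R) : (t \in `]- d, d[%R) = (`|t| < d) by rewrite in_itv /= ltr_norml.
  apply: (@derive1_at_max _ g (- d) d) => [||| t].
  - exact: ltW.
  - by move=> t; rewrite itvE => /dg[].
  - by rewrite itvE normr0.
  - by rewrite itvE; exact: gmax.
rewrite leNgt; apply/negP => c0.
have c20 : 0 < c / 2 by rewrite divr_gt0.
have /is_deriveP /(_ _ c20) [r r0 Hr] := dg'.
pose t := Num.min d r / 2.
have m0 : 0 < Num.min d r by rewrite lt_min d0.
have t0 : 0 < t by rewrite divr_gt0.
have tm : t < Num.min d r by rewrite ltr_pdivrMr// ltr_pMr// ltr1n.
have [td tr] : t < d /\ t < r by move: tm; rewrite lt_min => /andP[].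
have g't (s : R) : 0 < s <= t -> 0 < g' s.
  move=> /andP[s0 st].
  have := Hr s; rewrite gt_eqF// gtr0_norm// (le_lt_trans st)// => /(_ isT isT).
  rewrite g'0 addr0 subr0 [_%:A]mulr1 ler_distl => /andP[+ _].
  rewrite (_ : c - c / 2 = c / 2); last by field.
  move=> /(lt_le_trans c20); rewrite /GRing.scale /= pmulr_rgt0//.
  by rewrite invr_gt0.
have [|s /andP[s0 s1]] := @mvt_line R R^o g g' 0 1 t.
  move=> s /andP[s0 s1]; apply: dg; rewrite addr0 [_ *: _]mulr1.
  by rewrite ger0_norm ?(le_lt_trans _ td)// ?ler_piMl ?mulr_ge0// ltW.
rewrite !addr0 ![_%:A]mulr1 => E.
have := gmax t; rewrite gtr0_norm// => /(_ td).
rewrite -subr_le0 E pmulr_rle0// leNgt g't//.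
by rewrite mulr_gt0//= ler_piMl// ltW.
Qed.

(** * Harmonic functions in coordinates *)

Lemma is_derive_quadratic (R : realType) (b l k t : R) :
  is_derive t (1 : R) (fun s => b * s ^+ 2 + l * s + k) (2 * b * t + l).
Proof.
apply/is_deriveP => e e0; exists (e / (`|b| + 1)).
  by rewrite divr_gt0// ltr_wpDl.
move=> s s0 sd; rewrite ![_%:A]mulr1.
rewrite (_ : _ - _ = b * s); last by rewrite /GRing.scale /=; field.
rewrite normrM; have := ltr_wpDl (normr_ge0 b) (@ltr01 R) => b0.
move: sd; rewrite ltr_pdivlMr// => /ltW; apply: le_trans.
by rewrite mulrC ler_wpM2l// lerDl.
Qed.

Section Coordinates.
Context {R : realType} {V : normedModType R} {I : finType}.
Implicit Types (x y z : V) (u v w : V -> R).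

(** The norm is the sup norm of the coordinates, so balls are cubes; the last field is the
    Heine-Borel property. The abstract index type covers the pairs [(x_p, r)] without flattening
    them. *)
Record coord_system (e : I -> V) (c : I -> V -> R) : Prop := CoordSystem {
  coord_line : forall i j (t : R) x, c i (t *: e j + x) = t * (i == j)%:R + c i x;
  coord_norm : forall x y (d : R),
    0 <= d -> (`|x - y| <= d) <-> (forall i, `|c i x - c i y| <= d);
  coord_compact : forall y (d : R), compact [set x : V | `|x - y| <= d] }.

(** A condition at one point, with unmixed second derivatives only: what the second derivative test
    consumes. *)
Definition harmonic_at (e : I -> V) v x : Prop :=
  [/\ {for x, continuous v},
      forall i, derivable v x (e i) /\ derivable ('D_(e i) v) x (e i) &
      \sum_i ('D_(e i) ('D_(e i) v) x : R) = 0].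

Variables (e : I -> V) (c : I -> V -> R).
Hypothesis ec : coord_system e c.

Lemma coord_lipschitz i x y : `|c i x - c i y| <= `|x - y|.
Proof. exact: (coord_norm ec x y (normr_ge0 _)).1. Qed.

Lemma coord_system_continuous i : continuous (c i).
Proof.
move=> x; apply/continuous_normP => r r0; exists r => // y xy.
exact/(le_trans (coord_lipschitz _ _ _))/ltW.
Qed.

Lemma norm_dir_le1 i : `|e i| <= 1.
Proof.
rewrite -[e i]subr0; apply/(coord_norm ec _ _ ler01) => j.
have := coord_line ec j i 1 0; rewrite scale1r addr0 => ->.
by rewrite addrK mul1r; case: eqP; rewrite ?normr1 ?normr0.
Qed.

Let refl (i : I) y x := (- 2 * (c i x - c i y)) *: e i + x.

Let coord_refl i j y x : c j (refl i y x) =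
  (if j == i then 2 * c i y - c i x else c j x).
Proof. by rewrite (coord_line ec); case: eqP => [->|_] /=; ring. Qed.

Let norm_refl i y x (d : R) : 0 <= d -> `|x - y| <= d -> `|refl i y x - y| <= d.
Proof.
move=> d0 /(coord_norm ec _ _ d0) xy; apply/(coord_norm ec _ _ d0) => j.
rewrite coord_refl; case: eqP => [->|//].
by rewrite (_ : _ - _ = - (c i x - c i y)); [rewrite normrN | ring].
Qed.

Let refl_line i j y z (t : R) : refl i y (t *: e j + z) =
  t *: ((if j == i then -1 else 1) *: e j) + refl i y z.
Proof.
rewrite /refl (coord_line ec) [i == j]eq_sym; case: eqP => [->|_].
  rewrite !addrA -scalerDl scalerA -scalerDl; congr (_ *: _ + _) => /=; ring.
by rewrite mulr0 add0r scale1r !addrA [X in X + z]addrC.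
Qed.

Let refl_continuous i y : continuous (refl i y).
Proof.
move=> x; apply: cvgD; last exact: cvg_id.
apply: cvgZr_tmp.
apply: cvgM; first exact: cvg_cst.
by apply: cvgB; [exact: coord_system_continuous|exact: cvg_cst].
Qed.

Let quadr (b : I -> R) y x := \sum_k b k * (c k x - c k y) ^+ 2.

Let quadr_line b y j z (t : R) : quadr b y (t *: e j + z) =
  b j * t ^+ 2 + 2 * b j * (c j z - c j y) * t + quadr b y z.
Proof.
rewrite /quadr (bigD1 j)//= [in RHS](bigD1 j)//= (coord_line ec) eqxx /= addrA.
congr (_ + _); first by ring.
by apply: eq_bigr => k /negbTE kj; rewrite (coord_line ec) kj mulr0 add0r.
Qed.

Let quadr_continuous b y : continuous (quadr b y).
Proof.
move=> x; apply: cvg_big => [|k _]; first exact: add_continuous.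
apply: cvgM; first exact: cvg_cst.
apply: (@cvg_comp _ _ _ (fun x => c k x - c k y) (fun s => s ^+ 2)).
  by apply: cvgB; [exact: coord_system_continuous|exact: cvg_cst].
exact: exprn_continuous.
Qed.

Let sumB_zeros (f g : I -> R) : \sum_j f j = 0 -> \sum_j g j = 0 ->
  \sum_j (f j - g j) = 0.
Proof. by move=> f0 g0; rewrite sumrB f0 g0 subrr. Qed.

Let sumZ_zeros (a : R) (f : I -> R) : \sum_j f j = 0 -> \sum_j a * f j = 0.
Proof. by move=> f0; rewrite -mulr_sumr f0 mulr0. Qed.

Let sum_zeros (f g h : I -> R) : \sum_j f j = 0 -> \sum_j g j = 0 ->
  \sum_j (f j - g j + 2 * h j) = 2 * \sum_j h j.
Proof.
by move=> f0 g0; rewrite big_split sumrB f0 g0 subrr [LHS]add0r mulr_sumr.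
Qed.

Let norm_coord_le x y (d : R) : 0 <= d -> `|x - y| <= d ->
  forall k, (c k x - c k y) ^+ 2 <= d ^+ 2.
Proof.
move=> d0 /(coord_norm ec _ _ d0) xy k.
by rewrite -[leLHS]ger0_norm ?sqr_ge0// normrX lerXn2r// nnegrE.
Qed.

(* The comparison function and the reflection argument are those of Gilbarg and
   Trudinger, Section 3.4: [v - v \o refl] vanishes on the hyperplane
   [c i x = c i y], and is dominated on the half cube by a harmonic quadratic
   polynomial that grows linearly in [c i x - c i y]. *)
Let half_cube_max v y i (d M eps : R) x :
    0 < d -> 0 < eps ->
    (forall x, `|x - y| <= d -> harmonic_at e v x) ->
    (forall x, `|x - y| <= d -> `|v x| <= M) ->
    `|x - y| <= d -> 0 <= c i x - c i y ->
  v x - v (refl i y x)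
    + quadr (fun j => eps + 2 * M / d ^+ 2 * (#|I|%:R * (j == i)%:R - 1)) y x
    - 2 * M / d ^+ 2 * #|I|%:R * d * (c i x - c i y) <= eps * #|I|%:R * d ^+ 2.
Proof.
move=> d0 eps0 Hv HM xy xi; set b := fun j => _; set k := 2 * M / d ^+ 2.
set N : R := #|I|%:R.
set w := fun x => v x - v (refl i y x) + quadr b y x - k * N * d * (c i x - c i y).
rewrite -/(w x).
have M0 : 0 <= M by apply: le_trans (HM _ xy).
have k0 : 0 <= k by rewrite divr_ge0 ?sqr_ge0// mulr_ge0.
have N0 : 0 <= N by rewrite ler0n.
(* The half of the cube on one side of the reflecting hyperplane. *)
set K := [set x : V | `|x - y| <= d] `&` [set x | 0 <= c i x - c i y].
have cK : compact K.
  apply: compact_closedI; first exact: (coord_compact ec).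
  have /continuous_closedP H : continuous (fun x => c i x - c i y).
    by move=> z; apply: cvgB; [exact: coord_system_continuous|exact: cvg_cst].
  exact: (H _ (@closed_ge R 0)).
have [||z /set_mem[/= zy zi] zmax] := @compact_EVT_max _ _ w K _ cK.
- by exists x.
- apply: continuous_in_subspaceT => z /set_mem[/= zy zi].
  have [vz _ _] := Hv _ zy.
  have [vrz _ _] := Hv _ (norm_refl i (ltW d0) zy).
  have rz : {for z, continuous (v \o refl i y)}.
    have H0 : {for z, continuous (refl i y)} := @refl_continuous i y z.
    have H1 := continuous_comp H0 vrz.
    exact H1.
  have lz : {for z, continuous (fun x => k * N * d * (c i x - c i y))}.
    apply: cvgM; first exact: cvg_cst.
    by apply: cvgB; [exact: coord_system_continuous|exact: cvg_cst].
  exact: (continuousB (continuousD (continuousB vz rz) (@quadr_continuous b y z)) lz).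
apply: (le_trans (zmax x _)); first exact/mem_set.
set s := c i z - c i y in zi *.
set S := \sum_j (c j z - c j y) ^+ 2.
(* The part with factor [k] is a harmonic polynomial; [eps * S] makes [w] strictly subharmonic. *)
have wE : w z = v z - v (refl i y z) + eps * S + k * (N * s * (s - d) - S).
  rewrite /w (_ : quadr b y z = eps * S + k * (N * s ^+ 2 - S)) -/s; first by ring.
  rewrite /quadr /S (_ : N * s ^+ 2 = \sum_j N * (j == i)%:R * (c j z - c j y) ^+ 2).
    rewrite -sumrB !mulr_sumr -big_split /=; apply: eq_bigr => j _.
    by rewrite /b -/k -/N; ring.
  rewrite (bigD1 i)//= eqxx mulr1 big1 ?addr0// => j /negbTE ->.
  by rewrite mulr0 mul0r.
have TS j : (c j z - c j y) ^+ 2 <= S.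
  by rewrite /S (bigD1 j)//= lerDl sumr_ge0// => l _; rewrite sqr_ge0.
have SN : S <= N * d ^+ 2.
  rewrite mulr_natl -sumr_const; apply: ler_sum => j _.
  exact: norm_coord_le (ltW d0) zy j.
have S0 : 0 <= S by apply: sumr_ge0 => j _; rewrite sqr_ge0.
have sd : s <= d.
  by have /(coord_norm ec _ _ (ltW d0))/(_ i) := zy; apply: le_trans; exact: ler_norm.
rewrite leNgt; apply/negP => wz.
(* On the flat face the reflection fixes [z], the difference of values vanishes, and [w z] is at
   most [eps * S]. *)
have s0 : 0 < s.
  rewrite lt_neqAle zi andbT eq_sym; apply/eqP => s0; move: wz.
  rewrite wE /refl -/s s0 mulr0 scale0r add0r subrr add0r mulr0 mul0r sub0r.
  apply/negP; rewrite -leNgt -mulrA.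
  apply: (@le_trans _ _ (eps * S)); last by rewrite ler_pM2l.
  by rewrite gerDl mulrN oppr_le0 mulr_ge0.
(* On an outer face [S >= d ^+ 2], so that [k * S >= 2 * M] absorbs the difference of the values of
   [v]. Hence [z] is an interior point. *)
have cd j : `|c j z - c j y| < d.
  have /(coord_norm ec _ _ (ltW d0))/(_ j) := zy.
  rewrite le_eqVlt => /predU1P[jd|//]; move: wz.
  have dS : d ^+ 2 <= S by rewrite -jd -normrX ger0_norm ?sqr_ge0.
  apply: contraTT => _; rewrite -leNgt wE.
  have vM : v z - v (refl i y z) <= 2 * M.
    have := HM _ zy; have := HM _ (norm_refl i (ltW d0) zy).
    by rewrite !ler_norml => /andP[? ?] /andP[? ?]; lra.
  have kd : k * d ^+ 2 = 2 * M by rewrite /k divfK// sqrf_eq0 gt_eqF.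
  have kS : k * d ^+ 2 <= k * S by rewrite ler_wpM2l.
  have eS : eps * S <= eps * (N * d ^+ 2) by rewrite ler_pM2l.
  have sds : 0 <= k * (N * s * (d - s)).
    by apply: mulr_ge0 => //; apply: mulr_ge0; [exact: mulr_ge0|rewrite subr_ge0].
  rewrite (_ : k * (N * s * (s - d) - S) = - (k * (N * s * (d - s))) - k * S); last by ring.
  by rewrite -mulrA; lra.
have D2 j : 'D_(e j) ('D_(e j) v) z - 'D_(e j) ('D_(e j) v) (refl i y z) + 2 * b j <= 0.
  (* The reflection reverses the direction [e i] only; the sign occurs twice in a second derivative
     and disappears. *)
  pose sg : R := if j == i then -1 else 1.
  have sg2 : sg * sg = 1 by rewrite /sg; case: eqP; rewrite ?mulrNN mulr1.
  pose l := 2 * b j * (c j z - c j y) - k * N * d * (i == j)%:R.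
  (* Within [rho] of [z], a motion along [e j] meets neither the flat face nor an outer face. *)
  pose rho := Num.min s (d - `|c j z - c j y|).
  have rho0 : 0 < rho by rewrite lt_min s0 subr_gt0 cd.
  have inK (t : R) : `|t| < rho -> K (t *: e j + z).
    rewrite lt_min => /andP[ts td]; split => /=.
      apply/(coord_norm ec _ _ (ltW d0)) => m; rewrite (coord_line ec).
      have [->|_] := eqVneq m j.
        rewrite mulr1 -addrA (le_trans (ler_normD _ _))//.
        by rewrite -lerBrDr ltW.
      by rewrite mulr0 add0r; exact/ltW.
    rewrite (coord_line ec); move: ts; rewrite ltr_norml => /andP[+ _].
    case: eqP => _ /=; rewrite ?mulr1 ?mulr0 ?add0r// -addrA -/s.
    by rewrite -subr_gt0 opprK => /ltW.
  have ballK (t : R) : `|t| < rho -> `|t *: e j + z - y| <= d by move=> /inK[].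
  have refl_ball (t : R) : `|t| < rho -> `|t *: (sg *: e j) + refl i y z - y| <= d.
    by move=> /ballK /(norm_refl i (ltW d0)); rewrite refl_line.
  have sgK (a : R) : a = sg * (sg * a) by rewrite mulrA sg2 mul1r.
  rewrite [X in _ - X + _]sgK.
  apply: (@second_derivative_max R (fun t => w (t *: e j + z))
    (fun t => 'D_(e j) v (t *: e j + z)
      - sg * 'D_(e j) v (t *: (sg *: e j) + refl i y z) + (2 * b j * t + l)) _ rho) => //.
  - move=> t tr.
    have [_ /(_ j)[/derivableP + _] _] := Hv _ (ballK _ tr).
    move=> /is_derive_line D1.
    have [_ /(_ j)[/derivableP + _] _] := Hv _ (refl_ball _ tr).
    move=> /is_derive_line_scale D2.
    have D3 := is_derive_quadratic (b j) l (quadr b y z - k * N * d * s) t.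
    rewrite (_ : (fun t => _) = (fun t => v (t *: e j + z)) -
       (fun t => v (t *: (sg *: e j) + refl i y z)) +
       (fun t => b j * t ^+ 2 + l * t + (quadr b y z - k * N * d * s))).
      exact: (is_deriveD (is_deriveB D1 D2) D3).
    apply/funext => r; rewrite /w !fctE refl_line quadr_line (coord_line ec) -/sg /l /s.
    by ring.
  - have [_ /(_ j)[_ /derivableP D1] _] := Hv _ zy.
    have [_ /(_ j)[_ /derivableP D2] _] := Hv _ (norm_refl i (ltW d0) zy).
    have {}D1 := is_derive_line0 D1.
    have {}D2 := is_derive_line0 (is_derive_scale sg D2).
    have D3 := is_derive_quadratic 0 (2 * b j) l 0.
    rewrite mulr0 add0r in D3.
    rewrite (_ : (fun t => _) = (fun t => 'D_(e j) v (t *: e j + z)) -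
        sg \*: (fun t => 'D_(e j) v (t *: (sg *: e j) + refl i y z)) +
        (fun t => 0 * t ^+ 2 + 2 * b j * t + l)).
      exact: (is_deriveD (is_deriveB D1 (is_deriveZ _ D2)) D3).
    by apply/funext => r; rewrite !fctE mul0r add0r.
  - by move=> t /inK zt; rewrite scale0r add0r; apply: zmax; exact/mem_set.
have [_ _ vz] := Hv _ zy.
have [_ _ vrz] := Hv _ (norm_refl i (ltW d0) zy).
have sumD2 : \sum_j (('D_(e j) ('D_(e j) v) z : R) -
    'D_(e j) ('D_(e j) v) (refl i y z) + 2 * b j) = 2 * \sum_j b j.
  exact: (sum_zeros b vz vrz).
(* The second derivative tests add up to [\sum_j b j <= 0]; but the terms in [2 * M / d ^+ 2] cancel
   in this sum, which leaves [eps * #|I| > 0]. *)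
have : 2 * \sum_j b j <= 0 by rewrite -sumD2; apply: sumr_le0 => j _; exact: D2.
apply/negP; rewrite -ltNge pmulr_rgt0//.
rewrite big_split /= -mulr_sumr sumr_const sumrB -mulr_sumr.
rewrite (bigD1 i)//= eqxx big1 => [|j /negbTE-> //].
rewrite sumr_const addr0 mulr1 subrr mulr0 addr0 mulrn_wgt0//.
by apply/card_gt0P; exists i.
Qed.

Let harmonic_growth v y i (d M t : R) :
    0 < d ->
    (forall x, `|x - y| <= d -> harmonic_at e v x) ->
    (forall x, `|x - y| <= d -> `|v x| <= M) ->
    0 <= t <= d ->
  v (t *: e i + y) - v (- t *: e i + y) <= 2 * (#|I|%:R * M / d) * t.
Proof.
move=> d0 Hv HM /andP[t0 td]; set N : R := #|I|%:R.
have M0 : 0 <= M by apply: le_trans (HM y _); rewrite // subrr normr0 ltW.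
have N1 : 1 <= N by rewrite ler1n; apply/card_gt0P; exists i.
have N0 := le_trans ler01 N1.
have ty : `|t *: e i + y - y| <= d.
  rewrite addrK normrZ ger0_norm// (le_trans _ td)// ler_piMr//.
  exact: norm_dir_le1.
have ti : c i (t *: e i + y) - c i y = t.
  by rewrite (coord_line ec) eqxx mulr1 addrK.
have rt : refl i y (t *: e i + y) = - t *: e i + y.
  by rewrite /refl ti addrA -scalerDl; congr (_ *: _ + _); ring.
have b2d : 2 * M / d ^+ 2 * d = 2 * M / d by field; exact: lt0r_neq0.
have k0 : 0 <= 2 * M / d ^+ 2 by rewrite divr_ge0 ?sqr_ge0// mulr_ge0.
apply/ler_addgt0Pr => eps eps0.
have Nd0 : 0 < N * d ^+ 2 by rewrite mulr_gt0 ?exprn_gt0// (lt_le_trans ltr01).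
(* Normalized so that the bound of [half_cube_max] becomes [eps]. *)
have eps'0 : 0 < eps / (N * d ^+ 2) by rewrite divr_gt0.
have := @half_cube_max v y i d M _ _ d0 eps'0 Hv HM ty.
rewrite ti => /(_ t0); rewrite rt quadr_line eqxx mulr1 subrr mulr0 mul0r addr0.
rewrite [quadr _ y y]big1 ?addr0; last by move=> k _; rewrite subrr expr0n mulr0.
rewrite -/N (_ : eps / (N * d ^+ 2) * N * d ^+ 2 = eps); last by rewrite -mulrA divfK// gt_eqF.
rewrite (_ : 2 * M / d ^+ 2 * N * d * t = 2 * (N * M / d) * t); last first.
  by field; exact: lt0r_neq0.
suff : 0 <= (eps / (N * d ^+ 2) + 2 * M / d ^+ 2 * (N - 1)) * t ^+ 2 by lra.
apply: mulr_ge0; last exact: sqr_ge0.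
by apply: addr_ge0; [exact: ltW|apply: mulr_ge0 => //; rewrite subr_ge0].
Qed.

(** The hypotheses hold near [x]: the derivative of [u - v] has to agree with the difference of the
    derivatives on a neighbourhood before it is differentiated again. *)
Lemma harmonic_atB u v x :
  (\forall x \near x, harmonic_at e u x) ->
  (\forall x \near x, harmonic_at e v x) -> harmonic_at e (u - v) x.
Proof.
move=> nu nv; have [uc uD uL] := nbhs_singleton nu.
have [vc vD vL] := nbhs_singleton nv.
have D1 i : \forall x \near x, ('D_(e i) u - 'D_(e i) v) x = 'D_(e i) (u - v) x.
  apply: filterS2 nu nv => z [_ /(_ i)[uz _] _] [_ /(_ i)[vz _] _].
  by rewrite (deriveB uz vz).
have D2 i := near_eq_is_derive (D1 i)
  (is_deriveB (derivableP (uD i).2) (derivableP (vD i).2)).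
split; first exact: continuousB.
  move=> i; split; last by case: (D2 i).
  exact: derivableB (uD i).1 (vD i).1.
transitivity (\sum_i (('D_(e i) ('D_(e i) u) x : R) - ('D_(e i) ('D_(e i) v) x : R))).
  by apply: eq_bigr => i _; case: (D2 i).
exact: (sumB_zeros uL vL).
Qed.

Lemma harmonic_atZ (a : R) v x :
  (\forall x \near x, harmonic_at e v x) -> harmonic_at e (a \*: v) x.
Proof.
move=> nv; have [vc vD vL] := nbhs_singleton nv.
have D1 i : \forall x \near x, (a \*: 'D_(e i) v) x = 'D_(e i) (a \*: v) x.
  by apply: filterS nv => z [_ /(_ i)[vz _] _]; rewrite (deriveZ _ vz).
have D2 i := near_eq_is_derive (D1 i) (is_deriveZ a (derivableP (vD i).2)).
split; first exact: (continuousM (@cst_continuous _ _ a x) vc).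
  move=> i; split; last by case: (D2 i).
  exact: derivableZ (vD i).1.
transitivity (\sum_i a * ('D_(e i) ('D_(e i) v) x : R)).
  by apply: eq_bigr => i _; case: (D2 i).
exact: (sumZ_zeros a vL).
Qed.

Lemma harmonic_at_shift v z x :
  harmonic_at e v (z + x) -> harmonic_at e (fun x => v (z + x)) x.
Proof.
have E (w : V -> R) y f :
    (fun h : R => h^-1 *: (((fun x => w (z + x)) \o shift y) (h *: f) - w (z + y)))
    = (fun h : R => h^-1 *: ((w \o shift (z + y)) (h *: f) - w (z + y))).
  by apply/funext => h /=; rewrite addrCA.
have D1 w y f : 'D_f (fun x => w (z + x)) y = 'D_f w (z + y).
  by rewrite /derive E.
have D2 w y f : derivable (fun x => w (z + x)) y f = derivable w (z + y) f.
  by rewrite /derivable E.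
have D3 i : 'D_(e i) (fun x => v (z + x)) = fun x => 'D_(e i) v (z + x).
  by apply/funext => y; rewrite D1.
move=> [vc vD vL]; split.
- apply: (@continuous_comp _ _ _ (fun x => z + x) v) => //.
  by apply: cvgD; [exact: cvg_cst|exact: cvg_id].
- by move=> i; rewrite D3 (D2 v) (D2 ('D_(e i) v)); exact: vD.
- by rewrite -[RHS]vL; apply: eq_bigr => i _; rewrite D3 (D1 ('D_(e i) v)).
Qed.

Lemma near_harmonic v y (r : R) x :
  (forall x, `|x - y| < r -> harmonic_at e v x) -> `|x - y| < r ->
  \forall x \near x, harmonic_at e v x.
Proof.
move=> H xy; apply/near_normP; exists (r - `|x - y|); first by rewrite subr_gt0.
move=> z zx; apply: H; rewrite -(subrKA x) (le_lt_trans (ler_normD _ _))//.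
by rewrite -ltrBrDr.
Qed.

(** [harmonic_growth] divided by [2 * t] bounds the symmetric difference quotient, hence the
    derivative, from above; [- v] gives the lower bound. Since [d < r], the closed cube of radius
    [d] lies in the domain. *)
Lemma gradient_estimate v y i (r d M : R) : 0 < d < r ->
    (forall x, `|x - y| < r -> harmonic_at e v x) ->
    (forall x, `|x - y| < r -> `|v x| <= M) ->
  `|'D_(e i) v y| <= #|I|%:R * M / d.
Proof.
move=> /andP[d0 dr] Hv vM.
have one_sided w : (forall x, `|x - y| <= d -> harmonic_at e w x) ->
    (forall x, `|x - y| <= d -> `|w x| <= M) -> 'D_(e i) w y <= #|I|%:R * M / d.
  move=> Hw wM.
  have [|_ /(_ i)[/derivableP/is_deriveP D _] _] := Hw y.
    by rewrite subrr normr0 ltW.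
  apply/ler_addgt0Pr => eps /D[rho rho0 Hrho].
  pose t := Num.min d rho / 2.
  have m0 : 0 < Num.min d rho by rewrite lt_min d0.
  have t0 : 0 < t by rewrite divr_gt0.
  have tm : t < Num.min d rho by rewrite ltr_pdivrMr// ltr_pMr// ltr1n.
  have [td tr] : t < d /\ t < rho by move: tm; rewrite lt_min => /andP[].
  have t0d : 0 <= t <= d by rewrite !ltW.
  have := @harmonic_growth w y i d M t d0 Hw wM t0d.
  have := Hrho t; rewrite gt_eqF// gtr0_norm// => /(_ isT tr).
  have := Hrho (- t); rewrite oppr_eq0 gt_eqF// normrN gtr0_norm// => /(_ isT tr).
  set W := #|I|%:R * M / d; set wD : R := 'D_(e i) w y.
  set wp := w (t *: e i + y); set wm := w (- t *: e i + y).
  rewrite -![_ *: _]/(_ * _) invrN !ler_norml => /andP[A _] /andP[B _] C.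
  have tab : t * (t^-1 * (wp - w y) - t^-1 * (wm - w y)) <= t * (2 * W).
    by rewrite -mulrBr mulVKf ?gt_eqF// opprB addrA subrK [leRHS]mulrC.
  by move: tab; rewrite ler_pM2l//; rewrite mulNr in A; lra.
have y1 x : `|x - y| <= d -> `|x - y| < r by move/le_lt_trans; apply.
rewrite ler_norml; apply/andP; split; last by apply: one_sided => x /y1; auto.
have [_ /(_ i)[vD _] _] : harmonic_at e v y by apply: Hv; rewrite subrr normr0 (lt_trans d0).
rewrite lerNl -deriveN//; apply: one_sided => x /y1 xy; last by rewrite normrN vM.
rewrite -scaleN1r; apply: harmonic_atZ.
exact: near_harmonic Hv _.
Qed.

End Coordinates.

(** * Uniform limits of harmonic functions *)

Section Schwarz.
Context {R : realType} {V : normedModType R}.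
Implicit Types (u : V -> R) (x a b : V).

(** Two applications of the mean value theorem: to [u (s *: b + y) - u y] as a function of [y] along
    [a], then to [ua] along [b]. *)
Let second_difference u x a b (ua uab : V -> R) :
  (\forall y \near x, is_derive y a u (ua y)) ->
  (\forall y \near x, is_derive y b ua (uab y)) ->
  forall r : R, 0 < r -> exists2 d : R, 0 < d & forall s : R, 0 < s < d ->
    exists2 p, `|p - x| < r &
      u (s *: a + (s *: b + x)) - u (s *: a + x) - (u (s *: b + x) - u x) =
      s ^+ 2 * uab p.
Proof.
move=> /near_normP[r1 r10 H1] /near_normP[r2 r20 H2] r r0.
pose m := Num.min r (Num.min r1 r2).
have m0 : 0 < m by rewrite !lt_min r0 r10 r20.
have k0 : 0 < `|a| + `|b| + 1 by rewrite ltr_wpDl// addr_ge0.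
exists (m / (`|a| + `|b| + 1)); first by rewrite divr_gt0.
move=> s /andP[s0]; rewrite ltr_pdivlMr// => sm.
have close (t1 t2 : R) : 0 <= t1 <= 1 -> 0 <= t2 <= 1 ->
    `|(t2 * s) *: b + ((t1 * s) *: a + x) - x| < m.
  move=> /andP[t10 t11] /andP[t20 t21]; apply: le_lt_trans sm.
  rewrite addrA addrK (le_trans (ler_normD _ _))// !normrZ ?normrM.
  rewrite (ger0_norm t10) (ger0_norm t20) (gtr0_norm s0) !mulrDr addrC mulr1.
  apply: ler_wpDr; first exact: ltW.
  by apply: lerD; rewrite ler_wpM2r// ler_piMl// ltW.
have mr y : `|y - x| < m -> [/\ `|y - x| < r, `|y - x| < r1 & `|y - x| < r2].
  by rewrite !lt_min => /andP[-> /andP[-> ->]].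
have zo (t : R) : 0 < t < 1 -> 0 <= t <= 1 by move=> /andP[/ltW-> /ltW->].
have I1 : 0 <= (1 : R) <= 1 by rewrite ler01 lexx.
have I0 : 0 <= (0 : R) <= 1 by rewrite ler01 lexx.
have [|t1 /zo t1I E1] := @mvt_line R V (fun y => u (s *: b + y) - u y)
    (fun y => ua (s *: b + y) - ua y) x a s.
  move=> t tI.
  have [_ y1 _] := mr _ (close _ _ tI I1); have [_ y2 _] := mr _ (close _ _ tI I0).
  rewrite mul1r in y1; rewrite mul0r scale0r add0r in y2.
  have /is_derive_line0 D1 := H1 _ y1; have /is_derive_line0 D2 := H1 _ y2.
  have := is_deriveB D1 D2.
  rewrite -[X in is_derive X](mulr0 0) => D3.
  apply/is_deriveP => eps /(proj1 (is_deriveP _ _ _ _) D3)[d d0 Hd].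
  exists d => // h h0 hd; have := Hd h h0 hd.
  rewrite !fctE mulr0 !addr0 ![_%:A]mulr1 ?scale0r ?add0r.
  by rewrite [s *: b + (h *: a + _)]addrCA.
have [|t2 /zo t2I E2] := @mvt_line R V ua uab ((t1 * s) *: a + x) b s.
  by move=> t tI; have [_ _ y2] := mr _ (close _ _ t1I tI); exact: H2.
exists ((t2 * s) *: b + ((t1 * s) *: a + x)).
  by have [] := mr _ (close _ _ t1I t2I).
rewrite expr2 -mulrA -E2 -E1.
by rewrite [s *: a + (s *: b + x)]addrCA.
Qed.

(** The second difference is symmetric in [a] and [b], so [uab p = uba q] at points [p] and [q]
    arbitrarily close to [x]; continuity concludes. *)
Lemma derive_commute u x a b (ua ub uab uba : V -> R) :
  (\forall y \near x, is_derive y a u (ua y)) ->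
  (\forall y \near x, is_derive y b u (ub y)) ->
  (\forall y \near x, is_derive y b ua (uab y)) ->
  (\forall y \near x, is_derive y a ub (uba y)) ->
  {for x, continuous uab} -> {for x, continuous uba} -> uab x = uba x.
Proof.
move=> Da Db Dab Dba /continuous_normP cab /continuous_normP cba.
apply/eqP; rewrite -subr_eq0 -normr_eq0; apply/eqP/le_anti/andP; split=> //.
apply/ler_addgt0Pr => eps eps0; rewrite add0r.
have e20 : 0 < eps / 2 by rewrite divr_gt0.
have [r1 r10 H1] := cab _ e20; have [r2 r20 H2] := cba _ e20.
have [d1 d10 K1] := second_difference Da Dab r10.
have [d2 d20 K2] := second_difference Db Dba r20.
pose s := Num.min d1 d2 / 2.
have m0 : 0 < Num.min d1 d2 by rewrite lt_min d10.
have s0 : 0 < s by rewrite divr_gt0.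
have sm : s < Num.min d1 d2 by rewrite ltr_pdivrMr// ltr_pMr// ltr1n.
have [sd1 sd2] : s < d1 /\ s < d2 by move: sm; rewrite lt_min => /andP[].
have [|p px E1] := K1 s; first by rewrite s0.
have [|q qx E2] := K2 s; first by rewrite s0.
have pq : uab p = uba q.
  have s20 : s ^+ 2 != 0 by rewrite sqrf_eq0 gt_eqF.
  apply: (mulfI s20); rewrite -E1 -E2 [s *: a + (s *: b + x)]addrCA.
  by ring.
rewrite -(subrKA (uab p)) {2}pq (le_trans (ler_normD _ _))//.
by rewrite [leRHS](splitr eps) lerD ?H2// distrC H1.
Qed.

End Schwarz.

(** * Differentiability of uniform limits of harmonic functions *)

Section HarmonicApproximation.
Context {R : realType} {V : normedModType R} {I : finType}.
Variables (e : I -> V) (c : I -> V -> R).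
Hypothesis ec : coord_system e c.
Implicit Types (x y z : V) (u v w : V -> R).

(* A substitute for weak harmonicity: locally uniform limits of functions that
   are harmonic in the classical sense. *)
Definition harmonic_approx x (r : R) u : Prop :=
  forall eps : R, 0 < eps -> exists2 v,
    forall y, `|y - x| < r -> harmonic_at e v y &
    forall y, `|y - x| < r -> `|v y - u y| <= eps.

Lemma harmonic_approx_sub x x' (r r' : R) u : `|x' - x| + r' <= r ->
  harmonic_approx x r u -> harmonic_approx x' r' u.
Proof.
move=> xr H eps /H[v Hv vu].
have sub y : `|y - x'| < r' -> `|y - x| < r.
  move=> yx'; apply: lt_le_trans xr.
  by rewrite (le_lt_trans (ler_distD x' _ _))// [ltLHS]addrC ltrD2l.
by exists v => y /sub; [exact: Hv|exact: vu].
Qed.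

Lemma harmonic_approx_continuous x r u y : harmonic_approx x r u ->
  `|y - x| < r -> {for y, continuous u}.
Proof.
move=> H yx; apply/continuous_normP => eps eps0.
have e30 : 0 < eps / 3 by rewrite divr_gt0.
have [v Hv vu] := H _ e30.
have [/continuous_normP /(_ _ e30)[d d0 vd] _ _] := Hv _ yx.
exists (Num.min d (r - `|y - x|)); first by rewrite lt_min d0 subr_gt0.
move=> z; rewrite lt_min => /andP[/vd vzy zr].
have zx : `|z - x| < r.
  by rewrite -(subrKA y) (le_lt_trans (ler_normD _ _))// -ltrBrDr.
have := vu _ zx; have := vu _ yx; move: vzy.
by rewrite !ler_norml => /andP[? ?] /andP[? ?] /andP[? ?]; lra.
Qed.

Let dist_step y x (t : R) i : `|t *: e i + y - x| <= `|y - x| + `|t|.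
Proof.
rewrite -addrA (le_trans (ler_normD _ _))// [leRHS]addrC lerD2r normrZ ler_piMr//.
exact: norm_dir_le1 ec _.
Qed.

Let dq u i (t : R) y := t^-1 * (u (t *: e i + y) - u y).

(** The quotient stands in for ['D_(e i) v]: as a combination of translates it is harmonic without
    any third derivative of [v]. *)
Let dq_harmonic x (r t : R) v i : (forall y, `|y - x| < r -> harmonic_at e v y) ->
  forall y, `|y - x| < r - `|t| -> harmonic_at e (dq v i t) y.
Proof.
move=> Hv y yx.
have nt z : `|z - x| < r - `|t| -> `|t *: e i + z - x| < r.
  by move=> zx; have := dist_step z x t i; lra.
have sub z : `|z - x| < r - `|t| -> `|z - x| < r.
  by move=> /lt_le_trans; apply; rewrite gerBl.
have -> : dq v i t = t^-1 \*: ((fun y => v (t *: e i + y)) - v) by [].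
have H1 z : `|z - x| < r - `|t| -> harmonic_at e (fun y => v (t *: e i + y)) z.
  by move=> zx; apply: harmonic_at_shift; exact/Hv/nt.
have H2 z : `|z - x| < r - `|t| -> harmonic_at e ((fun y => v (t *: e i + y)) - v) z.
  move=> zx; apply: harmonic_atB; first exact: near_harmonic H1 _.
  by apply: near_harmonic Hv _; exact: sub.
by apply: harmonic_atZ; exact: near_harmonic H2 _.
Qed.

(** The constant of the gradient estimate at a point with margin [d]. The factor [2] arises because
    the estimate needs a radius strictly below [d], taken to be [d / 2]. *)
Let L (d : R) := 2 * #|I|%:R / d.

Let grad_le v x (r d M : R) i : 0 < d ->
    (forall y, `|y - x| < r + d -> harmonic_at e v y) ->
    (forall y, `|y - x| < r + d -> `|v y| <= M) ->
  forall y, `|y - x| <= r -> `|'D_(e i) v y| <= L d * M.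
Proof.
move=> d0 Hv vM y yx.
have d2 : 0 < d / 2 < d by rewrite divr_gt0//= ltr_pdivrMr// ltr_pMr// ltr1n.
have sub z : `|z - y| < d -> `|z - x| < r + d.
  move=> zy; rewrite -(subrKA y) (le_lt_trans (ler_normD _ _))// addrC.
  exact: ler_ltD.
have -> : L d * M = #|I|%:R * M / (d / 2).
  by rewrite /L; field; rewrite gt_eqF.
by apply: (gradient_estimate ec i d2) => z /sub; [exact: Hv|exact: vM].
Qed.

Let step_norm y x (r s t : R) i : 0 <= s <= 1 -> `|y - x| <= r ->
  `|(s * t) *: e i + y - x| <= r + `|t|.
Proof.
move=> /andP[s0 s1] yx; apply: (le_trans (dist_step _ _ _ _)).
by rewrite lerD// normrM (ger0_norm s0) ler_piMl.
Qed.

Let dq_le v x (r d M t : R) i : 0 < d ->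
    (forall y, `|y - x| < r + d -> harmonic_at e v y) ->
    (forall y, `|y - x| < r + d -> `|v y| <= M) ->
  forall y, `|y - x| <= r - `|t| -> `|dq v i t y| <= L d * M.
Proof.
move=> d0 Hv vM y yx.
have G := grad_le i d0 Hv vM.
have [->|t0] := eqVneq t 0.
  rewrite /dq invr0 mul0r normr0; apply: le_trans (G y _) => //.
  by rewrite (le_trans yx)// gerBl.
have st s : 0 <= s <= 1 -> `|(s * t) *: e i + y - x| <= r.
  by move=> s01; have := step_norm t i s01 yx; rewrite subrK.
have [|s /andP[s0 s1] E] := @mvt_line R V v ('D_(e i) v) y (e i) t.
  move=> s s01; apply: derivableP.
  have [|_ /(_ i)[] //] := Hv ((s * t) *: e i + y).
  by rewrite (le_lt_trans (st _ s01))// ltrDl.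
rewrite /dq E mulrA mulVf// mul1r; apply: G; apply: st.
by rewrite !ltW.
Qed.

(** A rate linear in [t] with a constant that depends on [v] only through [M]. The harmonic function
    [dq v i s] is bounded by [L d * M], so its derivative is bounded by [L d ^+ 2 * M], which is a
    Lipschitz estimate for ['D_(e i) v] along [e i]. The two gradient estimates and the step [s]
    each use up a margin [d], whence the radius [4 * d]. *)
Let dq_derive v x (d M t : R) i : 0 < d ->
    (forall y, `|y - x| < 4 * d -> harmonic_at e v y) ->
    (forall y, `|y - x| < 4 * d -> `|v y| <= M) -> t != 0 -> `|t| <= d ->
  forall y, `|y - x| <= d ->
  `|dq v i t y - 'D_(e i) v y| <= `|t| * (L d ^+ 2 * M).
Proof.
move=> d0 Hv vM t0 td y yx.
have lip (s : R) : `|s| <= d ->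
    `|'D_(e i) v (s *: e i + y) - 'D_(e i) v y| <= `|s| * (L d ^+ 2 * M).
  move=> sd.
  have [->|s0] := eqVneq s 0; first by rewrite scale0r add0r subrr normr0 mul0r.
  have H3 : forall z, `|z - x| < d + d -> harmonic_at e (dq v i s) z.
    move=> z zx; apply: (dq_harmonic i Hv); rewrite (lt_le_trans zx)//.
    rewrite lerBrDr; lra.
  have M3 : forall z, `|z - x| < d + d -> `|dq v i s z| <= L d * M.
    have e4 : 4 * d = 3 * d + d by ring.
    rewrite e4 in Hv vM.
    move=> z zx; apply: (dq_le i d0 Hv vM); rewrite (le_trans (ltW zx))//.
    rewrite lerBrDr; lra.
  have := grad_le i d0 H3 M3 yx.
  have Dv z : `|z - x| < 4 * d -> is_derive z (e i) v ('D_(e i) v z).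
    by move=> /Hv[_ /(_ i)[/derivableP]].
  have y4 : `|y - x| < 4 * d by lra.
  have sy4 : `|s *: e i + y - x| < 4 * d.
    have := step_norm s i (_ : 0 <= (1 : R) <= 1) yx.
    rewrite ler01 lexx => /(_ isT); rewrite mul1r; lra.
  have -> : 'D_(e i) (dq v i s) y = s^-1 * ('D_(e i) v (s *: e i + y) - 'D_(e i) v y).
    have D1 : is_derive y (e i) (fun y => v (s *: e i + y)) ('D_(e i) v (s *: e i + y)).
      have /is_deriveP D := Dv _ sy4; apply/is_deriveP => eps /D[rr r0 Hr].
      by exists rr => // h h0 hr; have := Hr h h0 hr; rewrite addrCA.
    by have [] := is_deriveZ s^-1 (is_deriveB D1 (Dv _ y4)).
  rewrite normrM normfV ler_pdivrMl ?normr_gt0// => /le_trans; apply.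
  by rewrite expr2 -mulrA.
have stI s : 0 <= s <= 1 -> `|s * t| <= `|t|.
  by move=> /andP[s0 s1]; rewrite normrM (ger0_norm s0) ler_piMl.
have [|s /andP[s0 s1] E] := @mvt_line R V v ('D_(e i) v) y (e i) t.
  move=> s s01; apply: derivableP.
  have [|_ /(_ i)[] //] := Hv ((s * t) *: e i + y).
  have := step_norm t i s01 yx; lra.
have s01 : 0 <= s <= 1 by rewrite !ltW.
rewrite /dq E mulrA mulVf// mul1r.
apply: (le_trans (lip _ (le_trans (stI _ s01) td))).
rewrite ler_wpM2r ?stI// mulr_ge0 ?sqr_ge0// (le_trans _ (vM y _))//.
by rewrite (le_lt_trans yx)//; lra.
Qed.

Let dq_approx u v x (d eps t : R) i :
    (forall y, `|y - x| < 4 * d -> `|v y - u y| <= eps) ->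
    t != 0 -> `|t| <= d -> 
  forall y, `|y - x| < d -> `|dq v i t y - dq u i t y| <= 2 * eps / `|t|.
Proof.
move=> vu t0 td y yx.
have d0 : 0 < d by exact: le_lt_trans yx.
have y4 : `|y - x| < 4 * d by lra.
have ty4 : `|t *: e i + y - x| < 4 * d by have := dist_step y x t i; lra.
rewrite /dq -mulrBr normrM normfV mulrC ler_wpM2r ?invr_ge0//.
have := vu _ y4; have := vu _ ty4.
by rewrite !ler_norml => /andP[? ?] /andP[? ?]; lra.
Qed.

(** Both quotients are compared with those of an approximant [v]. As [C] does not depend on [v], the
    closeness of [v] to [u] can be chosen after [s] and [t], and so outweighs the division by
    them. *)
Let dq_cauchy u x (d C : R) i : 0 < d -> 0 <= C ->
    (forall eps : R, 0 < eps -> exists2 v : V -> R,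
      forall y, `|y - x| < 4 * d -> `|v y - u y| <= eps &
      forall t : R, t != 0 -> `|t| <= d -> forall y, `|y - x| <= d ->
        `|dq v i t y - 'D_(e i) v y| <= `|t| * C) ->
  forall y s t, `|y - x| < d -> s != 0 -> t != 0 -> `|s| <= d -> `|t| <= d ->
  `|dq u i s y - dq u i t y| <= (`|s| + `|t|) * C.
Proof.
move=> d0 C0 H y s t yx s0 t0 sd td; apply/ler_addgt0Pr => eps eps0.
have sp : 0 < `|s| by rewrite normr_gt0.
have tp : 0 < `|t| by rewrite normr_gt0.
pose eta := eps / (2 / `|s| + 2 / `|t|).
have k0 : 0 < 2 / `|s| + 2 / `|t| by rewrite addr_gt0// divr_gt0.
have eta0 : 0 < eta by rewrite divr_gt0.
have [v vu vD] := H _ eta0.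
have A1 := dq_approx i vu s0 sd yx; have A2 := dq_approx i vu t0 td yx.
have B1 := vD _ s0 sd _ (ltW yx); have B2 := vD _ t0 td _ (ltW yx).
have E : eps = 2 * eta / `|s| + 2 * eta / `|t|.
  rewrite [LHS](_ : _ = eta * (2 / `|s| + 2 / `|t|)); first by ring.
  by rewrite /eta divfK ?gt_eqF.
move: A1 A2 B1 B2; rewrite {1}E mulrDl !ler_norml.
set q1 := 2 * eta / `|s|; set q2 := 2 * eta / `|t|.
by move=> /andP[? ?] /andP[? ?] /andP[? ?] /andP[? ?]; apply/andP; split; lra.
Qed.

(** Completeness of the reals gives the derivative; [s] tending to [0] in the Cauchy estimate gives
    the rate. *)
Let dq_cvg u x (d C : R) i : 0 < d -> 0 <= C ->
    (forall y s t, `|y - x| < d -> s != 0 -> t != 0 -> `|s| <= d -> `|t| <= d ->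
      `|dq u i s y - dq u i t y| <= (`|s| + `|t|) * C) ->
  forall y, `|y - x| < d -> derivable u y (e i) /\
    forall t, t != 0 -> `|t| <= d -> `|dq u i t y - 'D_(e i) u y| <= `|t| * C.
Proof.
move=> d0 C0 H y yx.
have uy : derivable u y (e i).
  apply: cauchy_cvg; apply: cauchy_exP => eps eps0.
  have k0 : 0 < 2 * (C + 1) by rewrite mulr_gt0// ltr_wpDl.
  pose s := Num.min d (eps / (2 * (C + 1))).
  have s0 : 0 < s by rewrite lt_min d0 divr_gt0.
  have [sd se] : s <= d /\ s <= eps / (2 * (C + 1)) by rewrite !ge_min !lexx orbT.
  exists (dq u i s y); exists s => // t /=.
  rewrite sub0r normrN => ts t0.
  have sa : `|s| = s by rewrite gtr0_norm.
  rewrite -ball_normE /=; apply: le_lt_trans (H y s t yx _ t0 _ _) _.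
  - by rewrite gt_eqF.
  - by rewrite sa.
  - exact/ltW/(lt_le_trans ts).
  have Cs : 2 * s * (C + 1) <= eps.
    by move: se; rewrite ler_pdivlMr// mulrCA mulrA.
  rewrite sa; apply: lt_le_trans Cs.
  apply: (@le_lt_trans _ _ (2 * s * C)); last by rewrite ltr_pM2l ?mulr_gt0// ltrDl.
  by rewrite ler_wpM2r//; lra.
split=> // t t0 td; apply/ler_addgt0Pr => eps eps0.
have e20 : 0 < eps / 2 by rewrite divr_gt0.
have /derivableP/is_deriveP/(_ _ e20)[r r0 Hr] := uy.
have k0 : 0 < 2 * (C + 1) by rewrite mulr_gt0// ltr_wpDl.
pose s := Num.min d (Num.min (r / 2) (eps / (2 * (C + 1)))).
have s0 : 0 < s by rewrite !lt_min d0 !divr_gt0.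
have [sd sr se] : [/\ s <= d, s <= r / 2 & s <= eps / (2 * (C + 1))].
  by rewrite !ge_min !lexx !orbT.
have sa : `|s| = s by rewrite gtr0_norm.
have sn0 : s != 0 by rewrite gt_eqF.
have := Hr s sn0; rewrite sa => /(_ _)/wrap[].
  by apply: le_lt_trans sr _; rewrite ltr_pdivrMr// ltr_pMr// ltr1n.
move=> A; have B := H y s t yx sn0 t0 _ td; rewrite sa in B; have {}B := B sd.
have Cs : 2 * s * (C + 1) <= eps.
  by move: se; rewrite ler_pdivlMr// mulrCA mulrA.
have Cs' : s * C <= eps / 2 by lra.
move: A B; rewrite -[_ *: _]/(dq u i s y) mulrDl !ler_norml.
by move=> /andP[? ?] /andP[? ?]; apply/andP; split; lra.
Qed.

(** The approximants of the derivative are the harmonic quotients [dq v i t]: the rate determines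
    [t], and only then is [v] chosen close to [u], relative to [t]. *)
Theorem harmonic_approx_derive x (r : R) u i : 0 < r -> harmonic_approx x r u ->
  exists2 d : R, 0 < d & (forall y, `|y - x| < d -> derivable u y (e i)) /\
    harmonic_approx x d ('D_(e i) u).
Proof.
move=> r0 Hu.
have /continuous_normP /(_ _ ltr01)[d1 d10 ud1] : {for x, continuous u}.
  by apply: harmonic_approx_continuous Hu _; rewrite subrr normr0.
(* On the ball of radius [4 * d] the function [u] stays within [1] of [u x], hence is bounded by
   [M]. *)
pose d := Num.min r d1 / 4.
have d0 : 0 < d by rewrite divr_gt0// lt_min r0.
have [dr dd1] : 4 * d <= r /\ 4 * d <= d1.
  by rewrite /d mulrC divfK// !ge_min !lexx orbT.
pose M := `|u x| + 1; pose C := L d ^+ 2 * (M + 1).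
have C0 : 0 <= C by rewrite mulr_ge0 ?sqr_ge0// /M addr_ge0// addr_ge0.
have Hv (eps : R) : 0 < eps -> exists v : V -> R, [/\
    forall y, `|y - x| < 4 * d -> harmonic_at e v y,
    forall y, `|y - x| < 4 * d -> `|v y - u y| <= eps &
    forall t : R, t != 0 -> `|t| <= d -> forall y, `|y - x| <= d ->
      `|dq v i t y - 'D_(e i) v y| <= `|t| * C].
  (* Closeness within [1] bounds every approximant by [M + 1], so that [C] does not depend on
     [eps]. *)
  move=> eps0; have m0 : 0 < Num.min eps 1 by rewrite lt_min eps0 ltr01.
  have [v vH vu] := Hu _ m0.
  have sub y : `|y - x| < 4 * d -> `|y - x| < r by move=> /lt_le_trans; apply.
  have [vu1 vu2] : (forall y, `|y - x| < 4 * d -> `|v y - u y| <= eps) /\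
                   (forall y, `|y - x| < 4 * d -> `|v y - u y| <= 1).
    by split=> y /sub/vu; rewrite le_min => /andP[].
  exists v; split=> //; first by move=> y /sub/vH.
  move=> t t0 td y yx.
  apply: (@dq_derive v x d (M + 1) t i d0 _ _ t0 td y yx); first by move=> z /sub/vH.
  move=> z zx; have := vu2 _ zx; have := ud1 _ (lt_le_trans zx dd1).
  have := lerB_dist (v z) (u z); have := lerB_dist (u z) (u x).
  by rewrite /M; lra.
have Hc := @dq_cauchy u x d C i d0 C0.
have /(dq_cvg d0 C0) H : forall y s t, `|y - x| < d -> s != 0 -> t != 0 ->
    `|s| <= d -> `|t| <= d -> `|dq u i s y - dq u i t y| <= (`|s| + `|t|) * C.
  by apply: Hc => eps /Hv[v [_ ? ?]]; exists v.
exists d => //; split=> [y /H[]//|eps eps0].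
have k0 : 0 < 2 * (C + 1) by rewrite mulr_gt0// ltr_wpDl.
pose t := Num.min d (eps / (2 * (C + 1))).
have t0 : 0 < t by rewrite lt_min d0 divr_gt0.
have [td te] : t <= d /\ t <= eps / (2 * (C + 1)) by rewrite !ge_min !lexx orbT.
have ta : `|t| = t by rewrite gtr0_norm.
have tn0 : t != 0 by rewrite gt_eqF.
(* The quotient turns an error [eta] into [2 * eta / t = eps / 2]. *)
pose eta := eps * t / 4.
have eta0 : 0 < eta by rewrite divr_gt0// mulr_gt0.
have [v [vH vu _]] := Hv _ eta0.
exists (dq v i t) => y yx.
  by apply: (dq_harmonic i vH); rewrite ta; lra.
have Ct : 2 * t * (C + 1) <= eps.
  by move: te; rewrite ler_pdivlMr// mulrCA mulrA.
have Ct' : t * C <= eps / 2 by lra.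
have A : `|dq v i t y - dq u i t y| <= eps / 2.
  have -> : eps / 2 = 2 * eta / `|t| by rewrite ta /eta; field.
  by apply: (dq_approx i vu) => //; rewrite ta.
have [_ /(_ t tn0)] := H _ yx; rewrite ta => /(_ td).
move: A; rewrite !ler_norml => /andP[? ?] /andP[? ?]; apply/andP; split; lra.
Qed.

End HarmonicApproximation.

(** * Steklov averages *)

(** [z + y] may leave [K], hence the continuity on the whole space; functions given on a ball
    acquire it through [clamp]. *)
Lemma compact_uniform_continuity (R : realType) (V W : normedModType R)
    (K : set V) (u : V -> W) : compact K -> continuous u ->
  forall eps : R, 0 < eps -> exists2 d : R, 0 < d & forall z, `|z| < d ->
    forall y, K y -> `|u (z + y) - u y| <= eps.
Proof.
move=> /compact_near_coveringP/near_covering_withinP cK cu eps eps0.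
have /near_normP[d d0 Hd] : \forall z \near (0 : V), K `<=`
    [set y | `|u (z + y) - u y| <= eps].
  apply: cK => y /= Ky.
  have e20 : 0 < eps / 2 by rewrite divr_gt0.
  have /continuous_normP/(_ _ e20)[d d0 Hd] := cu y.
  have d20 : 0 < d / 2 by rewrite divr_gt0.
  have N1 : \forall y' \near y, `|y' - y| < d / 2.
    by apply/near_normP; exists (d / 2).
  have N2 : \forall z \near (0 : V), `|z| < d / 2.
    by apply/near_normP; exists (d / 2) => // z; rewrite subr0.
  exists ([set y' | `|y' - y| < d / 2], [set z : V | `|z| < d / 2]).
    by split; [exact: N1|exact: N2].
  move=> [y' z] /= [A zd] _.
  have B : `|z + y' - y| < d.
    rewrite -addrA (le_lt_trans (ler_normD _ _))//.
    by rewrite [ltRHS](splitr d) ltrD.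
  have A' : `|y' - y| < d by apply: lt_trans A _; rewrite ltr_pdivrMr// ltr_pMr// ltr1n.
  rewrite /= (le_trans (ler_distD (u y) _ _))// [leRHS](splitr eps).
  by rewrite lerD ?Hd// distrC Hd.
by exists d => // z zd y Ky; apply: (Hd z) => //=; rewrite subr0.
Qed.

Section Steklov.
Context {R : realType} {V : normedModType R}.
Notation mu := (@lebesgue_measure R).
Implicit Types (u w : V -> R) (x v : V) (h : R).

Definition steklov h v u x : R :=
  h^-1 * \int[mu]_(s in `[0, h]) u (s *: v + x).

Let segment_continuous u x v :
  continuous u -> continuous (fun s : R => u (s *: v + x)).
Proof.
move=> cu s; apply: (@continuous_comp _ _ _ (fun s : R => s *: v + x) u).
  by apply: cvgD; [apply: cvgZr_tmp; exact: cvg_id|exact: cvg_cst].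
exact: cu.
Qed.

Let segment_integrable (g : R -> R) (a b : R) : continuous g ->
  mu.-integrable `[a, b] (EFin \o g).
Proof.
move=> cg; apply: continuous_compact_integrable; first exact: segment_compact.
exact: continuous_subspaceT.
Qed.

Lemma steklovD h v u w x : continuous u -> continuous w ->
  steklov h v (fun y => u y + w y) x = steklov h v u x + steklov h v w x.
Proof.
move=> cu cw; rewrite /steklov -mulrDr RintegralD//.
  exact/segment_integrable/segment_continuous.
exact/segment_integrable/segment_continuous.
Qed.

Lemma steklovZ h v (a : R) u x : continuous u ->
  steklov h v (fun y => a * u y) x = a * steklov h v u x.
Proof.
move=> cu; rewrite /steklov mulrCA RintegralZl//.
exact/segment_integrable/segment_continuous.
Qed.

Lemma steklov_cst h v (a : R) x : 0 < h -> steklov h v (cst a) x = a.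
Proof.
move=> h0; rewrite /steklov Rintegral_cst//= lebesgue_measure_itv/= lte_fin h0.
by rewrite -EFinB subr0/= mulrCA mulVf ?mulr1// gt_eqF.
Qed.

Lemma steklovB h v u w x : continuous u -> continuous w ->
  steklov h v (fun y => u y - w y) x = steklov h v u x - steklov h v w x.
Proof.
move=> cu cw; rewrite /steklov -mulrBr RintegralB//.
  exact/segment_integrable/segment_continuous.
exact/segment_integrable/segment_continuous.
Qed.

Lemma steklov_norm_le h v u x (M : R) : 0 < h -> continuous u ->
  (forall s : R, 0 <= s <= h -> `|u (s *: v + x)| <= M) ->
  `|steklov h v u x| <= M.
Proof.
move=> h0 cu uM; rewrite /steklov normrM normfV (gtr0_norm h0) ler_pdivrMl//.
have iu := @segment_integrable _ 0 h (@segment_continuous u x v cu).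
apply: le_trans (le_normr_Rintegral _ iu) _ => //.
apply: (@le_trans _ _ (\int[mu]_(s in `[0, h]) M)).
  apply: le_Rintegral => //.
  - apply: segment_integrable => s.
    by apply: cvg_norm; exact: segment_continuous.
  - by apply: segment_integrable => s; exact: cvg_cst.
rewrite Rintegral_cst//= lebesgue_measure_itv/= lte_fin h0.
by rewrite -EFinB subr0/= mulrC.
Qed.

Lemma segment_uniform_continuity h v u x : continuous u ->
  forall eps : R, 0 < eps -> exists2 d : R, 0 < d & forall z, `|z| < d ->
    forall s : R, 0 <= s <= h -> `|u (s *: v + (z + x)) - u (s *: v + x)| <= eps.
Proof.
move=> cu eps eps0.
have cK : compact ((fun s : R => s *: v + x) @` `[0, h]).
  apply: continuous_compact; last exact: segment_compact.
  apply: continuous_subspaceT => s.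
  by apply: cvgD; [apply: cvgZr_tmp; exact: cvg_id|exact: cvg_cst].
have [d d0 Hd] := compact_uniform_continuity cK cu eps0.
exists d => // z zd s s0h; rewrite addrCA; apply: Hd => //.
by exists s => //=; rewrite in_itv.
Qed.

Lemma steklov_continuous h v u : 0 < h -> continuous u -> continuous (steklov h v u).
Proof.
move=> h0 cu x; apply/continuous_normP => eps eps0.
have [d d0 Hd] := segment_uniform_continuity h v x cu eps0.
exists d => // y yx; rewrite -(subrK x y).
have -> : steklov h v u (y - x + x) = steklov h v (fun z => u (y - x + z)) x.
  by congr (_ * _); apply: eq_Rintegral => s _; rewrite addrCA.
have cu' : continuous (fun z => u (y - x + z)).
  move=> z; apply: (@continuous_comp _ _ _ (fun z => y - x + z) u).
    by apply: cvgD; [exact: cvg_cst|exact: cvg_id].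
  exact: cu.
rewrite -steklovB//; apply: steklov_norm_le => //.
  by move=> z; apply: cvgB; [exact: cu'|exact: cu].
by move=> s s0h; rewrite addrCA Hd.
Qed.

(** The difference quotient of the average is the average of the difference quotients, which by the
    mean value theorem are values of [w] at nearby points; uniform continuity along the segment does
    the rest. *)
Lemma is_derive_steklov h v v' u w x (r : R) : 0 < h -> 0 < r ->
  continuous u -> continuous w ->
  (forall s z, 0 <= s <= h -> `|z| < r ->
     is_derive (s *: v + (z + x)) v' u (w (s *: v + (z + x)))) ->
  is_derive x v' (steklov h v u) (steklov h v w x).
Proof.
move=> h0 r0 cu cw D; apply/is_deriveP => eps eps0.
have [d d0 Hd] := segment_uniform_continuity h v x cw eps0.
have k0 : 0 < `|v'| + 1 by rewrite ltr_wpDl.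
exists (Num.min d r / (`|v'| + 1)); first by rewrite divr_gt0// lt_min d0.
move=> t t0; rewrite ltr_pdivlMr// => tdr.
have tv : `|t *: v'| < Num.min d r.
  by rewrite normrZ (le_lt_trans _ tdr)// ler_wpM2l// lerDl.
have cut : continuous (fun z => u (t *: v' + z)).
  move=> z; apply: (@continuous_comp _ _ _ (fun z => t *: v' + z) u); last exact: cu.
  by apply: cvgD; [exact: cvg_cst|exact: cvg_id].
have cdu : continuous (fun z => u (t *: v' + z) - u z).
  by move=> z; apply: cvgB; [exact: cut|exact: cu].
have cq : continuous (fun z => t^-1 * (u (t *: v' + z) - u z)).
  by move=> z; apply: cvgM; [exact: cvg_cst|exact: cdu].
have -> : t^-1 *: (steklov h v u (t *: v' + x) - steklov h v u x) - steklov h v w x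
    = steklov h v (fun z => t^-1 * (u (t *: v' + z) - u z) - w z) x.
  rewrite steklovB// steklovZ// steklovB//; congr (t^-1 * (h^-1 * _ - _) - _).
  by apply: eq_Rintegral => s _; rewrite addrCA.
apply: steklov_norm_le => //.
  by move=> z; apply: cvgB; [exact: cq|exact: cw].
move=> s s0h.
have step (th : R) : 0 <= th <= 1 -> `|(th * t) *: v'| < Num.min d r.
  move=> /andP[th0 th1]; apply: le_lt_trans tv.
  by rewrite -scalerA [leLHS]normrZ (ger0_norm th0) ler_piMl.
have [|th /andP[th0 th1] E] := @mvt_line R V u w (s *: v + x) v' t.
  move=> th /step; rewrite lt_min => /andP[_ thr].
  by rewrite addrCA; exact: D.
rewrite E mulrA mulVf// mul1r addrCA.
apply: Hd => //.
have : 0 <= th <= 1 by rewrite !ltW.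
by move=> /step; rewrite lt_min => /andP[].
Qed.

(** The fundamental theorem of calculus: in the direction of the average, continuity of [u] is
    turned into differentiability. *)
Lemma is_derive_steklov_dir h v u x : 0 < h -> continuous u ->
  is_derive x v (steklov h v u) (h^-1 * (u (h *: v + x) - u x)).
Proof.
move=> h0 cu; pose g (t : R) := u (t *: v + x).
have cg : continuous g by exact: segment_continuous.
(* The lower limit [-1] makes [0] an interior point, so that [G] is differentiable there on both
   sides. *)
pose G (t : R) := \int[mu]_(s in `[-1, t]) g s.
have dG (t : R) : -1 < t -> is_derive t (1 : R) G (g t).
  move=> t1; have t1' : t < t + 1 by rewrite ltrDl.
  have [D E] := continuous_FTC1_closed t1' (@segment_integrable g (-1) (t + 1) cg) t1 (cg t).
  by split; [exact: D|rewrite -derive1E; exact: E].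
have cG (t : R) : -1 < t -> {for t, continuous G}.
  move=> /dG[D _]; apply/differentiable_continuous.
  exact/derivable1_diffP.
have SG (t : R) : `|t| < 1 -> steklov h v u (t *: v + x) = h^-1 * (G (h + t) - G t).
  rewrite ltr_norml => /andP[t1 _]; congr (_ * _).
  transitivity (\int[mu]_(s in `[0, h]) g (s + t)).
    by apply: eq_Rintegral => s _; rewrite /g scalerDl addrA.
  have st (s : R) : 0 <= s -> -1 < s + t by move=> s0; rewrite ltr_wpDl.
  have dGt (s : R) : 0 <= s -> is_derive s (1 : R) (fun s => G (s + t)) (g (s + t)).
    move=> /st/dG/is_deriveP H; apply/is_deriveP => eps /H[d d0 Hd].
    by exists d => // k k0 kd; have := Hd k k0 kd; rewrite addrA.
  have cGt (s : R) : 0 <= s -> {for s, continuous (fun s => G (s + t))}.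
    by move=> /dGt[D _]; apply/differentiable_continuous/derivable1_diffP.
  have := @continuous_FTC2 R (fun s => g (s + t)) (fun s => G (s + t)) 0 h h0.
  rewrite add0r /Rintegral => E.
  rewrite E//.
  - apply: continuous_subspaceT => s.
    apply: (@continuous_comp _ _ _ (fun s => s + t) g); last exact: cg.
    by apply: cvgD; [exact: cvg_id|exact: cvg_cst].
  - split.
    + by move=> s; rewrite in_itv /= => /andP[s0 _]; have [] := dGt s (ltW s0).
    + by apply: cvg_at_right_filter; exact: cGt.
    + by apply: cvg_at_left_filter; apply: cGt; exact: ltW.
  - move=> s; rewrite in_itv /= => /andP[s0 _]; rewrite derive1E.
    by have [] := dGt s (ltW s0).
have D0 : is_derive (0 : R) (1 : R) (fun t => h^-1 * (G (h + t) - G t)) (h^-1 * (g h - g 0)).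
  have D1 : is_derive (0 : R) (1 : R) (fun t => G (h + t)) (g h).
    have /is_deriveP H := dG h (lt_trans (ltrN10 R) h0).
    apply/is_deriveP => eps /H[d d0 Hd].
    exists d => // k k0 kd; have := Hd k k0 kd.
    by rewrite !addr0 [h + _]addrC.
  exact: (is_deriveZ h^-1 (is_deriveB D1 (dG 0 (ltrN10 R)))).
rewrite (_ : u x = g 0); last by rewrite /g scale0r add0r.
suff /is_derive_line : is_derive (0 : R) (1 : R)
    (fun t => steklov h v u (t *: v + x)) (h^-1 * (g h - g 0)).
  by rewrite scale0r add0r.
apply: (near_eq_is_derive _ D0).
apply/near_normP; exists 1 => // t; rewrite subr0 => t1; rewrite -SG//.
Qed.

End Steklov.

(** * Reduction of vector-valued functions to their coordinates *)

Section RowVectors.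
Context {R : realType} {N : nat}.

Lemma row_coord_norm_le (M : 'rV[R]_N) j : `|M 0 j| <= `|M|.
Proof.
by rewrite [leRHS]/Num.Def.normr /= mx_normrE; exact: (le_bigmax _ _ (0, j)).
Qed.

Lemma row_norm_le (M : 'rV[R]_N) (r : R) : 0 <= r ->
  (forall j, `|M 0 j| <= r) -> `|M| <= r.
Proof.
move=> r0 H; rewrite [leLHS]/Num.Def.normr /= mx_normrE bigmax_le//= => -[i j] _.
by rewrite ord1.
Qed.

Context {V : normedModType R}.
Implicit Types (F : V -> 'rV[R]_N) (x v : V).

Lemma continuous_rowP F x : {for x, continuous F} <->
  forall j, {for x, continuous (fun y => F y 0 j)}.
Proof.
split=> [/continuous_normP H j|H].
  apply/continuous_normP => eps /H[d d0 Hd]; exists d => // y /Hd; apply: le_trans.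
  by have := row_coord_norm_le (F y - F x) j; rewrite !mxE.
apply/continuous_normP => eps eps0; apply/near_normP.
suff : \forall y \near x, forall j, `|F y 0 j - F x 0 j| <= eps.
  apply: filterS => y Hy; apply: row_norm_le; first exact: ltW.
  by move=> j; rewrite !mxE.
apply: filter_forall => j; apply/near_normP.
by have /continuous_normP/(_ _ eps0) := H j.
Qed.

Lemma is_derive_rowP F x v (l : 'rV[R]_N) : is_derive x v F l <->
  forall j, is_derive x v (fun y => F y 0 j) (l 0 j).
Proof.
split=> [/is_deriveP H j|H].
  apply/is_deriveP => eps /H[d d0 Hd]; exists d => // t t0 /(Hd _ t0).
  by apply: le_trans; have := row_coord_norm_le
    (t^-1 *: (F (t *: v + x) - F x) - l) j; rewrite !mxE.
have D : derivable F x v.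
  by apply/derivable_mxP => i j; rewrite ord1; case: (H j).
split=> //; rewrite derive_mx//; apply/rowP => j; rewrite mxE.
by case: (H j).
Qed.

End RowVectors.

Section VectorSteklov.
Context {R : realType} {V : normedModType R} {N : nat}.
Implicit Types (F G : V -> 'rV[R]_N) (x v : V) (h : R).

Definition row_steklov h v F x : 'rV[R]_N :=
  \row_j steklov h v (fun y => F y 0 j) x.

Let coordc F j : continuous F -> continuous (fun y => F y 0 j).
Proof. by move=> cF x; exact: (continuous_rowP F x).1 (cF x) j. Qed.

Let row_steklovE h v F j :
  (fun y => row_steklov h v F y 0 j) = steklov h v (fun y => F y 0 j).
Proof. by apply/funext => y; rewrite mxE. Qed.

Lemma row_steklov_continuous h v F : 0 < h -> continuous F ->
  continuous (row_steklov h v F).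
Proof.
move=> h0 cF x; apply/continuous_rowP => j.
by rewrite row_steklovE; exact/steklov_continuous/coordc.
Qed.

Lemma is_derive_row_steklov h v v' F G x (r : R) : 0 < h -> 0 < r ->
  continuous F -> continuous G ->
  (forall s z, 0 <= s <= h -> `|z| < r ->
     is_derive (s *: v + (z + x)) v' F (G (s *: v + (z + x)))) ->
  is_derive x v' (row_steklov h v F) (row_steklov h v G x).
Proof.
move=> h0 r0 cF cG D; apply/is_derive_rowP => j.
rewrite row_steklovE mxE.
apply: (is_derive_steklov h0 r0 (@coordc F j cF) (@coordc G j cG)) => s z sh zr.
exact: (is_derive_rowP _ _ _ _).1 (D s z sh zr) j.
Qed.

Lemma is_derive_row_steklov_dir h v F x : 0 < h -> continuous F ->
  is_derive x v (row_steklov h v F) (h^-1 *: (F (h *: v + x) - F x)).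
Proof.
move=> h0 cF; apply/is_derive_rowP => j.
rewrite row_steklovE !mxE.
exact/is_derive_steklov_dir/coordc.
Qed.

Lemma row_steklovB h v F G : continuous F -> continuous G ->
  row_steklov h v (fun y => F y - G y) = fun x => row_steklov h v F x - row_steklov h v G x.
Proof.
move=> cF cG; apply/funext => x; apply/rowP => j; rewrite !mxE.
rewrite -steklovB; [|exact: coordc|exact: coordc].
by congr (_ * _); apply: eq_Rintegral => s _; rewrite !mxE.
Qed.

Lemma row_steklov_cst h v (a : 'rV[R]_N) x : 0 < h ->
  row_steklov h v (fun=> a) x = a.
Proof. by move=> h0; apply/rowP => j; rewrite mxE; exact: steklov_cst. Qed.

Lemma row_steklov_norm_le h v F x (M : R) : 0 < h -> continuous F ->
  (forall s : R, 0 <= s <= h -> `|F (s *: v + x)| <= M) ->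
  `|row_steklov h v F x| <= M.
Proof.
move=> h0 cF FM.
have M0 : 0 <= M by apply: le_trans (FM 0 _); rewrite // lexx ltW.
apply: row_norm_le => // j; rewrite mxE; apply: steklov_norm_le => //.
  exact: coordc.
by move=> s /FM; apply: le_trans; exact: row_coord_norm_le.
Qed.

End VectorSteklov.

Lemma row_steklov_linear (R : realType) (V : normedModType R) (N N' : nat)
    (J : finType) (M : J -> 'M[R]_(N, N')) (h : R) (v : V)
    (F : J -> V -> 'rV[R]_N) x : (forall j, continuous (F j)) ->
  row_steklov h v (fun y => \sum_j F j y *m M j) x =
  \sum_j row_steklov h v (F j) x *m M j.
Proof.
move=> cF; apply/rowP => k.
have cFj j i : continuous (fun y => F j y 0 i).
  by move=> y; exact: (continuous_rowP (F j) y).1 (cF j y) i.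
(* Obtained from homogeneity, since [steklov_cst] asks for [0 < h]. *)
have st0 y : steklov h v (fun=> 0) y = 0 :> R.
  rewrite -[RHS](mul0r (steklov h v (fun=> 0) y)) -steklovZ; last by move=> ?; exact: cvg_cst.
  by congr (_ * _); apply: eq_Rintegral => s _; rewrite mul0r.
have sumE (T : Type) (s : seq T) (f : T -> V -> R) y : (forall t, continuous (f t)) ->
    continuous (fun y => \sum_(t <- s) f t y) /\
    steklov h v (fun y => \sum_(t <- s) f t y) y = \sum_(t <- s) steklov h v (f t) y.
  move=> cf; elim: s => [|t s [cs IHs]].
    rewrite big_nil; split.
      by under eq_fun do rewrite big_nil; move=> ?; exact: cvg_cst.
    by under [fun y => _]eq_fun do rewrite big_nil; exact: st0.
  rewrite big_cons -IHs -steklovD//; under eq_fun do rewrite big_cons.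
  by split=> // z; apply: cvgD; [exact: cf|exact: cs].
rewrite !mxE summxE.
rewrite (_ : (fun y => _) = fun y => \sum_j \sum_i M j i k * F j y 0 i); last first.
  apply/funext => y; rewrite summxE; apply: eq_bigr => j _; rewrite mxE.
  by apply: eq_bigr => i _; rewrite mulrC.
rewrite (sumE _ _ _ x _).2; last first.
  by move=> j; apply: (sumE _ _ _ x _).1 => i y; apply: cvgM; [exact: cvg_cst|exact: cFj].
apply: eq_bigr => j _; rewrite (sumE _ _ _ x _).2; last first.
  by move=> i y; apply: cvgM; [exact: cvg_cst|exact: cFj].
by rewrite mxE; apply: eq_bigr => i _; rewrite mxE steklovZ 1?mulrC.
Qed.

(** * Averages in several directions *)

Section IteratedSteklov.
Context {R : realType} {V : normedModType R} {I : finType} {N : nat}.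
Variables (e : I -> V) (c : I -> V -> R).
Hypothesis ec : coord_system e c.
Variables (h : R).
Hypothesis h0 : 0 < h.
Implicit Types (F G H K : V -> 'rV[R]_N) (x y z : V) (l : seq I).

Fixpoint iter_steklov l F : V -> 'rV[R]_N :=
  if l is i :: l' then row_steklov h (e i) (iter_steklov l' F) else F.

Lemma iter_steklov_continuous l F : continuous F -> continuous (iter_steklov l F).
Proof. by move=> cF; elim: l => //= i l IH; exact: row_steklov_continuous. Qed.

Let step_dist i y x (s : R) : 0 <= s <= h -> `|s *: e i + y - x| <= `|y - x| + h.
Proof.
move=> /andP[s0 sh]; rewrite -addrA (le_trans (ler_normD _ _))// [leRHS]addrC.
rewrite lerD2r normrZ ger0_norm// -[leRHS]mulr1 ler_pM//.
exact: norm_dir_le1 ec _.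
Qed.

Let sizeS i l (r : R) : r - (size (i :: l))%:R * h + h = r - (size l)%:R * h.
Proof. by rewrite /= -natr1; ring. Qed.

Let steklov_step i j F G x y (r : R) : continuous F -> continuous G ->
  (forall y, `|y - x| < r + h -> is_derive y (e j) F (G y)) ->
  `|y - x| < r -> is_derive y (e j) (row_steklov h (e i) F) (row_steklov h (e i) G y).
Proof.
move=> cF cG D yx.
apply: (@is_derive_row_steklov _ _ _ _ _ _ _ _ _ (r - `|y - x|)) => //.
  by rewrite subr_gt0.
move=> s z sh zr; apply: D; apply: (le_lt_trans (step_dist _ _ _ sh)).
rewrite ltrD2r -addrA (le_lt_trans (ler_normD _ _))//.
by rewrite -ltrBrDr.
Qed.

(** Each average looks ahead by at most [h], so every direction in [l] costs [h] in the radius. *)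
Lemma is_derive_iter_steklov l j F G x (r : R) :
  continuous F -> continuous G ->
  (forall y, `|y - x| < r -> is_derive y (e j) F (G y)) ->
  forall y, `|y - x| < r - (size l)%:R * h ->
    is_derive y (e j) (iter_steklov l F) (iter_steklov l G y).
Proof.
move=> cF cG D; elim: l => [|i l IH] y; first by rewrite mul0r subr0; exact: D.
apply: steklov_step; [exact: iter_steklov_continuous..|].
by move=> z; rewrite sizeS; exact: IH.
Qed.

(** The average along [e j] makes even the merely continuous derivative [G] differentiable in [e j].
    The last clause says that the mixed second derivative taken in the other order is the same
    function [K]; it is the source of the symmetry used for the Laplacian. *)
Lemma iter_steklov_derive l i j F G x (r : R) : j \in l ->
  continuous F -> continuous G ->
  (forall y, `|y - x| < r -> is_derive y (e i) F (G y)) ->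
  exists H K, [/\ continuous H /\ continuous K,
    forall y, is_derive y (e j) (iter_steklov l F) (H y),
    forall y, is_derive y (e j) (iter_steklov l G) (K y) &
    forall y, `|y - x| < r - (size l)%:R * h -> is_derive y (e i) H (K y)].
Proof.
move=> jl cF cG D; elim: l jl => [//|j' l IH]; rewrite in_cons.
(* An outermost average along [e j] has an explicit difference quotient as derivative; an average in
   another direction is carried along. *)
have [<-{j'} _|_ /= /IH[H [K [[cH cK] HF KG KH]]]] := eqVneq j j'.
  have cl := @iter_steklov_continuous l.
  have cd (A : V -> 'rV[R]_N) : continuous A ->
      continuous (fun y => h^-1 *: (A (h *: e j + y) - A y)).
    move=> cA y; apply: cvgZl_tmp; apply: cvgB; last exact: cA.
    apply: (@continuous_comp _ _ _ (fun y => h *: e j + y) A); last exact: cA.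
    by apply: cvgD; [exact: cvg_cst|exact: cvg_id].
  exists (fun y => h^-1 *: (iter_steklov l F (h *: e j + y) - iter_steklov l F y)).
  exists (fun y => h^-1 *: (iter_steklov l G (h *: e j + y) - iter_steklov l G y)).
  split.
  - by split; apply: cd; exact: cl.
  - by move=> y; apply: is_derive_row_steklov_dir => //; exact: cl.
  - by move=> y; apply: is_derive_row_steklov_dir => //; exact: cl.
  - move=> y yx.
    have yx' : `|y - x| + h < r - (size l)%:R * h by rewrite -(sizeS j) ltrD2r.
    have hh : 0 <= h <= h by rewrite lexx ltW.
    have Dl z : `|z - x| < r - (size l)%:R * h ->
        is_derive z (e i) (iter_steklov l F) (iter_steklov l G z).
      exact: is_derive_iter_steklov.
    have D1 := Dl _ (le_lt_trans (step_dist j y x hh) yx').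
    have D2 : is_derive y (e i) (iter_steklov l F) (iter_steklov l G y).
      by apply: Dl; apply: lt_trans yx'; rewrite ltrDl.
    apply: is_deriveZ; apply: is_deriveB => //.
    apply/is_deriveP => eps; have /is_deriveP Dp := D1; move=> /Dp[d d0 Hd].
    by exists d => // t t0 td; have := Hd t t0 td; rewrite addrCA.
exists (row_steklov h (e j') H), (row_steklov h (e j') K); split.
- by split; exact: row_steklov_continuous.
- move=> y; apply: (@steklov_step _ _ _ _ y _ 1) => //.
    exact: iter_steklov_continuous.
  by rewrite subrr normr0.
- move=> y; apply: (@steklov_step _ _ _ _ y _ 1) => //.
    exact: iter_steklov_continuous.
  by rewrite subrr normr0.
- by move=> y; apply: steklov_step => // z; rewrite (sizeS j' l); exact: KH.
Qed.

Lemma iter_steklov_dist l F y (a : 'rV[R]_N) (eps : R) : continuous F ->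
  (forall z, `|z| <= (size l)%:R * h -> `|F (z + y) - a| <= eps) ->
  `|iter_steklov l F y - a| <= eps.
Proof.
move=> cF; elim: l y => [|i l IH] y Fa /=.
  by have := Fa 0; rewrite normr0 mul0r add0r; apply.
have cS : continuous (iter_steklov l F) by exact: iter_steklov_continuous.
have ca : continuous (fun _ : V => a) by move=> ?; exact: cvg_cst.
rewrite -(row_steklov_cst (e i) a y h0).
have := row_steklovB h (e i) cS ca; move/(congr1 (fun f => f y)) => /= <-.
apply: row_steklov_norm_le => //.
  by move=> z; apply: cvgB; [exact: cS|exact: ca].
move=> s sh; apply: IH => z zl; rewrite addrA; apply: Fa.
rewrite (le_trans (ler_normD _ _))// -natr1 mulrDl mul1r lerD//.
have := step_dist i 0 0 sh.
by rewrite addr0 subr0 subrr normr0 add0r.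
Qed.

End IteratedSteklov.

Lemma is_derive_mulmxr (R : realType) (V : normedModType R) (N N' : nat)
    (M : 'M[R]_(N, N')) (F : V -> 'rV[R]_N) x v (l : 'rV[R]_N) :
  is_derive x v F l -> is_derive x v (fun y => F y *m M) (l *m M).
Proof.
move=> /is_derive_rowP D; apply/is_derive_rowP => k; rewrite mxE.
rewrite (_ : (fun y => _) = fun y => \sum_i M i k *: F y 0 i); last first.
  by apply/funext => y; rewrite mxE; apply: eq_bigr => i _; rewrite mulrC.
under eq_bigr do rewrite mulrC.
by apply: is_derive_bigsum => i; exact: is_deriveZ.
Qed.

Lemma iter_steklov_linear (R : realType) (V : normedModType R) (I : finType)
    (N N' : nat) (e : I -> V) (J : finType) (M : J -> 'M[R]_(N, N')) (h : R) l
    (F : J -> V -> 'rV[R]_N) x : 0 < h -> (forall j, continuous (F j)) ->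
  iter_steklov e h l (fun y => \sum_j F j y *m M j) x =
  \sum_j iter_steklov e h l (F j) x *m M j.
Proof.
move=> h0 cF; elim: l x => //= i l IH x.
rewrite -row_steklov_linear; last by move=> j; exact: iter_steklov_continuous.
by congr (row_steklov _ _ _ _); apply/funext => y; exact: IH.
Qed.

(** * First-order systems that factorize the Laplacian *)

Section DiracSystem.
Context {R : realType} {V : normedModType R} {I : finType}.
Variables (e : I -> V) (c : I -> V -> R).
Hypothesis ec : coord_system e c.

Let clamp (x : V) (r : R) (z : V) := x + (r / Num.max r `|z - x|) *: (z - x).

Let clamp_continuous x r : 0 < r -> continuous (clamp x r).
Proof.
move=> r0 z; apply: cvgD; first exact: cvg_cst.
have zx : {for z, continuous (fun z => z - x)}.
  by apply: cvgB; [exact: cvg_id|exact: cvg_cst].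
apply: cvgZ => //; apply: cvgM; first exact: cvg_cst.
apply: cvgV; first by rewrite gt_eqF// lt_max r0.
have nz : {for z, continuous (fun z => `|z - x|)} by exact: cvg_norm.
exact: (continuous_max (@cst_continuous _ _ r z) nz).
Qed.

Let clamp_dist x r z : 0 < r -> `|clamp x r z - x| <= r.
Proof.
move=> r0; rewrite /clamp addrC addKr normrZ.
have m0 : 0 < Num.max r `|z - x| by rewrite lt_max r0.
rewrite gtr0_norm ?divr_gt0// mulrAC ler_pdivrMr// ler_pM2l//.
by rewrite le_max lexx orbT.
Qed.

Let clamp_id x r z : 0 < r -> `|z - x| <= r -> clamp x r z = z.
Proof.
move=> r0 zx; rewrite /clamp (max_idPl zx) divff ?gt_eqF// scale1r.
by rewrite addrC subrK.
Qed.

(* The Steklov averages of [F] in all the directions still satisfy the constant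
   coefficient system, and are twice differentiable, so that the factorization
   of the Laplacian applies to them. [F] is first made globally continuous by
   composition with the retraction [clamp]. *)
Theorem dirac_system_harmonic_approx (N N' : nat) (M : I -> 'M[R]_(N, N'))
    (P : I -> 'M[R]_(N', N)) (F : V -> 'rV[R]_N) (G : I -> V -> 'rV[R]_N) (x : V) (r : R) A :
    0 < r ->
    (forall i j, M i *m P j + M j *m P i = (2 * (i == j)%:R)%:M) ->
    (forall y, `|y - x| < r -> {for y, continuous F}) ->
    (forall i y, `|y - x| < r -> {for y, continuous (G i)}) ->
    (forall i y, `|y - x| < r -> is_derive y (e i) F (G i y)) ->
    (forall y, `|y - x| < r -> \sum_i G i y *m M i = 0) ->
  harmonic_approx e x (r / 4) (fun y => F y 0 A).
Proof.
move=> r0 MP cF cG DF sys eps eps0.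
have r20 : 0 < r / 2 by rewrite divr_gt0.
have r2r : r / 2 < r by rewrite ltr_pdivrMr// ltr_pMr// ltr1n.
have r40 : 0 < r / 4 by rewrite divr_gt0.
have in_r z : `|clamp x (r / 2) z - x| < r.
  exact: le_lt_trans (clamp_dist _ _ r20) r2r.
have clampc (T : V -> 'rV[R]_N) :
    (forall y, `|y - x| < r -> {for y, continuous T}) -> continuous (T \o clamp x (r / 2)).
  move=> cT z; apply: continuous_comp; first exact: clamp_continuous.
  exact/cT/in_r.
pose F' := F \o clamp x (r / 2); pose G' i := G i \o clamp x (r / 2).
have cF' : continuous F' by exact: clampc.
have cG' i : continuous (G' i) by apply: clampc; exact: cG.
have DF' i y : `|y - x| < r / 2 -> is_derive y (e i) F' (G' i y).
  move=> yx; have -> : G' i y = G i y by rewrite /G' /= clamp_id// ltW.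
  apply: (near_eq_is_derive _ (DF i y (lt_trans yx r2r))).
  apply/near_normP; exists (r / 2 - `|y - x|); first by rewrite subr_gt0.
  move=> z zy; rewrite /F' /= clamp_id// (le_trans (ler_distD y _ _))//.
  by rewrite -lerBrDr ltW.
have [d d0 Fd] := compact_uniform_continuity (@coord_compact _ _ _ _ _ ec x (r / 4)) cF' eps0.
pose l := enum I; pose n : R := (size l)%:R.
have n0 : 0 <= n by rewrite ler0n.
(* Dividing by [n + 1] keeps the total displacement [n * h] strictly below the modulus of continuity
   [d] and the margin [r / 4]. *)
pose h := Num.min d (r / 4) / (n + 1).
have m0 : 0 < Num.min d (r / 4) by rewrite lt_min d0.
have h0 : 0 < h by rewrite divr_gt0// ltr_wpDl.
have nh : n * h < Num.min d (r / 4).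
  rewrite /h mulrA ltr_pdivrMr ?ltr_wpDl// mulrC ltr_pM2l//.
  by rewrite ltrDl.
have [nhd nhr] : n * h < d /\ n * h < r / 4 by move: nh; rewrite lt_min => /andP[].
pose S T := @iter_steklov R V I N e h l T.
have inball y : `|y - x| < r / 4 -> `|y - x| < r / 2 - n * h by lra.
have cS T : continuous T -> continuous (S T) by exact: iter_steklov_continuous.
have DS i y : `|y - x| < r / 4 -> is_derive y (e i) (S F') (S (G' i) y).
  by move=> /inball; apply: (is_derive_iter_steklov ec h0) => //.
have nearball y : `|y - x| < r / 4 -> \forall z \near y, `|z - x| < r / 4.
  move=> yx; apply/near_normP; exists (r / 4 - `|y - x|); first by rewrite subr_gt0.
  by move=> z zy; rewrite (le_lt_trans (ler_distD y _ _))// -ltrBrDr.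
pose K i j : V -> 'rV[R]_N := 'D_(e j) (S (G' i)).
(* [H0] coincides with [S (G' j)] near [y] by uniqueness of derivatives, so its derivative [K0]
   along [e i] is both [K i j] and [K j i]. *)
have KP i j : (forall y, is_derive y (e j) (S (G' i)) (K i j y)) /\
    forall y, `|y - x| < r / 4 -> K i j y = K j i y.
  have jl : j \in l by rewrite mem_enum.
  have [H0 [K0 [_ HF KG KH]]] := iter_steklov_derive ec h0 jl cF' (cG' i) (DF' i).
  have KK0 y : K i j y = K0 y by rewrite /K; case: (KG y).
  split=> [y|y yx]; first by rewrite KK0; exact: KG.
  have HS z : `|z - x| < r / 4 -> H0 z = S (G' j) z.
    by move=> zx; apply: is_derive_unique (HF z) (DS j z zx).
  have : is_derive y (e i) (S (G' j)) (K0 y).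
    apply: (near_eq_is_derive _ (KH y (inball _ yx))).
    by apply: filterS (nearball _ yx) => z /HS.
  by rewrite KK0 => -[_ <-].
(* The relation between the [G i] is algebraic, so after composition with [clamp] it holds
   everywhere, whereas [DF'] holds only in a ball. *)
have sysS y : \sum_i S (G' i) y *m M i = 0.
  rewrite -(iter_steklov_linear e M l y h0 cG').
  rewrite (_ : (fun y => _) = fun=> 0); last first.
    by apply/funext => z; exact/sys/in_r.
  elim: (l) y => //= i l' IH y; rewrite (_ : iter_steklov _ _ _ _ = fun=> 0).
    exact: row_steklov_cst.
  by apply/funext => z; exact: IH.
have sysK j y : \sum_i K i j y *m M i = 0.
  have D : is_derive y (e j) (fun y => \sum_i S (G' i) y *m M i) (\sum_i K i j y *m M i).
    by apply: is_derive_bigsum => i; apply: is_derive_mulmxr; exact: (KP i j).1.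
  case: D => _ <-; rewrite (_ : (fun y => _) = cst 0) ?derive_cst//.
  by apply/funext => z; exact: sysS.
(* The system is differentiated along each [e j], multiplied by [P j] and summed; symmetrizing in
   [i] and [j] leaves, by [MP], twice the diagonal. *)
have lapK y : `|y - x| < r / 4 -> \sum_i K i i y = 0.
  move=> yx.
  have E1 : \sum_j \sum_i K i j y *m (M i *m P j) = 0.
    rewrite big1// => j _; under eq_bigr do rewrite mulmxA.
    by rewrite -mulmx_suml sysK mul0mx.
  have E2 : \sum_j \sum_i K i j y *m (M j *m P i) = 0.
    rewrite exchange_big -[RHS]E1 /=; apply: eq_bigr => j _; apply: eq_bigr => i _.
    by rewrite (KP j i).2.
  have E3 : \sum_j \sum_i K i j y *m (2 * (i == j)%:R)%:M = 0 :> 'rV[R]_N.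
    rewrite -[RHS]addr0 -[X in _ = X + _]E1 -[X in _ = _ + X]E2 -big_split /=.
    apply: eq_bigr => j _; rewrite -big_split /=; apply: eq_bigr => i _.
    by rewrite -mulmxDr MP.
  have : 2 *: \sum_i K i i y = 0.
    rewrite -[RHS]E3 scaler_sumr; apply: eq_bigr => j _.
    rewrite (bigD1 j)//= big1 ?addr0; last first.
      by move=> i /negbTE ->; rewrite mulr0 mul_mx_scalar scale0r.
    by rewrite eqxx mulr1 mul_mx_scalar.
  by move/eqP; rewrite scaler_eq0 pnatr_eq0 => /eqP.
exists (fun y => S F' y 0 A) => y yx; last first.
  have Fy : F y = F' y by rewrite /F' /= clamp_id//; lra.
  rewrite Fy; have := row_coord_norm_le (S F' y - F' y) A.
  rewrite mxE [in X in X <= _ -> _]mxE; move/le_trans; apply.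
  apply: (iter_steklov_dist ec) => // z zn; apply: Fd; last exact: ltW.
  exact: le_lt_trans zn nhd.
have D1 i z : `|z - x| < r / 4 -> is_derive z (e i) (fun y => S F' y 0 A) (S (G' i) z 0 A).
  by move=> /(DS i)/is_derive_rowP/(_ A).
have D2 i : is_derive y (e i) ('D_(e i) (fun y => S F' y 0 A)) (K i i y 0 A).
  have /is_derive_rowP/(_ A) := (KP i i).1 y.
  apply: near_eq_is_derive; apply: filterS (nearball _ yx) => z zx.
  by case: (D1 i z zx).
split.
- exact: (continuous_rowP (S F') y).1 (cS _ cF' y) A.
- by move=> i; split; [case: (D1 i y yx)|case: (D2 i)].
- transitivity (\sum_i K i i y 0 A); first by apply: eq_bigr => i _; case: (D2 i).
  by rewrite -summxE lapK// mxE.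
Qed.

End DiracSystem.

(** * Clifford algebras and regular pairs *)

Section HarmonicRows.
Context {R : realType} {V : normedModType R} {I : finType} {N : nat}.
Variables (e : I -> V) (c : I -> V -> R).
Hypothesis ec : coord_system e c.
Implicit Types (D : set V) (F : V -> 'rV[R]_N) (x y : V).

Definition harmonic_rows D F : Prop := forall x A, D x ->
  exists2 r : R, 0 < r & harmonic_approx e x r (fun y => F y 0 A).

Lemma harmonic_approx_eq x (r : R) (u w : V -> R) :
  (forall y, `|y - x| < r -> u y = w y) ->
  harmonic_approx e x r u -> harmonic_approx e x r w.
Proof.
move=> uw H eps /H[v vH vu]; exists v => // y yx.
by rewrite -uw//; exact: vu.
Qed.

Variable D : set V.
Hypothesis oD : open D.

Lemma harmonic_rows_continuous F x : harmonic_rows D F -> D x -> {for x, continuous F}.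
Proof.
move=> HF Dx; apply/continuous_rowP => A; have [r r0 H] := HF _ A Dx.
by apply: harmonic_approx_continuous H _; rewrite subrr normr0.
Qed.

Lemma harmonic_rows_is_derive F x i : harmonic_rows D F -> D x ->
  is_derive x (e i) F ('D_(e i) F x).
Proof.
move=> HF Dx; apply: derivableP; apply/derivable_mxP => k A; rewrite ord1.
have [r r0 /(harmonic_approx_derive ec i r0)[d d0 [Dd _]]] := HF _ A Dx.
by apply: Dd; rewrite subrr normr0.
Qed.

(** Stability of the class under differentiation; by iteration, its members have derivatives of all
    orders. *)
Lemma harmonic_rows_derive F i : harmonic_rows D F -> harmonic_rows D ('D_(e i) F).
Proof.
move=> HF x A Dx.
have [r r0 /(harmonic_approx_derive ec i r0)[d d0 [_ Hd]]] := HF _ A Dx.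
have /near_normP[d' d'0 DD] := open_nbhs_nbhs (conj oD Dx : open_nbhs x D).
exists (Num.min d d'); first by rewrite lt_min d0.
apply: (@harmonic_approx_eq _ _ ('D_(e i) (fun y => F y 0 A))).
  move=> y; rewrite lt_min => /andP[_ /DD Dy].
  by have /is_derive_rowP/(_ A)[_ ->] := harmonic_rows_is_derive i HF Dy.
by apply: harmonic_approx_sub Hd; rewrite subrr normr0 add0r ge_min lexx.
Qed.

(** The second derivatives belong to the class again, hence are continuous, as the symmetry theorem
    requires. *)
Lemma harmonic_rows_commute F i j x : harmonic_rows D F -> D x ->
  'D_(e j) ('D_(e i) F) x = 'D_(e i) ('D_(e j) F) x.
Proof.
move=> HF Dx; apply/rowP => A.
have nD : \forall y \near x, D y by exact: open_nbhs_nbhs.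
have HD k := harmonic_rows_derive k HF.
have HDD k l := harmonic_rows_derive l (HD k).
apply: (@derive_commute _ _ (fun y => F y 0 A) x (e i) (e j)
  (fun y => 'D_(e i) F y 0 A) (fun y => 'D_(e j) F y 0 A)
  (fun y => 'D_(e j) ('D_(e i) F) y 0 A) (fun y => 'D_(e i) ('D_(e j) F) y 0 A)).
- apply: filterS nD => y Dy.
  exact: (is_derive_rowP _ _ _ _).1 (harmonic_rows_is_derive i HF Dy) A.
- apply: filterS nD => y Dy.
  exact: (is_derive_rowP _ _ _ _).1 (harmonic_rows_is_derive j HF Dy) A.
- apply: filterS nD => y Dy.
  exact: (is_derive_rowP _ _ _ _).1 (harmonic_rows_is_derive j (HD i) Dy) A.
- apply: filterS nD => y Dy.
  exact: (is_derive_rowP _ _ _ _).1 (harmonic_rows_is_derive i (HD j) Dy) A.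
- exact: (continuous_rowP _ x).1 (harmonic_rows_continuous (HDD i j) Dx) A.
- exact: (continuous_rowP _ x).1 (harmonic_rows_continuous (HDD j i) Dx) A.
Qed.

End HarmonicRows.

Section Slice.
Context {R : realType} {p q : nat}.
Local Notation Cl := (clifford R (p + q)).
Local Notation sliceT := ('rV[R]_p.+1 * R)%type.

Definition slice_dir (o : option 'I_p.+1) : sliceT :=
  if o is Some i then dir_xp i else dir_r.

Definition slice_coord (o : option 'I_p.+1) (x : sliceT) : R :=
  if o is Some i then x.1 0 i else x.2.

Lemma slice_coord_system : coord_system slice_dir slice_coord.
Proof.
split.
- move=> [i|] [j|] t x; rewrite /slice_coord /slice_dir /=.
  + by rewrite !mxE eqxx.
  + by rewrite scaler0 mxE mxE add0r mulr0 add0r.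
  + by rewrite scaler0 add0r mulr0 add0r.
  + by [].
- move=> x y d d0; rewrite prod_normE ge_max; split=> [/andP[xy1 xy2] [i|]|H].
  + by apply: le_trans xy1; have := row_coord_norm_le (x.1 - y.1) i; rewrite !mxE.
  + exact: xy2.
  + apply/andP; split; last exact: H None.
    by apply: row_norm_le => // j; have := H (Some j); rewrite !mxE.
- move=> y d.
  have seg (a s : R) : (`|s - a| <= d) = (s \in `[a - d, a + d]).
    by rewrite ler_distl in_itv.
  have c1 : compact [set u : 'rV[R]_p.+1 | forall i, `[y.1 0 i - d, y.1 0 i + d]%classic (u 0 i)].
    apply: (@rV_compact R p.+1 (fun i => `[y.1 0 i - d, y.1 0 i + d]%classic)) => i.
    exact: segment_compact.
  have c2 : compact `[y.2 - d, y.2 + d] by exact: segment_compact.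
  apply: (subclosed_compact _ (compact_setX c1 c2)).
    have /continuous_closedP H : continuous (fun x : sliceT => `|x - y|).
      move=> x; apply: cvg_norm; apply: cvgB; [exact: cvg_id|exact: cvg_cst].
    exact: (H _ (@closed_le R d)).
  move=> x /=; rewrite prod_normE ge_max => /andP[x1 x2]; split => /=.
    move=> i; rewrite -seg; apply: le_trans x1.
    by have := row_coord_norm_le (x.1 - y.1) i; rewrite !mxE.
  by rewrite -seg.
Qed.

End Slice.

(** * Clifford multiplication in matrix form *)

Section CliffordMatrices.
Context {R : realType} {n : nat}.
Local Notation Cl := (clifford R n).
Local Notation N := #|{set 'I_n}|.

(* Left multiplication by [a], as a matrix acting on row vectors. *)
Definition lmul_mx (a : Cl) : 'M[R]_N := \matrix_i (a * (delta_mx 0 i : Cl) : 'rV[R]_N).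

Lemma mul_lmul_mx (a x : Cl) : (x : 'rV[R]_N) *m lmul_mx a = a * x.
Proof.
rewrite mulmx_sum_row [in RHS](row_sum_delta (x : 'rV[R]_N)) mulr_sumr.
by apply: eq_bigr => i _; rewrite rowK; exact: (@scalerAr R Cl).
Qed.

(** The order is reversed because matrices act on rows from the right. *)
Lemma lmul_mxM (a b : Cl) : lmul_mx a *m lmul_mx b = lmul_mx (b * a).
Proof.
apply/row_matrixP => i; rewrite row_mul !rowK -mulrA.
exact: mul_lmul_mx.
Qed.

Lemma lmul_mxD (a b : Cl) : lmul_mx a + lmul_mx b = lmul_mx (a + b).
Proof. by apply/row_matrixP => i; rewrite linearD /= !rowK mulrDl. Qed.

Lemma lmul_mx_scalar (k : R) : lmul_mx k%:A = k%:M.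
Proof.
apply/row_matrixP => i; rewrite rowK -scalerAl mul1r.
by rewrite -scalemx1 linearZ /= row1.
Qed.

Definition e_conj (i : 'I_n.+1) : Cl := if i == ord0 then 1 else - e_ i.

Lemma e_0 : e_ ord0 = 1 :> Cl.
Proof. by rewrite /e_ unlift_none. Qed.

Lemma e_rel (i j : 'I_n.+1) : i != ord0 -> j != ord0 ->
  e_ i * e_ j + e_ j * e_ i = - (2 * (i == j)%:R)%:A :> Cl.
Proof.
rewrite eq_sym => /unlift_some[i' -> _]; rewrite eq_sym => /unlift_some[j' -> _].
by rewrite /e_ !liftK gen_rel (inj_eq lift_inj).
Qed.

(** Polarized form of [conj x * x = |x|^2] for paravectors; [e_rel_conj] is the same for
    [x * conj x]. *)
Lemma e_conj_rel (i j : 'I_n.+1) :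
  e_conj i * e_ j + e_conj j * e_ i = (2 * (i == j)%:R)%:A :> Cl.
Proof.
rewrite /e_conj; have [->|i0] := eqVneq i ord0; have [->|j0] := eqVneq j ord0.
- by rewrite e_0 /= !mulr1 scaler_nat.
- rewrite e_0 mul1r mulr1 subrr.
  by rewrite mulr0 scale0r.
- by rewrite e_0 mul1r mulr1 addNr (negbTE i0) mulr0 scale0r.
- by rewrite !mulNr -opprD e_rel// opprK.
Qed.

Lemma e_rel_conj (i j : 'I_n.+1) :
  e_ i * e_conj j + e_ j * e_conj i = (2 * (i == j)%:R)%:A :> Cl.
Proof.
rewrite /e_conj; have [->|i0] := eqVneq i ord0; have [->|j0] := eqVneq j ord0.
- by rewrite e_0 /= !mulr1 scaler_nat.
- by rewrite e_0 mul1r mulr1 addNr mulr0 scale0r.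
- by rewrite e_0 mul1r mulr1 subrr (negbTE i0) mulr0 scale0r.
- by rewrite !mulrN -opprD e_rel// opprK.
Qed.

End CliffordMatrices.

Section CliffordCalculus.
Context {R : realType} {n : nat} {V : normedModType R}.
Local Notation Cl := (clifford R n).

Lemma is_derive_mulCl (a : Cl) (F : V -> Cl) x v (l : Cl) :
  is_derive x v F l -> is_derive x v (fun y => a * F y) (a * l).
Proof.
move=> D; have := is_derive_mulmxr (lmul_mx a) D; rewrite mul_lmul_mx.
rewrite (_ : (fun y => F y *m lmul_mx a) = (fun y => a * F y))//.
by apply/funext => y; rewrite mul_lmul_mx.
Qed.

Lemma mulCl_continuous (a : Cl) (F : V -> Cl) x :
  {for x, continuous F} -> {for x, continuous (fun y => a * F y)}.
Proof.
move=> /continuous_rowP cF; apply/continuous_rowP => j.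
rewrite (_ : (fun y => _) = fun y => \sum_i F y 0 i * lmul_mx a i j); last first.
  by apply/funext => y; rewrite -mul_lmul_mx mxE.
apply: cvg_big => [|i _]; first exact: add_continuous.
by apply: cvgM; [exact: cF|exact: cvg_cst].
Qed.

End CliffordCalculus.

(** One indexing for all [p + 2] partial derivatives, [None] being the radial one; sealed to keep
    the derivative opaque. *)
HB.lock Definition slice_pd (R : realType) (p q : nat) (o : option 'I_p.+1)
    (F : 'rV[R]_p.+1 * R -> clifford R (p + q)) :
    'rV[R]_p.+1 * R -> clifford R (p + q) :=
  'D_(slice_dir o) F.

(** * Solution pairs of the slice system *)

Section RegularPair.
Context {R : realType} {p q : nat}.
Local Notation Cl := (clifford R (p + q)).
Local Notation sliceT := ('rV[R]_p.+1 * R)%type.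
Local Notation N := #|{set 'I_(p + q)}|.
Implicit Types (D : set sliceT) (F : sliceT -> Cl).

Definition e_p_conj (i : 'I_p.+1) : Cl := e_conj (lshift q i : 'I_(p + q).+1).

Lemma e_p0 : e_p ord0 = 1 :> Cl.
Proof. by rewrite /e_p -[RHS]e_0; congr e_; apply: val_inj. Qed.

Lemma e_p_conjE i : e_p_conj i = if i == ord0 then 1 else - e_p i.
Proof. by rewrite /e_p_conj /e_conj. Qed.

(** The class on which the recursion operates: the system together with the regularity already
    gained, and oddness in the form of the vanishing of [F2] at [r = 0]. It is closed under the
    derivatives in [x_p]. *)
Definition regular_pair D F1 F2 : Prop :=
  [/\ harmonic_rows (@slice_dir R p) D F1, harmonic_rows (@slice_dir R p) D F2,
      forall x, D x ->
        \sum_(i < p.+1) e_p i * slice_pd (Some i) F1 x = slice_pd None F2 x,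
      forall x, D x ->
        \sum_(i < p.+1) e_p_conj i * slice_pd (Some i) F2 x = - slice_pd None F1 x &
      forall xp, D (xp, 0) -> F2 (xp, 0) = 0].

Lemma dirac_op_pE F x :
  dirac_op_p F x = \sum_(i < p.+1) e_p i * slice_pd (Some i) F x.
Proof. by rewrite slice_pd.unlock. Qed.

Lemma d_rE F : d_r F = slice_pd None F.
Proof. by rewrite slice_pd.unlock. Qed.

Lemma dirac_op_p_conjE F x :
  dirac_op_p_conj F x = \sum_(i < p.+1) e_p_conj i * slice_pd (Some i) F x.
Proof.
rewrite slice_pd.unlock [RHS](bigD1 ord0)//= [in RHS]e_p_conjE eqxx mul1r.
congr (_ + _); rewrite -sumrN.
by apply: eq_bigr => i /negbTE i0; rewrite e_p_conjE i0 mulNr.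
Qed.

(** Coefficients of the system for the stacked row [(F1, F2)]. The radial matrix sends [(a, b)] to
    [(- b, a)], which gives the terms [- d_r F2] and [d_r F1]. [diracP] collects the conjugate
    coefficients, with the radial block transposed. *)
Let diracM (o : option 'I_p.+1) : 'M[R]_(N + N) :=
  if o is Some i then block_mx (lmul_mx (e_p i)) 0 0 (lmul_mx (e_p_conj i))
  else block_mx 0 1%:M (- 1%:M) 0.

Let diracP (o : option 'I_p.+1) : 'M[R]_(N + N) :=
  if o is Some i then block_mx (lmul_mx (e_p_conj i)) 0 0 (lmul_mx (e_p i))
  else block_mx 0 (- 1%:M) 1%:M 0.

Let diracMP o o' : diracM o *m diracP o' + diracM o' *m diracP o =
  (2 * (o == o')%:R)%:M.
Proof.
have sE (a : R) : a%:M = block_mx a%:M 0 0 a%:M :> 'M[R]_(N + N).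
  by rewrite -scalar_mx_block.
case: o o' => [i|] [j|]; rewrite /diracM /diracP !mulmx_block add_block_mx;
  rewrite ?(mulmx0, mul0mx, addr0, add0r, mulmx1, mul1mx, mulmxN, mulNmx, opprK).
- rewrite !lmul_mxM !lmul_mxD e_conj_rel e_rel_conj !lmul_mx_scalar sE.
  by rewrite (_ : lshift q j == lshift q i = (Some i == Some j))// eq_sym
     (inj_eq (@lshift_inj _ _)).
- by rewrite addNr subrr mulr0 raddf0 block_mx0.
- by rewrite addNr subrr mulr0 raddf0 block_mx0.
- by rewrite sE mulr1 -raddfD.
Qed.

Let row_dirac_sum (a b : option 'I_p.+1 -> Cl) :
  \sum_o (row_mx (a o) (b o) : 'rV[R]_(N + N)) *m diracM o =
  row_mx (\sum_i e_p i * a (Some i) - b None : Cl)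
         (\sum_i e_p_conj i * b (Some i) + a None : Cl).
Proof.
rewrite (bigD1 None)//= (reindex_onto Some (odflt ord0)) /=; last by case.
rewrite (eq_bigl xpredT) => [|i]; last by rewrite /= eqxx.
rewrite mul_row_block !mulmx0 add0r addr0 mulmx1 mulmxN mulmx1.
rewrite (eq_bigr (fun i => row_mx (e_p i * a (Some i) : Cl)
  (e_p_conj i * b (Some i) : Cl) : 'rV[R]_(N + N))); last first.
  by move=> i _; rewrite mul_row_block !mulmx0 add0r addr0 !mul_lmul_mx.
rewrite [X in _ + X](_ : _ = row_mx (\sum_i e_p i * a (Some i) : Cl)
    (\sum_i e_p_conj i * b (Some i) : Cl)).
  by rewrite add_row_mx [X in row_mx X _]addrC [X in row_mx _ X]addrC.
by elim/big_rec3: _ => [|i u v w _ ->]; rewrite ?row_mx0// add_row_mx.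
Qed.

(** Stacking makes the two equations one system of the kind treated above, and C^1 supplies the
    continuity of its derivatives. At [r = 0] oddness reads [F2 = - F2]. *)
Lemma GSR_regular D f F1 F2 : open D -> GSR D f F1 F2 -> regular_pair D F1 F2.
Proof.
move=> oD [[_ oF2 _] C1 C2 E1 E2].
have c1 x : D x -> {for x, continuous F1}.
  by move=> /C1[/differentiable_continuous].
have c2 x : D x -> {for x, continuous F2}.
  by move=> /C2[/differentiable_continuous].
have S1 x : D x ->
    \sum_(i < p.+1) e_p i * slice_pd (Some i) F1 x = slice_pd None F2 x.
  by move=> /E1/subr0_eq; rewrite dirac_op_pE d_rE.
have S2 x : D x ->
    \sum_(i < p.+1) e_p_conj i * slice_pd (Some i) F2 x = - slice_pd None F1 x.
  by move=> /E2/eqP; rewrite addr_eq0 dirac_op_p_conjE d_rE => /eqP.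
pose F x : 'rV[R]_(N + N) := row_mx (F1 x) (F2 x).
pose G o x : 'rV[R]_(N + N) :=
  row_mx (slice_pd o F1 x) (slice_pd o F2 x).
have rowl (T1 T2 : sliceT -> Cl) k :
    (fun y => (row_mx (T1 y) (T2 y) : 'rV[R]_(N + N)) 0 (lshift N k)) =
    (fun y => T1 y 0 k) by apply/funext => y; rewrite row_mxEl.
have rowr (T1 T2 : sliceT -> Cl) k :
    (fun y => (row_mx (T1 y) (T2 y) : 'rV[R]_(N + N)) 0 (rshift N k)) =
    (fun y => T2 y 0 k) by apply/funext => y; rewrite row_mxEr.
have rowc (T1 T2 : sliceT -> Cl) x : {for x, continuous T1} ->
    {for x, continuous T2} -> {for x, continuous (fun x => row_mx (T1 x) (T2 x))}.
  move=> t1 t2; apply/continuous_rowP => j; case: (split_ordP j) => k ->.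
    by rewrite rowl; exact: (continuous_rowP T1 x).1 t1 k.
  by rewrite rowr; exact: (continuous_rowP T2 x).1 t2 k.
have dF o x : D x -> is_derive x (slice_dir o) F (G o x).
  rewrite /G slice_pd.unlock => Dx; apply/is_derive_rowP => j.
  rewrite /F; case: (split_ordP j) => k ->.
    rewrite row_mxEl rowl.
    apply: (is_derive_rowP _ _ _ _).1; apply: derivableP.
    by apply: diff_derivable; case: (C1 _ Dx).
  rewrite row_mxEr rowr.
  apply: (is_derive_rowP _ _ _ _).1; apply: derivableP.
  by apply: diff_derivable; case: (C2 _ Dx).
have sys x : D x -> \sum_o G o x *m diracM o = 0.
  move=> Dx; rewrite (row_dirac_sum (fun o => slice_pd o F1 x) (fun o => slice_pd o F2 x)).
  by rewrite (S1 _ Dx) (S2 _ Dx) subrr addNr row_mx0.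
have H x A : D x -> exists2 r : R, 0 < r &
    harmonic_approx (@slice_dir R p) x r (fun y => F y 0 A).
  move=> Dx.
  have /near_normP[d d0 DD] := open_nbhs_nbhs (conj oD Dx : open_nbhs x D).
  exists (d / 4); first by rewrite divr_gt0.
  apply: (@dirac_system_harmonic_approx _ _ _ _ _ (@slice_coord_system R p)
    _ _ diracM diracP F G x d A d0 diracMP).
  - by move=> y /DD Dy; apply: rowc; [exact: c1|exact: c2].
  - move=> o y /DD Dy; rewrite /G slice_pd.unlock.
    by apply: rowc; [exact: (C1 _ Dy).2|exact: (C2 _ Dy).2].
  - by move=> o y /DD; exact: dF.
  - by move=> y /DD; exact: sys.
split=> //.
- by move=> x A Dx; have := H x (lshift _ A) Dx; rewrite rowl.
- by move=> x A Dx; have := H x (rshift _ A) Dx; rewrite rowr.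
- move=> xp /oF2; rewrite oppr0 => /eqP; rewrite -addr_eq0 -mulr2n.
  by rewrite -scaler_nat scaler_eq0 pnatr_eq0 => /eqP.
Qed.

Let sumClr (a : 'I_p.+1 -> Cl) (F : 'I_p.+1 -> sliceT -> Cl) (x v : sliceT)
    (l : 'I_p.+1 -> Cl) : (forall i, is_derive x v (F i) (l i)) ->
  is_derive x v (fun y => \sum_i a i * F i y) (\sum_i a i * l i).
Proof. by move=> D; apply: is_derive_bigsum => i; exact: is_derive_mulCl. Qed.

(** Differentiation of a constant coefficient relation: both sides have the same derivative along
    [o], and on the left it is moved inside past the other derivatives. *)
Let sumClr_commute (a : 'I_p.+1 -> Cl) D F (g : sliceT -> Cl) o (x : sliceT) (l : Cl) :
  open D -> harmonic_rows (@slice_dir R p) D F -> D x ->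
  (forall x, D x -> \sum_i a i * slice_pd (Some i) F x = g x) ->
  is_derive x (slice_dir o) g l ->
  \sum_i a i * slice_pd (Some i) (slice_pd o F) x = l.
Proof.
move=> oD HF Dx E Dg; have sc := @slice_coord_system R p.
have Di i : is_derive x (slice_dir o) (slice_pd (Some i) F)
    (slice_pd o (slice_pd (Some i) F) x).
  rewrite slice_pd.unlock.
  exact: (harmonic_rows_is_derive sc o (harmonic_rows_derive sc oD (Some i) HF) Dx).
have D1 := sumClr a Di.
have D2 : is_derive x (slice_dir o) g
    (\sum_i a i * slice_pd o (slice_pd (Some i) F) x).
  apply: (near_eq_is_derive _ D1).
  have nD : \forall y \near x, D y by exact: open_nbhs_nbhs.
  by apply: filterS nD => y /E.
have C i : slice_pd (Some i) (slice_pd o F) x = slice_pd o (slice_pd (Some i) F) x.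
  by rewrite slice_pd.unlock; exact: (harmonic_rows_commute sc oD o (Some i) HF Dx).
have -> : \sum_i a i * slice_pd (Some i) (slice_pd o F) x =
    \sum_i a i * slice_pd o (slice_pd (Some i) F) x :> Cl.
  by apply: eq_bigr => i _; rewrite C.
exact: is_derive_unique D2 Dg.
Qed.

Lemma regular_pair_derive D F1 F2 i : open D -> regular_pair D F1 F2 ->
  regular_pair D (slice_pd (Some i) F1) (slice_pd (Some i) F2).
Proof.
move=> oD [H1 H2 S1 S2 Z].
have sc := @slice_coord_system R p.
have nD x : D x -> \forall y \near x, D y by move=> Dx; exact: open_nbhs_nbhs.
have K1 : harmonic_rows slice_dir D (slice_pd (Some i) F1).
  by rewrite slice_pd.unlock; exact: (harmonic_rows_derive sc oD (Some i) H1).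
have K2 : harmonic_rows slice_dir D (slice_pd (Some i) F2).
  by rewrite slice_pd.unlock; exact: (harmonic_rows_derive sc oD (Some i) H2).
have Dr F x : harmonic_rows slice_dir D F -> D x ->
    is_derive x (slice_dir (Some i)) (slice_pd None F)
      (slice_pd None (slice_pd (Some i) F) x).
  move=> HF Dx; have := harmonic_rows_commute sc oD (Some i) None HF Dx.
  rewrite slice_pd.unlock => ->.
  exact: (harmonic_rows_is_derive sc (Some i) (harmonic_rows_derive sc oD None HF) Dx).
split; [exact: K1|exact: K2| | |].
- by move=> x Dx; exact: (sumClr_commute oD H1 Dx S1 (Dr _ _ H2 Dx)).
- move=> x Dx; apply: (sumClr_commute oD H2 Dx S2).
  exact: (is_deriveN (Dr _ _ H1 Dx)).
- move=> xp Dx; rewrite slice_pd.unlock.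
  (* A step along [x_i] stays on the hyperplane [r = 0], where [F2] vanishes, so the difference
     quotients are zero. *)
  have /is_deriveP D1 := harmonic_rows_is_derive sc (Some i) H2 Dx.
  apply/eqP; rewrite -normr_eq0; apply/eqP/le_anti/andP; split=> //.
  apply/ler_addgt0Pr => eps /D1[d d0 Hd]; rewrite add0r.
  have /near_normP[d' d'0 DD] := nD _ Dx.
  pose t := Num.min d d' / 2.
  have m0 : 0 < Num.min d d' by rewrite lt_min d0.
  have t0 : 0 < t by rewrite divr_gt0.
  have tm : t < Num.min d d' by rewrite ltr_pdivrMr// ltr_pMr// ltr1n.
  have [td td'] : t < d /\ t < d' by move: tm; rewrite lt_min => /andP[].
  have := Hd t; rewrite gt_eqF// gtr0_norm// => /(_ isT td).
  have st : t *: slice_dir (Some i) + (xp, 0) = (t *: delta_mx 0 i + xp, 0) :> sliceT.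
    by rewrite /slice_dir /dir_xp /=; congr (_, _); rewrite /= scaler0 addr0.
  rewrite st !Z//; first by rewrite subr0 scaler0 sub0r normrN.
  rewrite -st; apply: DD; rewrite addrK normrZ gtr0_norm// (le_lt_trans _ td')//.
  by rewrite -[leRHS]mulr1 ler_pM2l//; exact: (norm_dir_le1 sc (Some i)).
Qed.

End RegularPair.

(** * The iterated radial derivatives of a regular pair *)

Section RealLemmas.
Context {R : realType}.
Implicit Types (g : R -> R).

Let mvt0_pos g (g' : R -> R) (t : R) : 0 < t ->
  (forall s, 0 < s < t -> is_derive s (1 : R) g (g' s)) ->
  (forall s, 0 <= s <= t -> {for s, continuous g}) ->
  exists2 s, 0 < `|s| < `|t| & g t - g 0 = t * g' s.
Proof.
move=> t0 Dg cg.
have [] := @MVT R g g' 0 t t0.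
- apply: continuous_in_subspaceT => s /set_mem /=; rewrite in_itv; exact: cg.
- move=> s; rewrite in_itv /= => /andP[s0 st] ->; exists s; last by rewrite subr0 mulrC.
  by rewrite !gtr0_norm// s0.
Qed.

Lemma is_derive_opp_comp g (s l : R) : is_derive (- s) (1 : R) g l ->
  is_derive s (1 : R) (fun s => g (- s)) (- l).
Proof.
move=> /is_deriveP H; apply/is_deriveP => eps /H[d d0 Hd].
exists d => // t t0 td; have := Hd (- t).
rewrite oppr_eq0 normrN => /(_ t0 td).
by rewrite invrN !scaleNr -opprD -opprD normrN opprD opprK.
Qed.

(** Derivatives are taken off [0] only, where the radial recursion may be differentiated; at [0]
    there is continuity. *)
Lemma mvt0 g (g' : R -> R) (t : R) : t != 0 ->
  (forall s, 0 < `|s| < `|t| -> is_derive s (1 : R) g (g' s)) ->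
  (forall s, `|s| <= `|t| -> {for s, continuous g}) ->
  exists2 s, 0 < `|s| < `|t| & g t - g 0 = t * g' s.
Proof.
move=> t0 Dg cg; have [tp|tn|] := ltgtP 0 t; last by move/esym/eqP; rewrite (negbTE t0).
  apply: mvt0_pos => // s /andP[s0 st].
    by apply: Dg; rewrite !gtr0_norm// s0.
  by apply: cg; rewrite (gtr0_norm tp) ger0_norm.
have tn' : 0 < - t by rewrite oppr_gt0.
have [||s s0t] := @mvt0_pos (fun s => g (- s)) (fun s => - g' (- s)) _ tn'.
- move=> s /andP[s0 st]; apply: is_derive_opp_comp; apply: Dg.
  by rewrite normrN (gtr0_norm s0) s0 ltr0_norm.
- move=> s /andP[s0 st]; apply: (@continuous_comp _ _ _ -%R g).
    exact: opp_continuous.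
  by apply: cg; rewrite normrN (ger0_norm s0) ltr0_norm.
- rewrite opprK oppr0 mulrNN => E; exists (- s) => //.
  by rewrite normrN; move: s0t; rewrite normrN.
Qed.

(** By [mvt0] the quotient at [0] is a value of [g'] nearby, so a limit of [g'] at [0] is the
    derivative there. *)
Lemma is_derive_limit g (g' : R -> R) (l : R) (d : R) : 0 < d ->
  (forall s, 0 < `|s| < d -> is_derive s (1 : R) g (g' s)) ->
  (forall s, `|s| < d -> {for s, continuous g}) ->
  (forall eps : R, 0 < eps -> exists2 r : R, 0 < r &
    forall s, 0 < `|s| < r -> `|g' s - l| <= eps) ->
  is_derive (0 : R) (1 : R) g l.
Proof.
move=> d0 Dg cg g'l; apply/is_deriveP => eps eps0.
have [r r0 Hr] := g'l _ eps0.
exists (Num.min d r); first by rewrite lt_min d0.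
move=> t t0; rewrite lt_min => /andP[td tr].
have [||s /andP[s0 st] E] := @mvt0 g g' t t0.
- by move=> s /andP[s0 st]; apply: Dg; rewrite s0 (lt_trans st).
- by move=> s st; apply: cg; exact: le_lt_trans st td.
rewrite addr0 [_%:A]mulr1 E /GRing.scale /= mulKf//.
by apply: Hr; rewrite s0 (lt_trans st).
Qed.

(* Cauchy's mean value theorem for [(s ^+ k.+1 * g s) / s ^+ k.+1]. *)
Lemma odd_quotient g (h : R -> R) k (t : R) : t != 0 ->
  (forall s, 0 < `|s| < `|t| ->
    is_derive s (1 : R) (fun s : R => s ^+ k.+1 * g s) (s ^+ k * h s)) ->
  (forall s, `|s| <= `|t| -> {for s, continuous (fun s : R => s ^+ k.+1 * g s)}) ->
  exists2 s, 0 < `|s| < `|t| & k.+1%:R * g t = h s.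
Proof.
move=> t0 Dg cg.
(* Cauchy's auxiliary function, which vanishes at [0] and at [t]. *)
pose f s := t ^+ k.+1 * (s ^+ k.+1 * g s) - (t ^+ k.+1 * g t) * s ^+ k.+1.
have Df s : 0 < `|s| < `|t| -> is_derive s (1 : R) f
    (t ^+ k.+1 * (s ^+ k * h s) - (t ^+ k.+1 * g t) * (k.+1%:R * s ^+ k)).
  move=> st; have D2 : is_derive s (1 : R) (fun s : R => s ^+ k.+1) (k.+1%:R * s ^+ k).
    by split; [exact: exprn_derivable|rewrite exp_derive /GRing.scale /= mulr1].
  exact: (is_deriveB (is_deriveZ (t ^+ k.+1) (Dg s st)) (is_deriveZ (t ^+ k.+1 * g t) D2)).
have cf s : `|s| <= `|t| -> {for s, continuous f}.
  move=> /cg cgs; apply: cvgB; apply: cvgM => //; try exact: cvg_cst.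
  exact: exprn_continuous.
have [s st] := mvt0 t0 Df cf.
rewrite /f [t ^+ k.+1 * (t ^+ k.+1 * g t)]mulrC subrr.
rewrite !expr0n /= mul0r !mulr0 !subrr.
move/esym/eqP; rewrite mulf_eq0 (negbTE t0) /=.
have s0 : s != 0 by rewrite -normr_gt0; case/andP: st.
rewrite (_ : _ - _ = t ^+ k.+1 * s ^+ k * (h s - k.+1%:R * g t)); last by ring.
rewrite !mulf_eq0 !expf_eq0 (negbTE t0) (negbTE s0) !andbF /=.
by rewrite subr_eq0 => /eqP E; exists s.
Qed.

End RealLemmas.

Lemma is_derive_scaler (R : realType) (V : normedModType R) (N : nat)
    (a : V -> R) (F : V -> 'rV[R]_N) x v (da : R) (dF : 'rV[R]_N) :
  is_derive x v a da -> is_derive x v F dF ->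
  is_derive x v (fun y => a y *: F y) (da *: F x + a x *: dF).
Proof.
move=> Da /is_derive_rowP DF; apply/is_derive_rowP => j; rewrite !mxE.
have := is_deriveM Da (DF j).
rewrite (_ : (fun y => (a y *: F y) 0 j) = a * (fun y => F y 0 j)); last first.
  by apply/funext => y; rewrite mxE.
by move=> H; apply: (is_derive_eq H); rewrite /GRing.scale /= addrC [F x 0 j * _]mulrC.
Qed.

(* Sealed: conversion checks would otherwise unfold the Clifford product. *)
HB.lock Definition dirac_sum (R : realType) (p q : nat)
  (f : 'I_p.+1 -> clifford R (p + q)) : clifford R (p + q) := \sum_i e_p i * f i.
HB.lock Definition dirac_conj_sum (R : realType) (p q : nat)
  (f : 'I_p.+1 -> clifford R (p + q)) : clifford R (p + q) := \sum_i e_p_conj i * f i.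

Section DiracSum.
Context {R : realType} {p q : nat} {V : normedModType R}.
Local Notation Cl := (clifford R (p + q)).

Lemma dirac_sum_eq (f g : 'I_p.+1 -> Cl) : (forall i, f i = g i) -> dirac_sum f = dirac_sum g.
Proof. by move=> fg; congr dirac_sum; apply/funext. Qed.

Lemma dirac_conj_sum_eq (f g : 'I_p.+1 -> Cl) : (forall i, f i = g i) ->
  dirac_conj_sum f = dirac_conj_sum g.
Proof. by move=> fg; congr dirac_conj_sum; apply/funext. Qed.

Lemma dirac_sumZ (a : R) (f : 'I_p.+1 -> Cl) : dirac_sum (fun i => a *: f i) = a *: dirac_sum f.
Proof. by rewrite dirac_sum.unlock scaler_sumr; apply: eq_bigr => i _; rewrite scalerAr. Qed.

Lemma dirac_conj_sumZ (a : R) (f : 'I_p.+1 -> Cl) :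
  dirac_conj_sum (fun i => a *: f i) = a *: dirac_conj_sum f.
Proof.
by rewrite dirac_conj_sum.unlock scaler_sumr; apply: eq_bigr => i _; rewrite scalerAr.
Qed.

Lemma is_derive_dirac_sum (f : 'I_p.+1 -> V -> Cl) (x v : V) (l : 'I_p.+1 -> Cl) :
  (forall i, is_derive x v (f i) (l i)) ->
  is_derive x v (fun y => dirac_sum (f^~ y)) (dirac_sum l).
Proof.
move=> Df; rewrite dirac_sum.unlock; apply: is_derive_bigsum => i.
exact: is_derive_mulCl.
Qed.

Lemma is_derive_dirac_conj_sum (f : 'I_p.+1 -> V -> Cl) (x v : V) (l : 'I_p.+1 -> Cl) :
  (forall i, is_derive x v (f i) (l i)) ->
  is_derive x v (fun y => dirac_conj_sum (f^~ y)) (dirac_conj_sum l).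
Proof.
move=> Df; rewrite dirac_conj_sum.unlock; apply: is_derive_bigsum => i.
exact: is_derive_mulCl.
Qed.

Lemma dirac_sum_continuous (f : 'I_p.+1 -> V -> Cl) (x : V) :
  (forall i, {for x, continuous (f i)}) ->
  {for x, continuous (fun y => dirac_sum (f^~ y))}.
Proof.
move=> cf; rewrite dirac_sum.unlock; apply: cvg_big => [|i _]; first exact: add_continuous.
exact: mulCl_continuous.
Qed.

Lemma dirac_conj_sum_continuous (f : 'I_p.+1 -> V -> Cl) (x : V) :
  (forall i, {for x, continuous (f i)}) ->
  {for x, continuous (fun y => dirac_conj_sum (f^~ y))}.
Proof.
move=> cf; rewrite dirac_conj_sum.unlock; apply: cvg_big => [|i _]; first exact: add_continuous.
exact: mulCl_continuous.
Qed.

End DiracSum.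

Section SliceRecursion.
Context {R : realType} {p q : nat}.
Local Notation Cl := (clifford R (p + q)).
Local Notation sliceT := ('rV[R]_p.+1 * R)%type.
Implicit Types (F : sliceT -> Cl) (x : sliceT) (k : nat).
Local Notation pd i := (slice_pd (Some i)).

(* [(slice_ab k F1 F2).1] is [((1/r) d_r)^k F1] and [(slice_ab k F1 F2).2] is
   [((1/r) d_r)^k (F2 / r)], both with their limits at [r = 0]: thanks to the
   system satisfied by [F1] and [F2], each step can be written without
   differentiating in [r]. *)
Fixpoint slice_ab k F1 F2 : (sliceT -> Cl) * (sliceT -> Cl) :=
  if k is k'.+1 then
    (fun x => - dirac_conj_sum (fun i => (slice_ab k' (pd i F1) (pd i F2)).2 x),
     fun x => if x.2 == 0 then
       (2 * k + 1)%:R^-1 *: dirac_sum (fun i => - dirac_conj_sum (fun j =>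
         (slice_ab k' (pd j (pd i F1)) (pd j (pd i F2))).2 x))
       else (x.2 ^+ 2)^-1 *:
        (dirac_sum (fun i => (slice_ab k' (pd i F1) (pd i F2)).1 x)
          - (2 * k' + 1)%:R *: (slice_ab k' F1 F2).2 x))
  else (F1, fun x => if x.2 == 0 then 1%:R^-1 *: dirac_sum (fun i => pd i F1 x)
                     else x.2^-1 *: F2 x).

End SliceRecursion.

HB.lock Definition slice_a (R : realType) (p q k : nat)
    (F1 F2 : 'rV[R]_p.+1 * R -> clifford R (p + q)) :
    'rV[R]_p.+1 * R -> clifford R (p + q) := (slice_ab k F1 F2).1.
HB.lock Definition slice_b (R : realType) (p q k : nat)
    (F1 F2 : 'rV[R]_p.+1 * R -> clifford R (p + q)) :
    'rV[R]_p.+1 * R -> clifford R (p + q) := (slice_ab k F1 F2).2.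

(** * Calculus of the functions [a_k] and [b_k] *)

Section SliceRecursionTheory.
Context {R : realType} {p q : nat}.
Local Notation Cl := (clifford R (p + q)).
Local Notation sliceT := ('rV[R]_p.+1 * R)%type.
Implicit Types (D : set sliceT) (F : sliceT -> Cl) (x y : sliceT) (k : nat).
Local Notation pd i := (slice_pd (Some i)).

Lemma slice_a0 F1 F2 : slice_a 0 F1 F2 = F1.
Proof. by rewrite slice_a.unlock. Qed.

Lemma slice_aS k F1 F2 x : slice_a k.+1 F1 F2 x =
  - dirac_conj_sum (fun i => slice_b k (pd i F1) (pd i F2) x).
Proof. by rewrite slice_a.unlock slice_b.unlock. Qed.

Lemma slice_b_r0 k F1 F2 x : x.2 = 0 -> slice_b k F1 F2 x =
  (2 * k + 1)%:R^-1 *: dirac_sum (fun i => slice_a k (pd i F1) (pd i F2) x).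
Proof. by move=> x0; case: k => [|k]; rewrite slice_b.unlock slice_a.unlock /= x0 eqxx. Qed.

Lemma slice_b0 F1 F2 x : x.2 != 0 -> slice_b 0 F1 F2 x = x.2^-1 *: F2 x.
Proof. by move=> /negbTE x0; rewrite slice_b.unlock /= x0. Qed.

Lemma slice_bS k F1 F2 x : x.2 != 0 -> slice_b k.+1 F1 F2 x =
  (x.2 ^+ 2)^-1 *: (dirac_sum (fun i => slice_a k (pd i F1) (pd i F2) x)
    - (2 * k + 1)%:R *: slice_b k F1 F2 x).
Proof. by move=> /negbTE x0; rewrite slice_b.unlock slice_a.unlock /= x0. Qed.

(** True by construction: off [r = 0] this is the definition of [b_(k+1)], and at [r = 0], where
    that term disappears, it is the value given to [b_k]. Later computations thereby need no case
    distinction. *)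
Lemma slice_ab_rel k F1 F2 x :
  dirac_sum (fun i => slice_a k (pd i F1) (pd i F2) x) =
  x.2 ^+ 2 *: slice_b k.+1 F1 F2 x + (2 * k + 1)%:R *: slice_b k F1 F2 x.
Proof.
have [x0|x0] := eqVneq x.2 0.
  rewrite x0 expr0n scale0r add0r (slice_b_r0 _ _ _ x0) scalerA divff ?scale1r//.
by rewrite (slice_bS _ _ _ x0) scalerA divff ?sqrf_eq0// scale1r subrK.
Qed.

Variable D : set sliceT.
Hypothesis oD : open D.

Lemma near_D x : D x -> \forall y \near x, D y.
Proof. by move=> Dx; exact: open_nbhs_nbhs. Qed.

Let pd_eq o F G : (forall x, D x -> F x = G x) ->
  forall x, D x -> slice_pd o F x = slice_pd o G x.
Proof.
move=> FG x Dx; rewrite slice_pd.unlock; apply: (@near_eq_derive R _ _ F G x (slice_dir o)).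
by apply: filterS (near_D Dx) => y; exact: FG.
Qed.

(** Derivatives taken in different orders agree on [D] only, while the recursion is applied to total
    functions; openness of [D] propagates such equalities to derivatives. *)
Lemma slice_ab_eq k F1 F2 G1 G2 :
    (forall x, D x -> F1 x = G1 x) -> (forall x, D x -> F2 x = G2 x) ->
  forall x, D x -> slice_a k F1 F2 x = slice_a k G1 G2 x /\
                   slice_b k F1 F2 x = slice_b k G1 G2 x.
Proof.
elim: k F1 F2 G1 G2 => [|k IH] F1 F2 G1 G2 E1 E2 x Dx.
  split; first by rewrite !slice_a0 E1.
  have [x0|x0] := eqVneq x.2 0; last by rewrite !(slice_b0 _ _ x0) E2.
  rewrite !(slice_b_r0 _ _ _ x0).
  have E i : slice_a 0 (pd i F1) (pd i F2) x = slice_a 0 (pd i G1) (pd i G2) x.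
    by rewrite !slice_a0; exact: (pd_eq (Some i) E1).
  by rewrite (dirac_sum_eq E).
have IHi i y := IH _ _ _ _ (pd_eq (Some i) E1) (pd_eq (Some i) E2) y.
(* At [r = 0] the function [slice_b k.+1] involves second derivatives of the pair. *)
have IHij i j y := IH _ _ _ _ (pd_eq (Some j) (pd_eq (Some i) E1))
  (pd_eq (Some j) (pd_eq (Some i) E2)) y.
split.
  by rewrite !slice_aS (dirac_conj_sum_eq (fun i => (IHi i x Dx).2)).
have [x0|x0] := eqVneq x.2 0; last first.
  rewrite !(slice_bS _ _ _ x0) (IH _ _ _ _ E1 E2 _ Dx).2.
  by rewrite (dirac_sum_eq (fun i => (IHi i x Dx).1)).
rewrite !(slice_b_r0 _ _ _ x0).
have E i : slice_a k.+1 (pd i F1) (pd i F2) x = slice_a k.+1 (pd i G1) (pd i G2) x.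
  by rewrite !slice_aS (dirac_conj_sum_eq (fun j => (IHij i j x Dx).2)).
by rewrite (dirac_sum_eq E).
Qed.

Lemma slice_pd_commute F i j x : harmonic_rows (@slice_dir R p) D F -> D x ->
  slice_pd i (slice_pd j F) x = slice_pd j (slice_pd i F) x.
Proof.
by rewrite slice_pd.unlock; exact: (harmonic_rows_commute (@slice_coord_system R p) oD j i).
Qed.

Lemma slice_ab_commute k F1 F2 i j x : regular_pair D F1 F2 -> D x ->
  slice_a k (pd i (pd j F1)) (pd i (pd j F2)) x =
    slice_a k (pd j (pd i F1)) (pd j (pd i F2)) x /\
  slice_b k (pd i (pd j F1)) (pd i (pd j F2)) x =
    slice_b k (pd j (pd i F1)) (pd j (pd i F2)) x.
Proof.
by move=> [H1 H2 _ _ _]; apply: slice_ab_eq => y; exact: slice_pd_commute.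
Qed.

Lemma slice_b0_r F1 F2 x : regular_pair D F1 F2 -> D x ->
  x.2 *: slice_b 0 F1 F2 x = F2 x.
Proof.
move=> [_ _ _ _ Z] Dx; have [x0|x0] := eqVneq x.2 0; last first.
  by rewrite (slice_b0 _ _ x0) scalerA divff// scale1r.
by rewrite x0 scale0r; move: x x0 Dx => [xp r] /= -> /Z.
Qed.

(** A step in [x_p] leaves [r] unchanged, so the case distinction in [slice_b] is constant along it
    and each branch may be differentiated alone. *)
Let is_derive_fixed_r F G i x (l : Cl) : (forall y, y.2 = x.2 -> G y = F y) ->
  is_derive x (slice_dir (Some i)) F l -> is_derive x (slice_dir (Some i)) G l.
Proof.
move=> FG /is_deriveP H; apply/is_deriveP => eps /H[d d0 Hd].
exists d => // t t0 td; have := Hd t t0 td; rewrite !FG//.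
by rewrite /= scaler0 add0r.
Qed.

Let pd_is_derive F o x : harmonic_rows (@slice_dir R p) D F -> D x ->
  is_derive x (slice_dir o) F (slice_pd o F x).
Proof.
rewrite slice_pd.unlock.
exact: (harmonic_rows_is_derive (@slice_coord_system R p) o).
Qed.

Let regD i F1 F2 := @regular_pair_derive R p q D F1 F2 i oD.

(** By induction over all pairs: level [k + 1] is made of level [k] for differentiated pairs, and
    [slice_ab_commute] restores the order of the derivatives. *)
Lemma is_derive_slice_ab_xp k F1 F2 i x : regular_pair D F1 F2 -> D x ->
  is_derive x (slice_dir (Some i)) (slice_a k F1 F2) (slice_a k (pd i F1) (pd i F2) x) /\
  is_derive x (slice_dir (Some i)) (slice_b k F1 F2) (slice_b k (pd i F1) (pd i F2) x).
Proof.
elim: k F1 F2 => [|k IH] F1 F2 reg Dx.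
  have Da (G1 G2 : sliceT -> Cl) : regular_pair D G1 G2 ->
      is_derive x (slice_dir (Some i)) (slice_a 0 G1 G2) (slice_a 0 (pd i G1) (pd i G2) x).
    by move=> [H1 _ _ _ _]; rewrite !slice_a0; exact: pd_is_derive.
  split; first exact: Da.
  have [x0|x0] := eqVneq x.2 0.
    rewrite (slice_b_r0 _ _ _ x0).
    rewrite (dirac_sum_eq (fun j => (slice_ab_commute 0 j i reg Dx).1)).
    apply: (@is_derive_fixed_r (fun y => (2 * 0 + 1)%:R^-1 *: dirac_sum
        (fun j => slice_a 0 (pd j F1) (pd j F2) y))).
      by move=> y yx; rewrite slice_b_r0// yx.
    apply: is_deriveZ.
    by apply: (is_derive_dirac_sum (fun j => Da _ _ (regD j reg))).
  rewrite (slice_b0 _ _ x0).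
  apply: (@is_derive_fixed_r (fun y => x.2^-1 *: F2 y)).
    by move=> y yx; rewrite slice_b0 ?yx.
  by apply: is_deriveZ; apply: pd_is_derive => //; case: reg.
have Db j := (IH _ _ (regD j reg) Dx).2.
have Da (G1 G2 : sliceT -> Cl) : regular_pair D G1 G2 ->
    is_derive x (slice_dir (Some i)) (slice_a k.+1 G1 G2) (slice_a k.+1 (pd i G1) (pd i G2) x).
  move=> regG; rewrite slice_aS.
  rewrite (dirac_conj_sum_eq (fun j => (slice_ab_commute k j i regG Dx).2)).
  apply: (@is_derive_fixed_r (fun y => - dirac_conj_sum
      (fun j => slice_b k (pd j G1) (pd j G2) y))).
    by move=> y _; rewrite slice_aS.
  apply: is_deriveN.
  by apply: (is_derive_dirac_conj_sum (fun j => (IH _ _ (regD j regG) Dx).2)).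
split; first exact: Da.
have [x0|x0] := eqVneq x.2 0.
  rewrite (slice_b_r0 _ _ _ x0).
  rewrite (dirac_sum_eq (fun j => (slice_ab_commute k.+1 j i reg Dx).1)).
  apply: (@is_derive_fixed_r (fun y => (2 * k.+1 + 1)%:R^-1 *: dirac_sum
      (fun j => slice_a k.+1 (pd j F1) (pd j F2) y))).
    by move=> y yx; rewrite slice_b_r0// yx.
  apply: is_deriveZ.
  by apply: (is_derive_dirac_sum (fun j => Da _ _ (regD j reg))).
rewrite (slice_bS _ _ _ x0).
rewrite (dirac_sum_eq (fun j => (slice_ab_commute k j i reg Dx).1)).
apply: (@is_derive_fixed_r (fun y => (x.2 ^+ 2)^-1 *: (dirac_sum
    (fun j => slice_a k (pd j F1) (pd j F2) y) - (2 * k + 1)%:R *: slice_b k F1 F2 y))).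
  by move=> y yx; rewrite slice_bS yx.
apply: is_deriveZ; apply: is_deriveB.
  by apply: (is_derive_dirac_sum (fun j => (IH _ _ (regD j reg) Dx).1)).
by apply: is_deriveZ; exact: (IH _ _ reg Dx).2.
Qed.

Lemma near_r_neq0 x : x.2 != 0 -> \forall y \near x, y.2 != 0.
Proof.
move=> x0; apply/near_normP; exists `|x.2|; first by rewrite normr_gt0.
move=> y; apply: contraTneq => y0; rewrite -leNgt.
have := coord_lipschitz (@slice_coord_system R p) None y x.
by rewrite /= y0 sub0r normrN.
Qed.

Let is_derive_r (g : R -> R) x (l : R) : is_derive x.2 (1 : R) g l ->
  is_derive x (slice_dir None) (fun y => g y.2) l.
Proof.
move=> /is_deriveP H; apply/is_deriveP => eps /H[d d0 Hd].
by exists d => // t t0 td; have := Hd t t0 td.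
Qed.

Let is_derive_expV (n : nat) (r : R) : r != 0 ->
  is_derive r (1 : R) (fun s => (s ^+ n)^-1) (- n%:R * (r ^+ n.+1)^-1).
Proof.
move=> r0; have Dn : is_derive r (1 : R) (fun s : R => s ^+ n) (n%:R * r ^+ n.-1).
  by split; [exact: exprn_derivable|rewrite exp_derive /GRing.scale /= mulr1].
have rn : r ^+ n != 0 by rewrite expf_neq0.
have H := @is_deriveV R (fun s : R => s ^+ n) r _ 1 rn Dn; apply: (is_derive_eq H).
rewrite /GRing.scale /=.
case: n {Dn H} rn => [|n] rn; first by rewrite !mul0r mulr0 oppr0 mul0r.
rewrite /= !mulNr; congr (- _); rewrite !exprS !expr0.
by field; rewrite expf_neq0// r0.
Qed.

Let reg_sum1 F1 F2 x : regular_pair D F1 F2 -> D x ->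
  dirac_sum (fun i => pd i F1 x) = slice_pd None F2 x.
Proof. by move=> [_ _ S _ _] /S; rewrite dirac_sum.unlock. Qed.

Let reg_sum2 F1 F2 x : regular_pair D F1 F2 -> D x ->
  dirac_conj_sum (fun i => pd i F2 x) = - slice_pd None F1 x.
Proof. by move=> [_ _ _ S _] /S; rewrite dirac_conj_sum.unlock. Qed.

(** The base case is the system itself. In the step for [b], the derivative of [(r ^+ 2)^-1]
    contributes [- 2 b_(k+1) / r], which balances the difference between the coefficients [2k + 3]
    and [2k + 1] of two consecutive relations. *)
Lemma is_derive_slice_ab_r k F1 F2 x : regular_pair D F1 F2 -> D x -> x.2 != 0 ->
  is_derive x (slice_dir None) (slice_a k F1 F2) (x.2 *: slice_a k.+1 F1 F2 x) /\
  is_derive x (slice_dir None) (slice_b k F1 F2) (x.2 *: slice_b k.+1 F1 F2 x).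
Proof.
move=> reg Dx x0; elim: k F1 F2 reg => [|k IH] F1 F2 reg.
  have [H1 H2 _ _ _] := reg.
  split.
    rewrite slice_aS slice_a0 scalerN -dirac_conj_sumZ.
    rewrite (dirac_conj_sum_eq (fun i => slice_b0_r (regD i reg) Dx)).
    rewrite (reg_sum2 reg Dx) opprK; exact: pd_is_derive.
  have D2 := is_derive_scaler (is_derive_r (is_derive_expV 1 x0)) (pd_is_derive None H2 Dx).
  have E : \forall y \near x, (y.2 ^+ 1)^-1 *: F2 y = slice_b 0 F1 F2 y.
    by apply: filterS (near_r_neq0 x0) => y y0; rewrite expr1 slice_b0.
  apply: (is_derive_eq (near_eq_is_derive E D2)).
  rewrite (slice_bS _ _ _ x0) (slice_b0 _ _ x0).
  have -> : dirac_sum (fun i => slice_a 0 (pd i F1) (pd i F2) x) = slice_pd None F2 x.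
    rewrite -(reg_sum1 reg Dx); apply: dirac_sum_eq => i.
    by rewrite slice_a0.
  move: (slice_pd None F2 x) (F2 x) => u v.
  rewrite !scalerBr !scalerA addrC -scaleNr; congr (_ *: _ + _ *: _); by field.
have nx := near_r_neq0 x0.
split.
  have D1 := is_deriveN (is_derive_dirac_conj_sum (fun i => (IH _ _ (regD i reg)).2)).
  rewrite dirac_conj_sumZ -scalerN -slice_aS in D1.
  have E : \forall y \near x, - dirac_conj_sum (fun i =>
      slice_b k (pd i F1) (pd i F2) y) = slice_a k.+1 F1 F2 y.
    by apply: filterS nx => y _; rewrite slice_aS.
  exact: near_eq_is_derive E D1.
have D1 : is_derive x (slice_dir None) (fun y => dirac_sum (fun i =>
    slice_a k (pd i F1) (pd i F2) y) - (2 * k + 1)%:R *: slice_b k F1 F2 y)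
    (dirac_sum (fun i => x.2 *: slice_a k.+1 (pd i F1) (pd i F2) x)
      - (2 * k + 1)%:R *: (x.2 *: slice_b k.+1 F1 F2 x)).
  apply: is_deriveB; first by apply: is_derive_dirac_sum => i; exact: (IH _ _ (regD i reg)).1.
  by apply: is_deriveZ; exact: (IH _ _ reg).2.
have D2 := is_derive_scaler (is_derive_r (is_derive_expV 2 x0)) D1.
have E : \forall y \near x, (y.2 ^+ 2)^-1 *: (dirac_sum (fun i =>
    slice_a k (pd i F1) (pd i F2) y) - (2 * k + 1)%:R *: slice_b k F1 F2 y)
    = slice_b k.+1 F1 F2 y.
  by apply: filterS nx => y y0; rewrite (slice_bS _ _ _ y0).
apply: (is_derive_eq (near_eq_is_derive E D2)).
rewrite dirac_sumZ !slice_ab_rel addrK.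
move: (slice_b k.+1 F1 F2 x) (slice_b k.+2 F1 F2 x) => u v.
rewrite !scalerDr !scalerN !scalerA.
apply/rowP => j; rewrite !mxE !natrD !natrM -[k.+1]addn1 natrD; field.
by [].
Qed.

Lemma is_derive_fiber F xp (s : R) (l : Cl) : is_derive (xp, s) (slice_dir None) F l <->
  is_derive s (1 : R) (fun s => F (xp, s)) l.
Proof.
have E (t : R) : t *: slice_dir None + (xp, s) = (xp, t *: 1 + s) :> sliceT.
  by rewrite /slice_dir /dir_r; congr (_, _); rewrite /= scaler0 add0r.
by split=> /is_deriveP H; apply/is_deriveP => eps /H[d d0 Hd];
  exists d => // t t0 td; have := Hd t t0 td; rewrite E.
Qed.

Let fiber_continuous F xp (s : R) : {for (xp, s), continuous F} ->
  {for s, continuous (fun s => F (xp, s))}.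
Proof.
move=> /continuous_normP cF; apply/continuous_normP => eps /cF[d d0 Hd].
exists d => // t ts; apply: Hd.
by rewrite prod_normE gt_max /= subrr normr0 d0.
Qed.

(** Mean value arguments run from [y] along the vertical line to [r = 0]; near a point of that
    hyperplane the whole segment lies in [D]. *)
Let near_fiber x : D x -> x.2 = 0 -> exists2 d : R, 0 < d &
  forall y (s : R), `|y - x| < d -> `|s| <= `|y.2| -> D (y.1, s).
Proof.
move=> Dx x0; have /near_normP[d d0 H] := near_D Dx.
exists d => // y s yx sy; apply: H; apply: le_lt_trans yx.
rewrite !prod_normE /= x0 !subr0 ge_max le_max lexx /=.
by rewrite le_max sy orbT.
Qed.

Let expr_snd_continuous n : continuous (fun y : sliceT => y.2 ^+ n).
Proof.
move=> y; apply: (@continuous_comp _ _ _ (fun y : sliceT => y.2) (fun t : R => t ^+ n)).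
  exact: cvg_snd.
exact: exprn_continuous.
Qed.

(** [odd_quotient] on the vertical segment, applied coordinate by coordinate because the
    intermediate point [s] depends on [A]. *)
Let slice_b_mvt k F1 F2 x (A : 'I_#|{set 'I_(p + q)}|) : regular_pair D F1 F2 ->
  (forall y, D y -> {for y, continuous (fun y => y.2 ^+ (2 * k + 1) *: slice_b k F1 F2 y)}) ->
  x.2 != 0 -> (forall s : R, `|s| <= `|x.2| -> D (x.1, s)) ->
  exists2 s : R, 0 < `|s| < `|x.2| & (2 * k + 1)%:R * slice_b k F1 F2 x 0 A =
    dirac_sum (fun i => slice_a k (pd i F1) (pd i F2) (x.1, s)) 0 A.
Proof.
move=> reg cb x0 Dx; rewrite [x in slice_b _ _ _ x]surjective_pairing addn1.
apply: (@odd_quotient R (fun s => slice_b k F1 F2 (x.1, s) 0 A)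
  (fun s => dirac_sum (fun i => slice_a k (pd i F1) (pd i F2) (x.1, s)) 0 A)) => //.
  move=> s /andP[s0 sx]; rewrite normr_gt0 in s0.
  have Ds := Dx s (ltW sx).
  have /is_derive_rowP/(_ A) Db := (is_derive_fiber _ _ _ _).1 (is_derive_slice_ab_r k reg Ds s0).2.
  have De : is_derive s (1 : R) (fun s : R => s ^+ (2 * k).+1) ((2 * k).+1%:R * s ^+ (2 * k)).
    by split; [exact: exprn_derivable|rewrite exp_derive /GRing.scale /= mulr1].
  apply: (is_derive_eq (is_deriveM De Db)).
  rewrite slice_ab_rel !mxE /GRing.scale /= -addn1 natrD exprD; ring.
have -> : (fun s : R => s ^+ (2 * k).+1 * slice_b k F1 F2 (x.1, s) 0 A) =
    fun s => (s ^+ (2 * k + 1) *: slice_b k F1 F2 (x.1, s)) 0 A.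
  by apply/funext => s; rewrite mxE addn1.
by move=> s /Dx/cb/fiber_continuous/continuous_rowP/(_ A).
Qed.

(** Off [r = 0] one divides by the power of [r]. Near [r = 0], [slice_b_mvt] identifies each
    coordinate of [(2k + 1) b_k] with one of [D_p a_k] at a nearby point, so continuity is inherited
    from [a_k]. *)
Let slice_b_continuous k :
  (forall F1 F2 x, regular_pair D F1 F2 -> D x -> {for x, continuous (slice_a k F1 F2)}) ->
  (forall F1 F2 x, regular_pair D F1 F2 -> D x ->
    {for x, continuous (fun y => y.2 ^+ (2 * k + 1) *: slice_b k F1 F2 y)}) ->
  forall F1 F2 x, regular_pair D F1 F2 -> D x -> {for x, continuous (slice_b k F1 F2)}.
Proof.
move=> ca cb F1 F2 x reg Dx; have [x0|x0] := eqVneq x.2 0; last first.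
  apply: (@near_eq_continuous R sliceT Cl (fun y => (y.2 ^+ (2 * k + 1))^-1 *:
      (y.2 ^+ (2 * k + 1) *: slice_b k F1 F2 y))).
    by apply: filterS (near_r_neq0 x0) => y y0; rewrite scalerA mulVf ?scale1r// expf_neq0.
  apply: continuous_scaler; last exact: cb.
  apply: cvgV; first by rewrite expf_neq0.
  exact: expr_snd_continuous.
pose H y := dirac_sum (fun i => slice_a k (pd i F1) (pd i F2) y).
have /continuous_normP cH : {for x, continuous H}.
  by apply: dirac_sum_continuous => i; exact: ca (regD i reg) Dx.
apply/continuous_normP => eps /cH[d d0 Hd].
have [d' d'0 Dd] := near_fiber Dx x0.
exists (Num.min d d'); first by rewrite lt_min d0.
move=> y; rewrite lt_min => /andP[yd yd'].
have k0 : (2 * k + 1)%:R != 0 :> R by rewrite pnatr_eq0 addn1.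
have k1 : 1 <= (2 * k + 1)%:R :> R by rewrite ler1n addn1.
have eps0 : 0 <= eps by apply: le_trans (Hd x _); rewrite ?subrr ?normr0.
(* If [y.2 = 0], the definition of [b_k] gives the identity with [z = y], so a full neighbourhood of
   [x] is covered. *)
have HA (A : 'I_#|{set 'I_(p + q)}|) : exists2 z : sliceT, `|z - x| < d &
    (2 * k + 1)%:R * slice_b k F1 F2 y 0 A = H z 0 A.
  have [y0|y0] := eqVneq y.2 0.
    by exists y => //; rewrite (slice_b_r0 _ _ _ y0) mxE mulrA divff// mul1r.
  have [s /andP[s0 sy] E] := slice_b_mvt A reg (fun z => @cb F1 F2 z reg) y0
    (fun s => Dd y s yd').
  exists (y.1, s) => //; apply: le_lt_trans yd.
  rewrite !prod_normE /= x0 !subr0 ge_max le_max lexx /=.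
  by rewrite le_max (ltW sy) orbT.
apply: row_norm_le => // A; rewrite !mxE (slice_b_r0 _ _ _ x0).
have [z zx E] := HA A.
rewrite -[slice_b k F1 F2 y 0 A](mulKf k0) E mxE -mulrBr normrM.
rewrite ger0_norm ?invr_ge0// mulrC ler_pdivrMr ?(lt_le_trans ltr01)//.
apply: (@le_trans _ _ eps); last by rewrite ler_peMr.
apply: le_trans (Hd z zx); have := row_coord_norm_le (H z - H x) A.
by rewrite !mxE.
Qed.

(** In the step, [r^(2k+3) b_(k+1) = r^(2k+1) (D_p a_k - (2k+1) b_k)] is continuous by induction,
    also at [r = 0], and [slice_b_continuous] removes the power of [r]. *)
Lemma slice_ab_continuous k F1 F2 x : regular_pair D F1 F2 -> D x ->
  {for x, continuous (slice_a k F1 F2)} /\ {for x, continuous (slice_b k F1 F2)}.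
Proof.
elim: k F1 F2 x => [|k IH].
  have ca F1 F2 x : regular_pair D F1 F2 -> D x -> {for x, continuous (slice_a 0 F1 F2)}.
    move=> [H1 _ _ _ _] Dx; rewrite slice_a0.
    exact: harmonic_rows_continuous H1 Dx.
  move=> F1 F2 x reg Dx; split; first exact: ca.
  refine (slice_b_continuous ca _ reg Dx) => {reg Dx} {}F1 {}F2 {}x reg Dx.
  apply: (@near_eq_continuous R sliceT Cl F2).
    by apply: filterS (near_D Dx) => y Dy; rewrite expr1 (slice_b0_r reg Dy).
  by case: reg => [_ H2 _ _ _]; exact: harmonic_rows_continuous H2 Dx.
have ca F1 F2 x : regular_pair D F1 F2 -> D x -> {for x, continuous (slice_a k.+1 F1 F2)}.
  move=> reg Dx; apply: (@near_eq_continuous R sliceT Cl (fun y =>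
      - dirac_conj_sum (fun i => slice_b k (pd i F1) (pd i F2) y))).
    by apply: filterS (near_D Dx) => y _; rewrite slice_aS.
  apply: cvgN; apply: dirac_conj_sum_continuous => i.
  exact: (IH _ _ _ (regD i reg) Dx).2.
move=> F1 F2 x reg Dx; split; first exact: ca.
refine (slice_b_continuous ca _ reg Dx) => {reg Dx} {}F1 {}F2 {}x reg Dx.
apply: (@near_eq_continuous R sliceT Cl (fun y => y.2 ^+ (2 * k + 1) *:
  (dirac_sum (fun i => slice_a k (pd i F1) (pd i F2) y) -
   (2 * k + 1)%:R *: slice_b k F1 F2 y))).
  apply: filterS (near_D Dx) => y _; rewrite slice_ab_rel addrK scalerA -exprD.
  by rewrite (_ : 2 * k + 1 + 2 = 2 * k.+1 + 1)%N//; rewrite mulnS addnC addnA.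
apply: continuous_scaler; first exact: expr_snd_continuous.
apply: cvgB; first by apply: dirac_sum_continuous => i; exact: (IH _ _ _ (regD i reg) Dx).1.
by apply: cvgZl_tmp; exact: (IH _ _ _ reg Dx).2.
Qed.

Let is_derive_r_extend F (G : sliceT -> Cl) x : D x -> (forall y, D y -> {for y, continuous F}) ->
  {for x, continuous G} ->
  (forall y, D y -> y.2 != 0 -> is_derive y (slice_dir None) F (G y)) ->
  is_derive x (slice_dir None) F (G x).
Proof.
move=> Dx cF /continuous_normP cG DF; have [x0|] := eqVneq x.2 0; last exact: DF.
have [d d0 Dd] := near_fiber Dx x0.
move: x x0 Dx Dd cG => [xp r] /= -> {r} Dx Dd cG.
have fib (s : R) : `|(xp, s) - (xp, 0)| = `|s|.
  rewrite prod_normE /= subrr normr0 subr0; exact/max_idPr.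
have Ds (s : R) : `|s| < d -> D (xp, s).
  by move=> sd; apply: (Dd (xp, s) s) => //; rewrite fib.
apply/is_derive_fiber/is_derive_rowP => A.
apply: (@is_derive_limit R (fun s => F (xp, s) 0 A) (fun s => G (xp, s) 0 A) _ d d0).
- move=> s /andP[s0 sd]; apply: (is_derive_rowP _ _ _ _).1; apply/is_derive_fiber.
  by apply: DF; [exact: Ds|rewrite -normr_gt0].
- by move=> s /Ds/cF/fiber_continuous/continuous_rowP/(_ A).
- move=> eps /cG[r r0 Hr]; exists r => // s /andP[_ sr].
  apply: le_trans (Hr (xp, s) _); last by rewrite fib.
  by have := row_coord_norm_le (G (xp, s) - G (xp, 0)) A; rewrite !mxE.
Qed.

(** The radial rules extend to [r = 0] by [is_derive_limit], since all functions involved are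
    continuous there. *)
Lemma is_derive_slice_ab_dr k F1 F2 x : regular_pair D F1 F2 -> D x ->
  is_derive x (slice_dir None) (slice_a k F1 F2) (x.2 *: slice_a k.+1 F1 F2 x) /\
  is_derive x (slice_dir None) (slice_b k F1 F2) (x.2 *: slice_b k.+1 F1 F2 x).
Proof.
move=> reg Dx; have cr (G : sliceT -> Cl) : {for x, continuous G} ->
    {for x, continuous (fun y => y.2 *: G y)}.
  by apply: continuous_scaler; exact: cvg_snd.
split.
  refine (@is_derive_r_extend _ (fun y => y.2 *: slice_a k.+1 F1 F2 y) x Dx _ _ _).
  - by move=> y Dy; exact: (slice_ab_continuous k reg Dy).1.
  - by apply: cr; exact: (slice_ab_continuous k.+1 reg Dx).1.
  - by move=> y Dy y0; exact: (is_derive_slice_ab_r k reg Dy y0).1.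
refine (@is_derive_r_extend _ (fun y => y.2 *: slice_b k.+1 F1 F2 y) x Dx _ _ _).
- by move=> y Dy; exact: (slice_ab_continuous k reg Dy).2.
- by apply: cr; exact: (slice_ab_continuous k.+1 reg Dx).2.
- by move=> y Dy y0; exact: (is_derive_slice_ab_r k reg Dy y0).2.
Qed.

Let near_D_r x : D x -> x.2 != 0 -> \forall y \near x, D y /\ y.2 != 0.
Proof. by move=> Dx x0; apply: filterI; [exact: near_D|exact: near_r_neq0]. Qed.

Lemma iter_inv_r_d_r_is_derive k F1 F2 x : regular_pair D F1 F2 -> D x -> x.2 != 0 ->
  iter k inv_r_d_r F1 x = slice_a k F1 F2 x /\
  is_derive x (slice_dir None) (iter k inv_r_d_r F1) (x.2 *: slice_a k.+1 F1 F2 x).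
Proof.
move=> reg; elim: k x => [|k IH] x Dx x0.
  split; first by rewrite slice_a0.
  by have := (is_derive_slice_ab_r 0 reg Dx x0).1; rewrite slice_a0.
have E y : D y -> y.2 != 0 -> iter k.+1 inv_r_d_r F1 y = slice_a k.+1 F1 F2 y.
  move=> Dy y0; have [_ Dk] := IH _ Dy y0.
  rewrite iterS /inv_r_d_r d_rE slice_pd.unlock.
  by rewrite (@derive_val _ _ _ _ _ _ _ Dk) scalerA mulVf// scale1r.
split; first exact: E.
apply: near_eq_is_derive (is_derive_slice_ab_r k.+1 reg Dx x0).1.
by apply: filterS (near_D_r Dx x0) => y [Dy y0]; rewrite (E _ Dy y0).
Qed.

(** [F2 = r b_0], and applying the operator to [r b_k] cancels [r] before differentiation:
    [d_r b_k = r b_(k+1)]. *)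
Lemma iter_d_r_inv_r_is_derive k F1 F2 x : regular_pair D F1 F2 -> D x -> x.2 != 0 ->
  iter k d_r_inv_r F2 x = x.2 *: slice_b k F1 F2 x /\
  is_derive x (slice_dir None) (fun y => y.2^-1 *: iter k d_r_inv_r F2 y)
    (x.2 *: slice_b k.+1 F1 F2 x).
Proof.
move=> reg; have step j y : (forall z, D z -> z.2 != 0 ->
      iter j d_r_inv_r F2 z = z.2 *: slice_b j F1 F2 z) -> D y -> y.2 != 0 ->
    is_derive y (slice_dir None) (fun z => z.2^-1 *: iter j d_r_inv_r F2 z)
      (y.2 *: slice_b j.+1 F1 F2 y).
  move=> E Dy y0; apply: near_eq_is_derive (is_derive_slice_ab_r j reg Dy y0).2.
  apply: filterS (near_D_r Dy y0) => z [Dz z0].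
  by rewrite (E _ Dz z0) scalerA mulVf// scale1r.
suff E j y : D y -> y.2 != 0 -> iter j d_r_inv_r F2 y = y.2 *: slice_b j F1 F2 y.
  by move=> Dx x0; split; [exact: E|exact: (step _ _ (E k))].
elim: j y => [|j IH] y Dy y0; first by rewrite (slice_b0_r reg Dy).
rewrite iterS /d_r_inv_r d_rE slice_pd.unlock.
exact: (@derive_val _ _ _ _ _ _ _ (step _ _ IH Dy y0)).
Qed.

Let fiber_limit F (G : sliceT -> Cl) xp : D (xp, 0) -> {for (xp, 0), continuous G} ->
  (forall y, D y -> y.2 != 0 -> F y = G y) ->
  F (xp, s) @[s --> 0^'] --> G (xp, 0).
Proof.
move=> Dx /fiber_continuous/cvg_within_filter cG FG.
have cG' : (fun s : R => G (xp, s)) @ 0^' --> G (xp, 0) by exact: cG.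
apply: cvg_trans cG'; apply: near_eq_cvg.
have [d d0 Dd] := near_fiber Dx erefl.
near=> s; apply/esym/FG => /=; last by near: s; exact: nbhs_dnbhs_neq.
apply: (Dd (xp, s)) => //=.
rewrite prod_normE /= subrr normr0 subr0 gt_max d0.
by near: s; exact: dnbhs0_lt.
Unshelve. all: by end_near.
Qed.

Lemma slice_A_eq k F1 F2 x : regular_pair D F1 F2 -> D x ->
  slice_A k F1 x = slice_a k F1 F2 x.
Proof.
move=> reg Dx; rewrite /slice_A /extend_r0; case: eqP => [x0|/eqP x0]; last first.
  exact: (iter_inv_r_d_r_is_derive k reg Dx x0).1.
move: x x0 Dx => [xp r] /= -> Dx; apply/cvg_lim => //.
apply: (fiber_limit Dx); first exact: (slice_ab_continuous k reg Dx).1.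
by move=> y Dy y0; exact: (iter_inv_r_d_r_is_derive k reg Dy y0).1.
Qed.

Let r_slice_b_continuous k F1 F2 x : regular_pair D F1 F2 -> D x ->
  {for x, continuous (fun y => y.2 *: slice_b k F1 F2 y)}.
Proof.
move=> reg Dx; apply: continuous_scaler; first exact: cvg_snd.
exact: (slice_ab_continuous k reg Dx).2.
Qed.

(** As [b_k] is continuous, the limit at [r = 0] is [0], in agreement with the factor [x.2]. *)
Lemma slice_B_eq k F1 F2 x : regular_pair D F1 F2 -> D x ->
  slice_B k F2 x = x.2 *: slice_b k F1 F2 x.
Proof.
move=> reg Dx; rewrite /slice_B /extend_r0; case: eqP => [x0|/eqP x0]; last first.
  exact: (iter_d_r_inv_r_is_derive k reg Dx x0).1.
move: x x0 Dx => [xp r] /= -> Dx; apply/cvg_lim => //.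
apply: (@fiber_limit _ (fun y => y.2 *: slice_b k F1 F2 y) _ Dx).
  exact: r_slice_b_continuous.
by move=> y Dy y0; exact: (iter_d_r_inv_r_is_derive k reg Dy y0).1.
Qed.

Lemma regular_slice_A_defined m F1 F2 : regular_pair D F1 F2 -> slice_A_defined D m F1.
Proof.
move=> reg; split=> [k x _ Dx x0|xp Dx].
  by have [_ []] := iter_inv_r_d_r_is_derive k reg Dx x0.
apply/cvg_ex; exists (slice_a m F1 F2 (xp, 0)).
apply: (fiber_limit Dx); first exact: (slice_ab_continuous m reg Dx).1.
by move=> y Dy y0; exact: (iter_inv_r_d_r_is_derive m reg Dy y0).1.
Qed.

Lemma regular_slice_B_defined m F1 F2 : regular_pair D F1 F2 -> slice_B_defined D m F2.
Proof.
move=> reg; split=> [k x _ Dx x0|xp Dx].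
  by have [_ []] := iter_d_r_inv_r_is_derive k reg Dx x0.
apply/cvg_ex; exists ((xp, 0).2 *: slice_b m F1 F2 (xp, 0)).
apply: (@fiber_limit _ (fun y => y.2 *: slice_b m F1 F2 y) _ Dx).
  exact: r_slice_b_continuous.
by move=> y Dy y0; exact: (iter_d_r_inv_r_is_derive m reg Dy y0).1.
Qed.

End SliceRecursionTheory.

(** * Continuous partial derivatives *)

Lemma row_coord_continuous (R : realType) n (i : 'I_n) (x : 'rV[R]_n) :
  {for x, continuous (fun y : 'rV[R]_n => y 0 i)}.
Proof. by apply: (continuous_rowP (id : 'rV[R]_n -> _) x).1; exact: cvg_id. Qed.

Section ContinuousPartials.
Context {R : realType} {n N : nat}.
Local Notation V := 'rV[R]_n.
Implicit Types (F : V -> 'rV[R]_N) (dF : 'I_n -> V -> 'rV[R]_N) (x y : V).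
Local Notation basis i := (delta_mx 0 i : V).

Let norm_basis_le1 i : `|basis i| <= 1.
Proof.
apply: row_norm_le => // j; rewrite mxE eqxx /=.
by case: (j == i); rewrite ?normr1 ?normr0.
Qed.

Let combination (l : seq 'I_n) (h : 'I_n -> R) : V := \sum_(i <- l) h i *: basis i.

Let combination_norm_le l h : `|combination l h| <= \sum_(i <- l) `|h i|.
Proof.
rewrite /combination; elim: l => [|i l IH]; first by rewrite !big_nil normr0.
rewrite !big_cons; apply: le_trans (ler_normD _ _) _; apply: lerD => //.
by rewrite normrZ ler_piMr ?norm_basis_le1.
Qed.

Let expansion F dF x (d eps : R) A l h :
  (forall i y, `|y - x| < d -> is_derive y (basis i) F (dF i y)) ->
  (forall i y, `|y - x| < d -> `|dF i y 0 A - dF i x 0 A| <= eps) ->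
  \sum_(i <- l) `|h i| < d ->
  `|F (combination l h + x) 0 A - F x 0 A - \sum_(i <- l) h i * dF i x 0 A|
    <= eps * \sum_(i <- l) `|h i|.
Proof.
move=> DF cF; elim: l => [|i l IH] ld.
  by rewrite /combination !big_nil add0r subrr subr0 normr0 mulr0.
rewrite !big_cons in ld *; pose z := combination l h + x.
have ld' : \sum_(j <- l) `|h j| < d by apply: le_lt_trans ld; rewrite lerDr.
have zx (s : R) : 0 <= s <= 1 -> `|(s * h i) *: basis i + z - x| < d.
  move=> /andP[s0 s1]; rewrite /z addrA addrK; apply: le_lt_trans ld.
  apply: le_trans (ler_normD _ _) _; apply: lerD; last exact: combination_norm_le.
  rewrite normrZ normrM -[leRHS]mulr1 ler_pM ?mulr_ge0//.
  by rewrite ger0_norm// ler_piMl.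
have [s /andP[s0 s1] E] := @mvt_line R V (fun y => F y 0 A) (fun y => dF i y 0 A) z
  (basis i) (h i) (fun s s01 => (is_derive_rowP _ _ _ _).1 (DF i _ (zx s s01)) A).
have -> : combination (i :: l) h + x = h i *: basis i + z.
  by rewrite /combination big_cons addrA.
have IHl := IH ld'.
rewrite (_ : _ - _ = h i * (dF i ((s * h i) *: basis i + z) 0 A - dF i x 0 A) +
  (F z 0 A - F x 0 A - \sum_(j <- l) h j * dF j x 0 A)); last first.
  rewrite mulrBr -E; ring.
apply: le_trans (ler_normD _ _) _; rewrite [leRHS]mulrDr; apply: lerD => //.
by rewrite normrM mulrC ler_wpM2r//; apply/cF/zx; rewrite !ltW.
Qed.

Let gradient dF x : 'M[R]_(n, N) := \matrix_i dF i x.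

Let gradientE dF x (h : V) A : (h *m gradient dF x) 0 A = \sum_i h 0 i * dF i x 0 A.
Proof. by rewrite mxE; apply: eq_bigr => i _; rewrite mxE. Qed.

Let mulmxr_continuous (M : 'M[R]_(n, N)) : continuous (fun h : V => h *m M).
Proof.
move=> h; apply/continuous_rowP => A.
rewrite (_ : (fun y => _) = fun y : V => \sum_i y 0 i * M i A); last first.
  by apply/funext => y; rewrite mxE.
apply: (@continuous_bigsum R V R) => i.
apply: (@continuous_scaler R V R); first exact: row_coord_continuous.
exact: cst_continuous.
Qed.

Variable D : set V.
Hypothesis oD : open D.
Variables (F : V -> 'rV[R]_N) (dF : 'I_n -> V -> 'rV[R]_N).
Hypothesis DF : forall i y, D y -> is_derive y (basis i) F (dF i y).
Hypothesis cF : forall i y, D y -> {for y, continuous (dF i)}.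

Let littleo_remainder x (eps : R) : D x -> 0 < eps ->
  \forall h \near (0 : V), `|F (h + x) - F x - h *m gradient dF x| <= eps * `|h|.
Proof.
(* [n.+1] dominates the sum of the [n] coordinates and is nonzero even for [n = 0]. *)
move=> Dx e0; have e1 : 0 < eps / n.+1%:R by rewrite divr_gt0.
have /near_normP[d d0 H] : \forall y \near x, D y /\
    forall i, `|dF i y - dF i x| <= eps / n.+1%:R.
  apply: filterI; first exact: open_nbhs_nbhs.
  apply: (@near_forall R V) => i; apply/near_normP.
  by have /continuous_normP/(_ _ e1) := @cF i x Dx.
apply/near_normP; exists (d / n.+1%:R); first by rewrite divr_gt0.
move=> h; rewrite subr0 => hd.
have hE : h = combination (index_enum 'I_n) (fun i => h 0 i) by exact: row_sum_delta.
have hn : \sum_i `|h 0 i| <= n.+1%:R * `|h|.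
  apply: (@le_trans _ _ (\sum_(i < n) `|h|)).
    by apply: ler_sum => i _; exact: row_coord_norm_le.
  by rewrite sumr_const card_ord -[leLHS]mulr_natl ler_wpM2r// ler_nat.
apply: row_norm_le => [|A]; first by rewrite mulr_ge0// ltW.
rewrite mxE [in X in X + _]mxE [in X in _ + X]mxE gradientE.
rewrite [(- F x) 0 A]mxE.
have Ex : `|F (h + x) 0 A - F x 0 A - \sum_i h 0 i * dF i x 0 A| <=
    eps / n.+1%:R * \sum_i `|h 0 i|.
  rewrite [in X in F X]hE; apply: (@expansion F dF x d).
  - by move=> i y /H[Dy _]; exact: DF.
  - move=> i y /H[_ /(_ i)]; apply: le_trans.
    by have := row_coord_norm_le (dF i y - dF i x) A; rewrite !mxE.
  - by apply: le_lt_trans hn _; rewrite mulrC -ltr_pdivlMr.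
apply: (le_trans Ex).
rewrite -mulrA ler_pM2l// mulrC ler_pdivrMr// mulrC.
exact: hn.
Qed.

Let differential x : D x -> differentiable F x /\ 'd F x = mulmxr (gradient dF x) :> (V -> _).
Proof.
move=> Dx; apply: differentiable_linear_approx; first exact: mulmxr_continuous.
by move=> eps; exact: littleo_remainder.
Qed.

Lemma C1_on_continuous_partials : C1_on D F.
Proof.
move=> x Dx; split=> [|v]; first exact: (differential Dx).1.
have E : \forall y \near x, v *m gradient dF y = 'D_v F y.
  have nD : \forall y \near x, D y by exact: open_nbhs_nbhs.
  apply: filterS nD => y Dy.
  by have [dfy dE] := differential Dy; rewrite deriveE// dE.
apply: (near_eq_continuous E); apply/continuous_rowP => A.
rewrite (_ : (fun y => _) = fun y : V => \sum_i v 0 i * dF i y 0 A); last first.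
  by apply/funext => y; rewrite gradientE.
apply: (@continuous_bigsum R V R) => i.
apply: (@continuous_scaler R V R); first exact: cst_continuous.
exact: ((continuous_rowP _ _).1 (@cF i x Dx)).
Qed.

End ContinuousPartials.

(** * The completion *)

Section Completion.
Context {R : realType} {p q : nat}.
Local Notation Cl := (clifford R (p + q)).
Local Notation sliceT := ('rV[R]_p.+1 * R)%type.
Local Notation paraT := 'rV[R]_(p.+1 + q).
Implicit Types (D : set sliceT) (x : paraT) (F : sliceT -> Cl).

Definition radius x : R := Num.sqrt (\sum_j x 0 (rshift p.+1 j) ^+ 2).

Definition slice_point x : sliceT := (lsubmx x, radius x).

Let sum_sqr_ge0 x : 0 <= \sum_j x 0 (rshift p.+1 j) ^+ 2.
Proof. by apply: sumr_ge0 => j _; exact: sqr_ge0. Qed.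

Lemma radius_sqr x : radius x ^+ 2 = \sum_j x 0 (rshift p.+1 j) ^+ 2.
Proof. exact: sqr_sqrtr (sum_sqr_ge0 x). Qed.

Lemma radius0 x j : radius x = 0 -> x 0 (rshift p.+1 j) = 0.
Proof.
move=> x0; have /eqP := radius_sqr x; rewrite x0 expr0n eq_sym psumr_eq0 => [|i _].
  by move=> /allP/(_ j); rewrite mem_index_enum /= sqrf_eq0 => /(_ isT)/eqP.
exact: sqr_ge0.
Qed.

Lemma slice_point_row_mx xp (r : R) w : sphere_q w -> 0 <= r ->
  slice_point (row_mx xp (r *: w)) = (xp, r).
Proof.
rewrite /sphere_q /= => w1 r0; rewrite /slice_point row_mxKl; congr (_, _).
rewrite /radius (eq_bigr (fun j => r ^+ 2 * w 0 j ^+ 2)) => [|j _].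
  by rewrite -mulr_sumr w1 mulr1 sqrtr_sqr ger0_norm.
by rewrite row_mxEr mxE exprMn.
Qed.

Lemma completionE D x : (0 < q)%N -> completion D x <-> D (slice_point x).
Proof.
move=> q0; split=> [[xp [r [w [w1 r0 Dr ->]]]]|Dx]; first by rewrite slice_point_row_mx.
exists (lsubmx x), (radius x).
have [x0|x0] := eqVneq (radius x) 0.
  (* For [r = 0] any unit vector will do, and [0 < q] provides one. *)
  exists (delta_mx 0 (Ordinal q0)); split=> //.
  - rewrite /sphere_q /= (bigD1 (Ordinal q0))//= big1 => [|j /negbTE j0].
      by rewrite mxE !eqxx expr1n addr0.
    by rewrite mxE j0 andbF expr0n.
  - exact: sqrtr_ge0.
  - rewrite x0 scale0r -[LHS]hsubmxK; congr row_mx.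
    by apply/rowP => j; rewrite !mxE radius0.
exists ((radius x)^-1 *: rsubmx x); split=> //.
- rewrite /sphere_q /= (eq_bigr (fun j => (radius x)^-1 ^+ 2 * x 0 (rshift p.+1 j) ^+ 2)).
    by rewrite -mulr_sumr -radius_sqr -exprMn mulVf// expr1n.
  by move=> j _; rewrite !mxE exprMn.
- exact: sqrtr_ge0.
- by rewrite scalerA divff// scale1r hsubmxK.
Qed.

Lemma slice_point_continuous : continuous slice_point.
Proof.
move=> x; apply: (@continuous_pair R paraT 'rV[R]_p.+1 R).
  apply: (continuous_rowP (fun x : paraT => lsubmx x) x).2 => j.
  rewrite (_ : (fun y => _) = fun y : paraT => y 0 (lshift q j)); last first.
    by apply/funext => y; rewrite mxE.
  exact: row_coord_continuous.
apply: (@continuous_comp _ _ _ (fun x : paraT => \sum_j x 0 (rshift p.+1 j) ^+ 2 : R) Num.sqrt).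
  apply: (@continuous_bigsum R paraT R) => j.
  apply: (@continuous_comp _ _ _ (fun x : paraT => x 0 (rshift p.+1 j) : R) (fun t : R => t ^+ 2)).
    exact: row_coord_continuous.
  exact: exprn_continuous.
exact: sqrt_continuous.
Qed.

Lemma open_completion D : (0 < q)%N -> open D -> open (completion D : set paraT).
Proof.
move=> q0 oD; rewrite (_ : completion D = slice_point @^-1` D :> set paraT); last first.
  by apply/seteqP; split=> x /(completionE _ _ q0).
by apply: open_comp => // x _; exact: slice_point_continuous.
Qed.

Let slice_point_l (t : R) i x :
  slice_point (t *: delta_mx 0 (lshift q i) + x) = t *: dir_xp i + slice_point x.
Proof.
rewrite /slice_point /dir_xp; congr (_, _).
  by apply/rowP => j; rewrite !mxE (inj_eq (@lshift_inj _ _)).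
rewrite /= scaler0 add0r; congr Num.sqrt; apply: eq_bigr => j _.
by rewrite !mxE eq_rlshift andbF mulr0 add0r.
Qed.

Lemma is_derive_slice_point_l i F x (l : Cl) : is_derive (slice_point x) (dir_xp i) F l ->
  is_derive x (delta_mx 0 (lshift q i)) (fun y => F (slice_point y)) l.
Proof.
move=> /is_deriveP H; apply/is_deriveP => eps /H[d d0 Hd].
by exists d => // t t0 td; have := Hd t t0 td; rewrite slice_point_l.
Qed.

Let slice_point_r (t : R) j x : slice_point (t *: delta_mx 0 (rshift p.+1 j) + x) =
  (lsubmx x, Num.sqrt (1 * t ^+ 2 + 2 * x 0 (rshift p.+1 j) * t + radius x ^+ 2)).
Proof.
rewrite /slice_point; congr (_, _).
  by apply/rowP => i; rewrite !mxE eq_lrshift andbF mulr0 add0r.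
rewrite radius_sqr /radius (bigD1 j)//= [in RHS](bigD1 j)//=; congr Num.sqrt.
rewrite (eq_bigr (fun i => x 0 (rshift p.+1 i) ^+ 2)) => [|i /negbTE ij]; last first.
  by rewrite !mxE eq_rshift ij andbF mulr0 add0r.
by rewrite !mxE !eqxx /=; ring.
Qed.

(** The chain rule off [x_q = 0]. At [x_q = 0] the radius is not differentiable, but the radial
    derivative of [F] there is [radius x *: l = 0], which makes the composite differentiable with
    derivative [0]. *)
Lemma is_derive_slice_point_r j F x (l : Cl) :
  is_derive (slice_point x) dir_r F (radius x *: l) ->
  is_derive x (delta_mx 0 (rshift p.+1 j)) (fun y => F (slice_point y))
    (x 0 (rshift p.+1 j) *: l).
Proof.
have [x0|x0] := eqVneq (radius x) 0.
  rewrite x0 radius0// !scale0r => /is_deriveP H; apply/is_deriveP => eps /H[d d0 Hd].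
  (* Starting from [x_q = 0], an increment [t] leads to the radius [|t|], whatever its sign. *)
  exists d => // t t0 td; have := Hd `|t|; rewrite normr_eq0 normr_id => /(_ t0 td).
  rewrite slice_point_r radius0// x0 mulr0 mul0r addr0 expr0n addr0 mul1r sqrtr_sqr.
  rewrite /slice_point x0 /dir_r !subr0.
  rewrite (_ : `|t| *: (0, 1) + (lsubmx x, 0) = (lsubmx x, `|t|) :> sliceT); last first.
    by congr (_, _); rewrite /= ?scaler0 ?add0r// addr0 [_%:A]mulr1.
  by rewrite !normrZ normfV normr_id normfV.
move=> /is_derive_fiber/is_derive_rowP DF.
have r0 : 0 < radius x by rewrite lt_neqAle eq_sym x0 sqrtr_ge0.
pose S (t : R) : R := 1 * t ^+ 2 + 2 * x 0 (rshift p.+1 j) * t + radius x ^+ 2.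
have S0 : S 0 = radius x ^+ 2 by rewrite /S expr0n !mulr0 !add0r.
have sS0 : Num.sqrt (S 0) = radius x by rewrite S0 sqrtr_sqr gtr0_norm.
have DS := @is_derive_quadratic R 1 (2 * x 0 (rshift p.+1 j)) (radius x ^+ 2) 0.
have Ds : is_derive (S 0) (1 : R) Num.sqrt (2 * Num.sqrt (S 0))^-1.
  by apply: is_derive1_sqrt; rewrite S0 exprn_gt0.
have DsS := is_derive1_comp Ds DS.
apply/is_derive_rowP => A; have DA := DF A; rewrite -sS0 in DA.
have /is_deriveP H := @is_derive1_comp R (fun s : R => F (lsubmx x, s) 0 A)
  (Num.sqrt \o S) 0 _ _ DA DsS.
apply/is_deriveP => eps /H[d d0 Hd]; exists d => // t t0 td; have := Hd t t0 td.
rewrite slice_point_r /= addr0 [_%:A]mulr1 sS0 -/(S t) /slice_point !mxE.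
rewrite (_ : radius x * l 0 A * _ = x 0 (rshift p.+1 j) * l 0 A)//.
by field.
Qed.

End Completion.

(** * Slice functions on the completion *)

Section CliffordIdentities.
Context {R : realType} {p q : nat}.
Local Notation Cl := (clifford R (p + q)).
Implicit Types (w : 'rV[R]_q) (f : 'I_p.+1 -> Cl).

Lemma e_q_rel (i j : 'I_q) :
  e_q i * e_q j + e_q j * e_q i = - (2 * (i == j)%:R)%:A :> Cl.
Proof.
by rewrite /e_q e_rel// -[in LHS]val_eqE /= -[in RHS]val_eqE /= eqn_add2l.
Qed.

Lemma e_q_sqr (j : 'I_q) : e_q j * e_q j = - 1 :> Cl.
Proof.
have /eqP := e_q_rel j j; rewrite eqxx mulr1 -mulr2n -scaler_nat -scalerN.
by rewrite (inj_eq (scalerI _)) ?pnatr_eq0// => /eqP.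
Qed.

(** [e_1, ..., e_p] anticommute with the generators of [x_q] and [e_0] commutes with them, which
    amounts to conjugation. *)
Lemma e_p_vecq (i : 'I_p.+1) w : e_p i * vecq w = vecq w * e_p_conj i :> Cl.
Proof.
rewrite /vecq mulr_sumr mulr_suml; apply: eq_bigr => j _.
rewrite -scalerAr -scalerAl; congr (_ *: _).
rewrite e_p_conjE; have [->|i0] := eqVneq i ord0; first by rewrite e_p0 mul1r mulr1.
apply/eqP; rewrite mulrN -addr_eq0; apply/eqP.
rewrite /e_p /e_q e_rel// -val_eqE.
rewrite (_ : (_ == _) = false) ?mulr0 ?scale0r ?oppr0//.
by apply: ltn_eqF; rewrite /= (leq_trans (ltn_ord i))// leq_addr.
Qed.

Lemma vecq_sqr w : vecq w * vecq w = - (\sum_j w 0 j ^+ 2)%:A :> Cl.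
Proof.
have E : vecq w * vecq w = \sum_i \sum_j (w 0 i * w 0 j) *: (e_q i * e_q j) :> Cl.
  rewrite /vecq mulr_suml; apply: eq_bigr => i _; rewrite mulr_sumr.
  by apply: eq_bigr => j _; rewrite -scalerAl -scalerAr scalerA.
have E' : vecq w * vecq w = \sum_i \sum_j (w 0 i * w 0 j) *: (e_q j * e_q i) :> Cl.
  rewrite E exchange_big; apply: eq_bigr => i _; apply: eq_bigr => j _.
  by rewrite mulrC.
apply: (@scalerI _ Cl (2%:R : R)); first by rewrite pnatr_eq0.
rewrite scaler_nat mulr2n {1}E {1}E' -big_split /=.
rewrite scalerN scalerA mulr_sumr scaler_suml -sumrN; apply: eq_bigr => i _.
rewrite -big_split (bigD1 i)//= big1 ?addr0 => [|j ij].
  by rewrite -scalerDr e_q_rel eqxx mulr1 scalerN scalerA mulrC.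
by rewrite -scalerDr e_q_rel eq_sym (negbTE ij) mulr0 scale0r oppr0 scaler0.
Qed.

Lemma dirac_sum_vecq w f : dirac_sum (fun i => vecq w * f i) = vecq w * dirac_conj_sum f.
Proof.
rewrite dirac_sum.unlock dirac_conj_sum.unlock mulr_sumr; apply: eq_bigr => i _.
by rewrite mulrA e_p_vecq mulrA.
Qed.

(** The sum is added to itself with [i] and [j] interchanged; the relation then cancels the
    off-diagonal terms. *)
Let symmetric_sum (a b : 'I_p.+1 -> Cl) (g : 'I_p.+1 -> 'I_p.+1 -> Cl) :
  (forall i j, a i * b j + a j * b i = (2 * (i == j)%:R)%:A) ->
  (forall i j, g i j = g j i) ->
  \sum_i a i * \sum_j b j * g i j = \sum_i g i i.
Proof.
move=> ab gC.
have E : \sum_i a i * \sum_j b j * g i j = \sum_i \sum_j a i * b j * g i j.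
  by apply: eq_bigr => i _; rewrite mulr_sumr; apply: eq_bigr => j _; rewrite mulrA.
have E' : \sum_i a i * \sum_j b j * g i j = \sum_i \sum_j a j * b i * g i j.
  rewrite E exchange_big; apply: eq_bigr => i _; apply: eq_bigr => j _.
  by rewrite gC.
apply: (@scalerI _ Cl (2%:R : R)); first by rewrite pnatr_eq0.
rewrite scaler_nat mulr2n {1}E {1}E' -big_split scaler_sumr; apply: eq_bigr => i _.
rewrite -big_split (bigD1 i)//= big1 ?addr0 => [|j ij].
  by rewrite -mulrDl ab eqxx mulr1 -scalerAl mul1r.
by rewrite -mulrDl ab eq_sym (negbTE ij) mulr0 scale0r mul0r.
Qed.

Let e_p_conj_rel (i j : 'I_p.+1) :
  e_p_conj i * e_p j + e_p_conj j * e_p i = (2 * (i == j)%:R)%:A :> Cl.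
Proof. by rewrite /e_p_conj /e_p e_conj_rel -[in LHS]val_eqE. Qed.

Let e_p_rel_conj (i j : 'I_p.+1) :
  e_p i * e_p_conj j + e_p j * e_p_conj i = (2 * (i == j)%:R)%:A :> Cl.
Proof. by rewrite /e_p_conj /e_p e_rel_conj -[in LHS]val_eqE. Qed.

Lemma dirac_conj_dirac_sum (g : 'I_p.+1 -> 'I_p.+1 -> Cl) : (forall i j, g i j = g j i) ->
  dirac_conj_sum (fun i => dirac_sum (g i)) = \sum_i g i i.
Proof.
rewrite dirac_sum.unlock dirac_conj_sum.unlock; exact: symmetric_sum e_p_conj_rel.
Qed.

Lemma dirac_dirac_conj_sum (g : 'I_p.+1 -> 'I_p.+1 -> Cl) : (forall i j, g i j = g j i) ->
  dirac_sum (fun i => dirac_conj_sum (g i)) = \sum_i g i i.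
Proof.
rewrite dirac_sum.unlock dirac_conj_sum.unlock; exact: symmetric_sum e_p_rel_conj.
Qed.

End CliffordIdentities.

(** Written with [x_q] rather than [r] times a unit vector, so that no choice has to be made at
    [r = 0]. *)
HB.lock Definition slice_field (R : realType) (p q k : nat)
    (F1 F2 : 'rV[R]_p.+1 * R -> clifford R (p + q)) :
    'rV[R]_(p.+1 + q) -> clifford R (p + q) :=
  fun x => slice_a k F1 F2 (slice_point x) + vecq (rsubmx x) * slice_b k F1 F2 (slice_point x).

(** * Laplacian and Dirac operator of the functions [f_k] *)

Section SliceField.
Context {R : realType} {p q : nat}.
Local Notation Cl := (clifford R (p + q)).
Local Notation sliceT := ('rV[R]_p.+1 * R)%type.
Local Notation paraT := 'rV[R]_(p.+1 + q).
Implicit Types (F : sliceT -> Cl) (f g : paraT -> Cl) (x : paraT) (k : nat).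
Local Notation pd i := (slice_pd (Some i)).

Lemma slice_fieldE k F1 F2 x : slice_field k F1 F2 x =
  slice_a k F1 F2 (slice_point x) + vecq (rsubmx x) * slice_b k F1 F2 (slice_point x).
Proof. by rewrite slice_field.unlock. Qed.

Let vecq_mulE (w : 'rV[R]_q) (a : Cl) : vecq w * a = \sum_j w 0 j *: (e_q j * a).
Proof. by rewrite /vecq mulr_suml; apply: eq_bigr => j _; rewrite scalerAl. Qed.

Let vecq_mul_funE f : (fun y : paraT => vecq (rsubmx y) * f y) =
  fun y : paraT => \sum_j y 0 (rshift p.+1 j) *: (e_q j * f y).
Proof.
apply/funext => y; rewrite vecq_mulE; apply: eq_bigr => j _.
by rewrite mxE.
Qed.

Let is_derive_coord x (v : paraT) i : is_derive x v (fun y : paraT => y 0 i : R) (v 0 i).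
Proof.
apply/is_deriveP => eps e0; exists 1 => // t t0 _.
by rewrite !mxE addrK /GRing.scale /= mulKf// subrr normr0 ltW.
Qed.

Lemma is_derive_vecq_mul f x v (l : Cl) : is_derive x v f l ->
  is_derive x v (fun y => vecq (rsubmx y) * f y)
    (vecq (rsubmx v) * f x + vecq (rsubmx x) * l).
Proof.
move=> Df; rewrite vecq_mul_funE !vecq_mulE -big_split.
apply: is_derive_bigsum => j; rewrite !mxE.
exact: (is_derive_scaler (is_derive_coord x v _) (is_derive_mulCl (e_q j) Df)).
Qed.

Lemma vecq_mul_continuous f x : {for x, continuous f} ->
  {for x, continuous (fun y => vecq (rsubmx y) * f y)}.
Proof.
move=> cf; rewrite vecq_mul_funE; apply: continuous_bigsum => j.
apply: continuous_scaler; first exact: row_coord_continuous.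
exact: mulCl_continuous.
Qed.

Let vecq_l i : vecq (rsubmx (delta_mx 0 (lshift q i) : paraT)) = 0 :> Cl.
Proof.
rewrite /vecq big1// => j _.
by rewrite !mxE eq_rlshift scale0r.
Qed.

Let vecq_r j : vecq (rsubmx (delta_mx 0 (rshift p.+1 j) : paraT)) = e_q j :> Cl.
Proof.
rewrite /vecq (bigD1 j)//= big1 => [|i /negbTE ij].
  by rewrite !mxE !eqxx scale1r addr0.
by rewrite !mxE eq_rshift ij scale0r.
Qed.

Variables (D : set sliceT) (q0 : (0 < q)%N) (oD : open D).
Local Notation Omega := (completion D : set paraT).

Let slice_pointD x : Omega x -> D (slice_point x).
Proof. by move/completionE; exact. Qed.

Lemma is_derive_slice_field_l k F1 F2 i x : regular_pair D F1 F2 -> Omega x ->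
  is_derive x (delta_mx 0 (lshift q i)) (slice_field k F1 F2)
    (slice_field k (pd i F1) (pd i F2) x).
Proof.
move=> reg /slice_pointD Dx; have [Da Db] := is_derive_slice_ab_xp oD k i reg Dx.
have := is_deriveD (is_derive_slice_point_l Da)
  (is_derive_vecq_mul (is_derive_slice_point_l Db)).
by rewrite vecq_l mul0r add0r slice_field.unlock.
Qed.

Lemma is_derive_slice_field_r k F1 F2 j x : regular_pair D F1 F2 -> Omega x ->
  is_derive x (delta_mx 0 (rshift p.+1 j)) (slice_field k F1 F2)
    (x 0 (rshift p.+1 j) *: slice_field k.+1 F1 F2 x +
     e_q j * slice_b k F1 F2 (slice_point x)).
Proof.
move=> reg /slice_pointD Dx; have [Da Db] := is_derive_slice_ab_dr oD k reg Dx.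
have := is_deriveD (is_derive_slice_point_r j Da)
  (is_derive_vecq_mul (is_derive_slice_point_r j Db)).
rewrite vecq_r slice_field.unlock scalerDr -[vecq _ * (_ *: _)]scalerAr.
by rewrite [e_q j * _ + _]addrC addrA.
Qed.

Lemma slice_field_continuous k F1 F2 x : regular_pair D F1 F2 -> Omega x ->
  {for x, continuous (slice_field k F1 F2)}.
Proof.
move=> reg /slice_pointD Dx; have [ca cb] := slice_ab_continuous oD k reg Dx.
have comp (G : sliceT -> Cl) : {for slice_point x, continuous G} ->
    {for x, continuous (fun y => G (slice_point y))}.
  by move=> cG; apply: continuous_comp => //; exact: slice_point_continuous.
rewrite slice_field.unlock.
exact: (continuousD (comp _ ca) (vecq_mul_continuous (comp _ cb))).
Qed.

Let slice_b_point_continuous k F1 F2 x : regular_pair D F1 F2 -> Omega x ->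
  {for x, continuous (fun y => slice_b k F1 F2 (slice_point y))}.
Proof.
move=> reg /slice_pointD Dx; apply: continuous_comp; first exact: slice_point_continuous.
exact: (slice_ab_continuous oD k reg Dx).2.
Qed.

(** A total function for each coordinate of the paravector, in the shape that
    [C1_on_continuous_partials] and the sums over all coordinates expect. *)
Let field_pd k F1 F2 (i : 'I_(p.+1 + q)) x : Cl :=
  match fintype.split i with
  | inl a => slice_field k (pd a F1) (pd a F2) x
  | inr j => x 0 i *: slice_field k.+1 F1 F2 x + e_q j * slice_b k F1 F2 (slice_point x)
  end.

Let field_pd2 k F1 F2 (i : 'I_(p.+1 + q)) x : Cl :=
  match fintype.split i with
  | inl a => slice_field k (pd a (pd a F1)) (pd a (pd a F2)) x
  | inr j => slice_field k.+1 F1 F2 x + (x 0 i ^+ 2) *: slice_field k.+2 F1 F2 x +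
      (2 * x 0 i) *: (e_q j * slice_b k.+1 F1 F2 (slice_point x))
  end.

Let field_pdl k F1 F2 a :
  field_pd k F1 F2 (lshift q a) = slice_field k (pd a F1) (pd a F2).
Proof. by apply/funext => x; rewrite /field_pd (unsplitK (inl a)). Qed.

Let field_pdr k F1 F2 j : field_pd k F1 F2 (rshift p.+1 j) = fun x =>
  x 0 (rshift p.+1 j) *: slice_field k.+1 F1 F2 x + e_q j * slice_b k F1 F2 (slice_point x).
Proof. by apply/funext => x; rewrite /field_pd (unsplitK (inr j)). Qed.

Let field_pd2l k F1 F2 a x : field_pd2 k F1 F2 (lshift q a) x =
  slice_field k (pd a (pd a F1)) (pd a (pd a F2)) x.
Proof. by rewrite /field_pd2 (unsplitK (inl a)). Qed.

Let field_pd2r k F1 F2 j x : field_pd2 k F1 F2 (rshift p.+1 j) x =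
  slice_field k.+1 F1 F2 x + (x 0 (rshift p.+1 j) ^+ 2) *: slice_field k.+2 F1 F2 x +
  (2 * x 0 (rshift p.+1 j)) *: (e_q j * slice_b k.+1 F1 F2 (slice_point x)).
Proof. by rewrite /field_pd2 (unsplitK (inr j)). Qed.

Let is_derive_field k F1 F2 i x : regular_pair D F1 F2 -> Omega x ->
  is_derive x (delta_mx 0 i) (slice_field k F1 F2) (field_pd k F1 F2 i x).
Proof.
move=> reg Ox; case: (split_ordP i) => j ->.
  by rewrite field_pdl; exact: is_derive_slice_field_l.
by rewrite field_pdr; exact: is_derive_slice_field_r.
Qed.

Let field_pd_continuous k F1 F2 i x : regular_pair D F1 F2 -> Omega x ->
  {for x, continuous (field_pd k F1 F2 i)}.
Proof.
move=> reg Ox; case: (split_ordP i) => j ->.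
  rewrite field_pdl; apply: slice_field_continuous => //.
  exact: regular_pair_derive.
rewrite field_pdr; apply: (@continuousD R Cl paraT
    (fun x => x 0 (rshift p.+1 j) *: slice_field k.+1 F1 F2 x)).
  apply: continuous_scaler; first exact: row_coord_continuous.
  exact: slice_field_continuous.
by apply: mulCl_continuous; exact: slice_b_point_continuous.
Qed.

Let is_derive_field_pd k F1 F2 i x : regular_pair D F1 F2 -> Omega x ->
  is_derive x (delta_mx 0 i) (field_pd k F1 F2 i) (field_pd2 k F1 F2 i x).
Proof.
move=> reg Ox; case: (split_ordP i) => j ->.
  by rewrite field_pdl field_pd2l; apply: is_derive_slice_field_l => //; exact: regular_pair_derive.
rewrite field_pdr field_pd2r; have Dx := slice_pointD Ox.
have D1 := is_derive_scaler (is_derive_coord x (delta_mx 0 (rshift p.+1 j)) (rshift p.+1 j))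
  (is_derive_slice_field_r k.+1 j reg Ox).
have D2 := is_derive_mulCl (e_q j)
  (is_derive_slice_point_r j (is_derive_slice_ab_dr oD k reg Dx).2).
apply: (is_derive_eq (is_deriveD D1 D2)).
rewrite mxE !eqxx scale1r scalerDr scalerA -expr2 -[e_q j * (_ *: _)]scalerAr.
move: (e_q j * _) => u; rewrite -!addrA -scalerDl.
by rewrite mulr_natl mulr2n.
Qed.

Let dirac_conj_sumD (u v : 'I_p.+1 -> Cl) :
  dirac_conj_sum (fun i => u i + v i) = dirac_conj_sum u + dirac_conj_sum v.
Proof.
by rewrite dirac_conj_sum.unlock -big_split; apply: eq_bigr => i _; rewrite mulrDr.
Qed.

Let dirac_sumN (u : 'I_p.+1 -> Cl) : dirac_sum (fun i => - u i) = - dirac_sum u.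
Proof. by rewrite dirac_sum.unlock -sumrN; apply: eq_bigr => i _; rewrite mulrN. Qed.

Let slice_aS_sum k F1 F2 (y : sliceT) :
  dirac_conj_sum (fun i => slice_b k (pd i F1) (pd i F2) y) = - slice_a k.+1 F1 F2 y.
Proof. by rewrite slice_aS opprK. Qed.

(** The Laplacian in [x_p] is [conj D_p D_p]: [slice_ab_rel] evaluates [D_p a_k], and the recursion
    for [a] then evaluates [conj D_p] of the result. *)
Let slice_a_laplace k F1 F2 (y : sliceT) : regular_pair D F1 F2 -> D y ->
  \sum_i slice_a k (pd i (pd i F1)) (pd i (pd i F2)) y =
  - (y.2 ^+ 2 *: slice_a k.+2 F1 F2 y + (2 * k + 1)%:R *: slice_a k.+1 F1 F2 y).
Proof.
move=> reg Dy.
rewrite -(@dirac_conj_dirac_sum R p q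
  (fun i j => slice_a k (pd j (pd i F1)) (pd j (pd i F2)) y)); last first.
  by move=> i j; rewrite (slice_ab_commute oD k j i reg Dy).1.
rewrite (dirac_conj_sum_eq (fun i => slice_ab_rel k (pd i F1) (pd i F2) y)).
by rewrite dirac_conj_sumD !dirac_conj_sumZ !slice_aS_sum !scalerN opprD.
Qed.

(** Here the factors come in the order [D_p conj D_p], so that [slice_ab_rel] is applied at level
    [k + 1], which explains the coefficient [2k + 3]. *)
Let slice_b_laplace k F1 F2 (y : sliceT) : regular_pair D F1 F2 -> D y ->
  \sum_i slice_b k (pd i (pd i F1)) (pd i (pd i F2)) y =
  - (y.2 ^+ 2 *: slice_b k.+2 F1 F2 y + (2 * k.+1 + 1)%:R *: slice_b k.+1 F1 F2 y).
Proof.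
move=> reg Dy.
rewrite -(@dirac_dirac_conj_sum R p q
  (fun i j => slice_b k (pd j (pd i F1)) (pd j (pd i F2)) y)); last first.
  by move=> i j; rewrite (slice_ab_commute oD k j i reg Dy).2.
rewrite (dirac_sum_eq (fun i => slice_aS_sum k (pd i F1) (pd i F2) y)).
by rewrite dirac_sumN slice_ab_rel.
Qed.

Let sum_vecq x (a : Cl) : \sum_j x 0 (rshift p.+1 j) *: (e_q j * a) = vecq (rsubmx x) * a.
Proof. by rewrite vecq_mulE; apply: eq_bigr => j _; rewrite mxE. Qed.

(** The directions of [x_q] contribute [q f_(k+1) + r^2 f_(k+2) + 2 x_q b_(k+1)]. The last term
    reduces the coefficient [2k + 3] coming from [b] to the [2k + 1] coming from [a], and the terms
    in [r^2] cancel. *)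
Let sum_field_pd2 k F1 F2 x : regular_pair D F1 F2 -> Omega x ->
  \sum_i field_pd2 k F1 F2 i x =
  (q%:R - (2 * k + 1)%:R) *: slice_field k.+1 F1 F2 x.
Proof.
move=> reg /slice_pointD Dx; rewrite big_split_ord /=.
rewrite (eq_bigr (fun a => slice_field k (pd a (pd a F1)) (pd a (pd a F2)) x)); last first.
  by move=> a _; rewrite field_pd2l.
rewrite [X in _ + X](eq_bigr (fun j => slice_field k.+1 F1 F2 x +
  (x 0 (rshift p.+1 j) ^+ 2) *: slice_field k.+2 F1 F2 x +
  (2 : R) *: (x 0 (rshift p.+1 j) *: (e_q j * slice_b k.+1 F1 F2 (slice_point x))))); last first.
  by move=> j _; rewrite field_pd2r scalerA.
rewrite !big_split /= -scaler_suml -scaler_sumr -radius_sqr sum_vecq.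
rewrite sumr_const card_ord -scaler_nat slice_field.unlock big_split /= -mulr_sumr.
rewrite (slice_a_laplace k reg Dx) (slice_b_laplace k reg Dx) /=.
rewrite mulrN mulrDr -2!scalerAr.
move: (vecq _ * _) (vecq _ * _) (slice_a _ _ _ _) (slice_a _ _ _ _) (radius x) => b1 b2 a1 a2 r.
apply/rowP => A; rewrite !mxE -[k.+1]addn1 mulnDr !natrD; ring.
Qed.

Let near_Omega x : Omega x -> \forall y \near x, Omega y.
Proof. by move=> Ox; apply: open_nbhs_nbhs; split=> //; exact: open_completion. Qed.

Let Omega_derive f g i x (l : Cl) : (forall y, Omega y -> f y = g y) -> Omega x ->
  is_derive x (delta_mx 0 i) g l -> is_derive x (delta_mx 0 i) f l.
Proof.
by move=> fg Ox; apply: near_eq_is_derive; apply: filterS (near_Omega Ox) => y /fg ->.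
Qed.

(** [f] is known on the completion only, which is open; [c] carries the product accumulated by
    earlier iterations. *)
Lemma laplace_slice_field k F1 F2 (c : R) f x : regular_pair D F1 F2 ->
  (forall y, Omega y -> f y = c *: slice_field k F1 F2 y) -> Omega x ->
  laplace_defined f x /\
  laplace f x = (c * (q%:R - (2 * k + 1)%:R)) *: slice_field k.+1 F1 F2 x.
Proof.
move=> reg fE Ox.
have D1 i y : Omega y -> is_derive y (delta_mx 0 i) f (c *: field_pd k F1 F2 i y).
  by move=> Oy; apply: (Omega_derive fE Oy); apply: is_deriveZ; exact: is_derive_field.
have D2 i : is_derive x (delta_mx 0 i) (partial_d i f) (c *: field_pd2 k F1 F2 i x).
  apply: (@Omega_derive _ (fun y => c *: field_pd k F1 F2 i y)) => //.
    by move=> y Oy; exact: (@derive_val _ _ _ _ _ _ _ (D1 i y Oy)).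
  by apply: is_deriveZ; exact: is_derive_field_pd.
split=> [i|]; first by split; [case: (D1 i x Ox)|case: (D2 i)].
rewrite -scalerA -(sum_field_pd2 k reg Ox) scaler_sumr; apply: eq_bigr => i _.
exact: (@derive_val _ _ _ _ _ _ _ (D2 i)).
Qed.

Lemma iter_laplace_slice_field F1 F2 f k x : regular_pair D F1 F2 ->
  (forall y, Omega y -> f y = slice_field 0 F1 F2 y) -> Omega x ->
  iter k laplace f x =
    (\prod_(i < k) (q%:R - (2 * i + 1)%:R)) *: slice_field k F1 F2 x.
Proof.
move=> reg fE; elim: k x => [|k IH] x Ox; first by rewrite big_ord0 scale1r; exact: fE.
by rewrite iterS big_ord_recr; exact: (laplace_slice_field reg IH Ox).2.
Qed.

Lemma slice_field_C1 k F1 F2 f : regular_pair D F1 F2 ->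
  (forall y, Omega y -> f y = slice_field k F1 F2 y) -> C1_on Omega f.
Proof.
move=> reg fE; apply: (@C1_on_continuous_partials R _ _ _ (open_completion q0 oD) f
  (field_pd k F1 F2)).
  by move=> i x Ox; apply: (Omega_derive fE Ox); exact: is_derive_field.
by move=> i x Ox; exact: field_pd_continuous.
Qed.

(** [x_q x_q = - r^2] cancels the terms in [b_(k+1)]; moving [D_p] past [x_q] conjugates it and
    yields [- x_q a_(k+1)], which cancels the contribution of the [x_q] directions; the [q] squares
    [e_j e_j = -1] leave [- q b_k]. *)
Lemma dirac_op_slice_field k F1 F2 f x : regular_pair D F1 F2 ->
  (forall y, Omega y -> f y = slice_field k F1 F2 y) -> Omega x ->
  dirac_op f x = ((2 * k + 1)%:R - q%:R) *: slice_b k F1 F2 (slice_point x).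
Proof.
move=> reg fE Ox.
have pE i : partial_d i f x = field_pd k F1 F2 i x.
  apply: (@derive_val _ _ _ _ _ _ _ _).
  by apply: (Omega_derive fE Ox); exact: is_derive_field.
rewrite /dirac_op big_split_ord /=.
rewrite (eq_bigr (fun a => e_p a * (slice_a k (pd a F1) (pd a F2) (slice_point x)) +
  e_p a * (vecq (rsubmx x) * slice_b k (pd a F1) (pd a F2) (slice_point x)))); last first.
  by move=> a _; rewrite pE field_pdl slice_fieldE mulrDr.
rewrite [X in _ + X](eq_bigr (fun j => x 0 (rshift p.+1 j) *:
    (e_q j * slice_field k.+1 F1 F2 x) - slice_b k F1 F2 (slice_point x))); last first.
  move=> j _; rewrite pE field_pdr mulrDr mulrA e_q_sqr mulN1r.
  by rewrite -scalerAr.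
rewrite !big_split /= sum_vecq sumr_const card_ord -scaler_nat.
have := slice_ab_rel k F1 F2 (slice_point x); rewrite dirac_sum.unlock => ->.
have := dirac_sum_vecq (rsubmx x)
  (fun a => slice_b k (pd a F1) (pd a F2) (slice_point x)).
rewrite dirac_sum.unlock => ->; rewrite slice_aS_sum slice_fieldE mulrDr mulrA vecq_sqr.
rewrite (eq_bigr (fun j => x 0 (rshift p.+1 j) ^+ 2)) => [|j _]; last by rewrite mxE.
rewrite -radius_sqr mulrN mulNr -scalerAl mul1r -[(slice_point x).2]/(radius x).
move: (vecq _ * _) (slice_b _ _ _ _) (slice_b _ _ _ _) (radius x) => a b1 b r.
apply/rowP => A; rewrite !mxE /=; ring.
Qed.

Lemma slice_field_row_mx k F1 F2 xp (r : R) w : sphere_q w -> 0 <= r ->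
  slice_field k F1 F2 (row_mx xp (r *: w)) =
  slice_a k F1 F2 (xp, r) + vecq w * (r *: slice_b k F1 F2 (xp, r)).
Proof.
move=> w1 r0; rewrite slice_fieldE slice_point_row_mx// row_mxKr.
congr (_ + _); rewrite -scalerAr scalerAl; congr (_ * _).
by rewrite /vecq scaler_sumr; apply: eq_bigr => j _; rewrite mxE scalerA.
Qed.

End SliceField.

(** The factor of index [i] is [2 (m - i)], so the product is the double factorial read
    backwards. *)
Lemma even_dfact_prod (R : realType) m :
  \prod_(i < m) ((2 * m).+1%:R - (2 * i + 1)%:R) = (even_dfact m)%:R :> R.
Proof.
rewrite /even_dfact big_add1 /= big_mkord natr_prod (reindex_inj rev_ord_inj) /=.
apply: eq_bigr => i _; rewrite -natrB; last first.
  by rewrite addn1 ltnS leq_mul2l leq_subr orbT.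
congr (_%:R); have := ltn_ord i; rewrite addn1 subSS -mulnBr => im.
by rewrite subKn.
Qed.

Theorem theorem3p8 (R : realType) (p q : nat) (hq : odd q)
    (D : set ('rV[R]_p.+1 * R)) (hD : is_domain D)
    (hsym : reflection_invariant D)
    (F1 F2 : 'rV[R]_p.+1 * R -> clifford R (p + q))
    (f : 'rV[R]_(p.+1 + q) -> clifford R (p + q))
    (hf : GSR D f F1 F2) :
  [/\ forall k x, (k < (q.-1)./2)%N -> completion D x ->
        laplace_defined (iter k laplace f) x,
      slice_A_defined D (q.-1)./2 F1 /\ slice_B_defined D (q.-1)./2 F2,
      has_slice_form D (tau f) (slice_A (q.-1)./2 F1) (slice_B (q.-1)./2 F2) &
      monogenic (completion D) (tau f)].
Proof.
have q0 : (0 < q)%N by case: q hq {F1 F2 f hf}.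
have qE : q = (2 * (q.-1)./2).+1.
  by rewrite -[LHS](prednK q0) mul2n halfK -[in odd _]subn1 oddB// hq subn0.
set m := (q.-1)./2 in qE *; have oD : open D by case: hD.
have reg := GSR_regular oD hf.
have fE x : completion D x -> f x = slice_field 0 F1 F2 x.
  move=> [xp [r [w [w1 r0 Dr ->]]]]; rewrite slice_field_row_mx// slice_a0.
  by rewrite (slice_b0_r reg Dr); case: hf => -[_ _ ->].
have lapE k x := @iter_laplace_slice_field R p q D q0 oD F1 F2 f k x reg fE.
(* An identity on the completion; since this set is open, it determines the derivatives of [tau f]
   there. *)
have tauE x : completion D x -> tau f x = slice_field m F1 F2 x.
  move=> Ox; rewrite /tau -/m lapE// scalerA [X in _ * X](_ : _ = (even_dfact m)%:R).
    rewrite mulVf ?scale1r// pnatr_eq0 -lt0n.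
    by rewrite /even_dfact big_nat; apply: prodn_cond_gt0 => i /andP[i0 _]; rewrite muln_gt0.
  by rewrite -even_dfact_prod; apply: eq_bigr => i _; rewrite [in LHS]qE.
split.
- move=> k x _ Ox.
  exact: (laplace_slice_field q0 oD reg (fun y Oy => lapE k y Oy) Ox).1.
- split; first exact: regular_slice_A_defined oD _ _ _ reg.
  exact: regular_slice_B_defined oD _ _ _ reg.
- move=> xp r w w1 r0 Dr; rewrite tauE; last by exists xp, r, w.
  by rewrite slice_field_row_mx// (slice_A_eq oD _ reg Dr) (slice_B_eq oD _ reg Dr).
- split; first exact: slice_field_C1 tauE.
  (* [q = 2 * m + 1] makes the coefficient of [b_m] vanish. *)
  move=> x Ox; rewrite (dirac_op_slice_field q0 oD reg tauE Ox).
  by rewrite [in X in _ - X]qE addn1 subrr scale0r.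
Qed.
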